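(* Let $T>0$, $r>0$, $d,m\ge 1$, $H\in(\tfrac12,1)$, and let $W^H=(W^{H,1},\dots,W^{H,m})$ be independent fractional Brownian motions with Hurst parameter $H$ on a complete probability space $(\Omega,\mathcal F,\mathbb P)$. Let $0<\beta,\delta\le 1$ with $\beta>1-H$ and $\delta>\frac1H-1$, and let $\rho\ge 2$. Assume that $\sigma:[0,T]\times\mathbb R^d\to\mathbb R^{d\times m}$ is measurable, $\sigma(t,x)$ is differentiable in $x$, and for every $N\ge0$ there is $M_N>0$ such that: (1) $|\sigma(t,x)-\sigma(t,y)|\le M_0|x-y|$ for all $x,y\in\mathbb R^d$, $t\in[0,T]$; (2) $|\partial_{x_i}\sigma(t,x)-\partial_{x_i}\sigma(t,y)|\le M_N|x-y|^\delta$ for all $|x|,|y|\le N$, $t\in[0,T]$, $i=1,\dots,d$; (3) $|\sigma(t,x)-\sigma(s,x)|+|\partial_{x_i}\sigma(t,x)-\partial_{x_i}\sigma(s,x)|\le M_0|t-s|^\beta$ for all $x\in\mathbb R^d$, $s,t\in[0,T]$, $i=1,\dots,d$. Assume that $b:[0,T]\times C(-r,T;\mathbb R^d)\to\mathbb R^d$ is measurable, that for every $t>0$ and $f\in C(-r,T;\mathbb R^d)$ the value $b(t,f)$ depends only on $\{f(s):-r\le s\le t\}$, and that there are $b_0\in L^\rho(0,T)$ and, for every $N\ge 0$, $L_N>0$ such that: (1) $|b(t,x)-b(t,y)|\le L_N\sup_{-r\le s\le t}|x(s)-y(s)|$ for all $x,y$ with $\|x\|_{\infty(r)}\le N$, $\|y\|_{\infty(r)}\le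 N$ and all $t\in[0,T]$; (2) $|b(t,x)|\le L_0\sup_{-r\le s\le t}|x(s)|+b_0(t)$ for all $x\in C(-r,T;\mathbb R^d)$, $t\in[0,T]$. Set $\alpha_0:=\min\{\frac12,\beta,\frac{\delta}{1+\delta}\}$. Let $\alpha\in(1-H,\alpha_0)$, $\rho\ge\frac1\alpha$, and let $\eta\in W_0^{\alpha,\infty}(-r,0;\mathbb R^d)\cap C^{1-\alpha}(-r,0;\mathbb R^d)$ be deterministic. Then the equation $$X^r(t)=\eta(0)+\int_0^t b(s,X^r)\,ds+\int_0^t\sigma(s,X^r(s-r))\,dW^H_s,\quad t\in(0,T],\qquad X^r(t)=\eta(t),\quad t\in[-r,0],$$ has a unique solution $X^r\in L^0(\Omega,\mathcal F,\mathbb P;W_0^{\alpha,\infty}(-r,T;\mathbb R^d))$, and for $\mathbb P$-almost all $\omega\in\Omega$, $X^r(\omega,\cdot)\in C^{1-\alpha}(-r,T;\mathbb R^d)$. Moreover, if in addition there exist $\gamma\in[0,1]$ and $K_0>0$ such that $|\sigma(t,x)|\le K_0(1+|x|^\gamma)$ for all $x\in\mathbb R^d$, $t\in[0,T]$, and $\alpha\in\bigl(1-H,\ \alpha_0\wedge\frac{2-\gamma}{4}\bigr)$, then $E\bigl(\|X^r\|_{\alpha,\infty(r)}^p\bigr)<\infty$ for all $p\ge1$.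
   Context: $C(-r,T;\mathbb R^d)$ is the space of continuous functions $[-r,T]\to\mathbb R^d$, and $\|f\|_{\infty(r)}:=\sup_{s\in[-r,T]}|f(s)|$. For $\alpha\in(0,\frac12)$, $W_0^{\alpha,\infty}(-r,T;\mathbb R^d)$ is the space of measurable $f:[-r,T]\to\mathbb R^d$ with $$\|f\|_{\alpha,\infty(r)}:=\sup_{t\in[-r,T]}\Bigl(|f(t)|+\int_{-r}^t\frac{|f(t)-f(s)|}{(t-s)^{\alpha+1}}ds\Bigr)<\infty .$$ For $\lambda\in(0,1]$, $C^\lambda(-r,T;\mathbb R^d)$ is the space of $\lambda$-Hölder continuous functions $f:[-r,T]\to\mathbb R^d$, with norm $\|f\|_{\lambda(r)}:=\|f\|_{\infty(r)}+\sup_{-r\le s<t\le T}\frac{|f(t)-f(s)|}{(t-s)^\lambda}$. The spaces $W_0^{\alpha,\infty}(-r,0;\mathbb R^d)$ and $C^\lambda(-r,0;\mathbb R^d)$ are defined in the same way with $[-r,T]$ replaced by $[-r,0]$. Elements of $W_0^{\alpha,\infty}$ to which $b(t,\cdot)$ is applied (in particular solutions) are understood to be continuous. $L^0(\Omega,\mathcal F,\mathbb P;E)$ denotes the space of (classes of) $E$-valued random variables. $\wedge$ denotes minimum. The stochastic integral is a pathwise generalized Stieltjes (Zähle) integral: for real functions $f,g$ on $[0,T]$ with $\int_0^T\frac{|f(s)|}{s^\alpha}ds+\int_0^T\int_0^s\frac{|f(s)-f(u)|}{(s-u)^{\alpha+1}}du\,ds<\infty$ and $\sup_{0<s<t<T}\bigl(\frac{|g(t)-g(s)|}{(t-s)^{1-\alpha}}+\int_s^t\frac{|g(u)-g(s)|}{(u-s)^{2-\alpha}}du\bigr)<\infty$,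 $$\int_0^t f\,dg:=\frac{1}{\Gamma(\alpha)\Gamma(1-\alpha)}\int_0^t\Bigl(\frac{f(s)}{s^\alpha}+\alpha\int_0^s\frac{f(s)-f(u)}{(s-u)^{\alpha+1}}du\Bigr)\Bigl(\frac{g(t)-g(s)}{(t-s)^{1-\alpha}}+(1-\alpha)\int_s^t\frac{g(u)-g(s)}{(u-s)^{2-\alpha}}du\Bigr)ds .$$ It coincides with the Riemann–Stieltjes integral when $f,g$ are Hölder continuous with orders summing to more than $1$. For matrix-valued integrands, $\bigl(\int_0^t\sigma\,dW^H\bigr)^i=\sum_{j=1}^m\int_0^t\sigma^{i,j}\,dW^{H,j}$. For $\alpha>1-H$ almost all trajectories of $W^{H}$ satisfy the condition on $g$. A solution is a process whose trajectories satisfy the equation almost surely. *)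

(* Defs.v *)
From mathcomp Require Import all_boot all_order all_algebra.
From mathcomp Require Import all_classical all_reals all_analysis.

Set Implicit Arguments.
Unset Strict Implicit.
Unset Printing Implicit Defensive.
Import Order.TTheory GRing.Theory Num.Theory.
Import numFieldNormedType.Exports.

Local Open Scope classical_set_scope.
Local Open Scope ring_scope.

(* The library norm on matrices is the sup norm of the entries; |.| is the
   Euclidean (Frobenius) one. *)
Definition enorm {R : realType} {p q : nat} (A : 'M[R]_(p, q)) : R :=
  Num.sqrt (\sum_i \sum_j A i j ^+ 2).

(* Functions on an interval [a, c] are represented by functions on the whole
   line; the spaces, norms and sigma-algebras below only see the values taken
   on [a, c]. Norms take their values in the extended reals. *)
Section function_spaces.
Context {R : realType} {d : nat}.
Implicit Types (a c alpha lam : R) (f : R -> 'rV[R]_d).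

Definition supnorm a c f : \bar R :=
  ereal_sup [set (enorm (f s))%:E | s in `[a, c]].

Definition Cspace a c : set (R -> 'rV[R]_d) :=
  [set f : R -> 'rV[R]_d | {within `[a, c], continuous f}].

Definition W0norm alpha a c f : \bar R :=
  ereal_sup [set ((enorm (f t))%:E +
    \int[lebesgue_measure]_(s in `[a, t[)
       (enorm (f t - f s) / (t - s) `^ (alpha + 1))%:E)%E | t in `[a, c]].

Definition W0space alpha a c : set (R -> 'rV[R]_d) :=
  [set f : R -> 'rV[R]_d | (forall i, measurable_fun `[a, c] (fun t => f t ord0 i)) /\
           (W0norm alpha a c f < +oo)%E].

Definition holder_norm lam a c f : \bar R :=
  (supnorm a c f +
   ereal_sup [set (enorm (f p.2 - f p.1) / (p.2 - p.1) `^ lam)%:E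
             | p in [set p : R * R | ([/\ a <= p.1, p.1 < p.2 & p.2 <= c])%R]])%E.

Definition Holder lam a c : set (R -> 'rV[R]_d) :=
  [set f : R -> 'rV[R]_d | (holder_norm lam a c f < +oo)%E].

(* [norm_open E N] are the subsets of E that are open for the norm N;
   [borelType E N] carries the sigma-algebra generated by them, whose trace on
   E is the Borel sigma-algebra of (E, N). *)
Definition norm_open (E : set (R -> 'rV[R]_d)) (N : (R -> 'rV[R]_d) -> \bar R) :
    set_system (R -> 'rV[R]_d) :=
  [set U | U `<=` E /\
     forall f, U f -> exists2 e : R, 0 < e &
       forall g, E g -> (N (g \- f)%R < e%:E)%E -> U g].

Definition borelType (E : set (R -> 'rV[R]_d)) (N : (R -> 'rV[R]_d) -> \bar R) :=
  g_sigma_algebraType (norm_open E N).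

Definition W0cont alpha a c := W0space alpha a c `&` Cspace a c.

End function_spaces.

Section fractional_Brownian_motion.
Context {R : realType} {dO : measure_display} {Omega : measurableType dO}.
Variable P : probability Omega R.

(* A point mass is a (degenerate) Gaussian law; [normal_prob m 0] is not a
   point mass in the library. *)
Definition gaussian_law (X : Omega -> R) : Prop :=
  measurable_fun setT X /\
  exists m s : R, 0 <= s /\
    forall B : set R, measurable B ->
      P (X @^-1` B) = if s == 0 then \d_m B else normal_prob m s B.

Definition gaussian_process (T : R) (B : R -> Omega -> R) : Prop :=
  forall (n : nat) (t : 'I_n -> R) (c : 'I_n -> R),
    (forall k, 0 <= t k <= T) ->
    gaussian_law (fun w => \sum_k c k * B (t k) w).

(* The continuous version, on the time interval [0, T]. *)
Definition is_fBm (H T : R) (B : R -> Omega -> R) : Prop :=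
  [/\ gaussian_process T B,
      forall t, 0 <= t <= T -> ('E_P[B t] = 0)%E,
      forall s t, 0 <= s <= T -> 0 <= t <= T ->
        covariance P (B s) (B t) =
        ((s `^ (2 * H) + t `^ (2 * H) - `|t - s| `^ (2 * H)) / 2)%:E &
      {ae P, forall w, {within `[0, T], continuous (fun t => B t w)}}].

Definition process_sigma (T : R) (B : R -> Omega -> R) : set_system Omega :=
  <<s [set A | exists t, 0 <= t <= T /\
         exists2 D : set R, measurable D & A = B t @^-1` D] >>.

Definition independent_processes (m : nat) (T : R)
    (W : 'I_m -> R -> Omega -> R) : Prop :=
  forall A : 'I_m -> set Omega, (forall j, process_sigma T (W j) (A j)) ->
    P (\bigcap_j A j) = (\prod_j P (A j))%E.

End fractional_Brownian_motion.

Section Zaehle_integral.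
Context {R : realType}.
Implicit Types (alpha T t : R) (f g : R -> R).

Definition Gamma (a : R) : R :=
  \int[lebesgue_measure]_(x in `]0, +oo[) (x `^ (a - 1) * expR (- x)).

Definition zaehle_integrand alpha T f : Prop :=
  measurable_fun `[0, T] f /\
  (\int[lebesgue_measure]_(s in `[0%R, T]) (`|f s| / s `^ alpha)%:E +
   \int[lebesgue_measure]_(s in `[0%R, T])
     \int[lebesgue_measure]_(u in `[0%R, s[)
       (`|f s - f u| / (s - u) `^ (alpha + 1))%:E < +oo)%E.

Definition zaehle_integrator alpha T g : Prop :=
  measurable_fun `[0, T] g /\
  (ereal_sup [set ((`|g p.2 - g p.1| / (p.2 - p.1) `^ (1 - alpha))%:E +
      \int[lebesgue_measure]_(u in `]p.1, p.2[)
        (`|g u - g p.1| / (u - p.1) `^ (2 - alpha))%:E)%E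
    | p in [set p : R * R | ([/\ 0 < p.1, p.1 < p.2 & p.2 < T])%R]] < +oo)%E.

Definition zaehle_int alpha f g t : R :=
  (Gamma alpha * Gamma (1 - alpha))^-1 *
  \int[lebesgue_measure]_(s in `]0, t[)
    ((f s / s `^ alpha +
      alpha * \int[lebesgue_measure]_(u in `]0, s[)
                ((f s - f u) / (s - u) `^ (alpha + 1))) *
     ((g t - g s) / (t - s) `^ (1 - alpha) +
      (1 - alpha) * \int[lebesgue_measure]_(u in `]s, t[)
                ((g u - g s) / (u - s) `^ (2 - alpha)))).

End Zaehle_integral.

Section equation.
Context {R : realType} {d m : nat}.
Implicit Types (sigma : R -> 'rV[R]_d -> 'M[R]_(d, m))
  (b : R -> (R -> 'rV[R]_d) -> 'rV[R]_d).

Definition partial_x sigma (i : 'I_d) (t : R) (x : 'rV[R]_d) : 'M[R]_(d, m) :=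
  'D_(delta_mx ord0 i) (sigma t) x.

Definition sigma_assumption (T beta delta : R) sigma : Prop :=
  (forall i j, measurable_fun (`[0, T] `*` setT)
     (fun p : measurableTypeR R * g_sigma_algebraType (@open 'rV[R]_d) =>
        sigma p.1 p.2 i j)) /\
  (forall t x, 0 <= t <= T -> differentiable (sigma t) x) /\
  exists M : R -> R,
    [/\ forall N, 0 <= N -> 0 < M N,
        forall t x y, 0 <= t <= T ->
          enorm (sigma t x - sigma t y) <= M 0 * enorm (x - y),
        forall N t x y i, 0 <= N -> 0 <= t <= T -> enorm x <= N ->
          enorm y <= N ->
          enorm (partial_x sigma i t x - partial_x sigma i t y)
            <= M N * enorm (x - y) `^ delta &
        forall s t x i, 0 <= s <= T -> 0 <= t <= T ->
          enorm (sigma t x - sigma s x) +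
          enorm (partial_x sigma i t x - partial_x sigma i s x)
            <= M 0 * `|t - s| `^ beta].

Definition b_assumption (r T rho : R) b : Prop :=
  [/\ forall i, @measurable_fun _ _
        (measurableTypeR R *
           borelType (@Cspace R d (- r) T) (supnorm (- r) T))%type
        (measurableTypeR R)
        (`[0, T] `*` Cspace (- r) T) (fun p => b p.1 p.2 ord0 i),
      forall t x y, 0 < t <= T -> Cspace (- r) T x -> Cspace (- r) T y ->
        (forall s, - r <= s <= t -> x s = y s) -> b t x = b t y &
      exists (b0 : R -> R) (L : R -> R),
        [/\ measurable_fun `]0, T[ b0 /\
              (\int[lebesgue_measure]_(t in `]0%R, T[) (`|b0 t| `^ rho)%:E
                 < +oo)%E,
            forall N, 0 <= N -> 0 < L N,
            forall N t x y, 0 <= N -> 0 <= t <= T ->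
              Cspace (- r) T x -> Cspace (- r) T y ->
              (supnorm (- r) T x <= N%:E)%E -> (supnorm (- r) T y <= N%:E)%E ->
              ((enorm (b t x - b t y))%:E
                 <= (L N)%:E * supnorm (- r) t (x \- y)%R)%E &
            forall t x, 0 <= t <= T -> Cspace (- r) T x ->
              ((enorm (b t x))%:E
                 <= (L 0)%:E * supnorm (- r) t x + (b0 t)%:E)%E]].

(* The integrals are total functions, hence the explicit requirement that they
   be well defined. *)
Definition solves_path (alpha r T : R) b sigma (eta : R -> 'rV[R]_d)
    (g : 'I_m -> R -> R) (x : R -> 'rV[R]_d) : Prop :=
  [/\ forall t, - r <= t <= 0 -> x t = eta t,
      forall i, (@lebesgue_measure R).-integrable `[0, T]
                  (fun s => (b s x ord0 i)%:E),
      forall i j, zaehle_integrand alpha T (fun s => sigma s (x (s - r)) i j),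
      forall j, zaehle_integrator alpha T (g j) &
      forall t i, 0 < t <= T ->
        x t ord0 i = eta 0 ord0 i
          + \int[lebesgue_measure]_(s in `[0, t]) b s x ord0 i
          + \sum_j zaehle_int alpha (fun s => sigma s (x (s - r)) i j) (g j) t].

Definition is_solution {dO : measure_display} {Omega : measurableType dO}
    (P : probability Omega R) (W : 'I_m -> R -> Omega -> R)
    (alpha r T : R) b sigma (eta : R -> 'rV[R]_d)
    (X : Omega -> R -> 'rV[R]_d) : Prop :=
  [/\ forall w, W0cont alpha (- r) T (X w),
      measurable_fun setT
        (X : Omega -> borelType (@W0cont R d alpha (- r) T)
                                (W0norm alpha (- r) T)) &
      {ae P, forall w,
         solves_path alpha r T b sigma eta (fun j t => W j t w) (X w)}].

End equation.

(* Main.v *)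
(** Since the delay [r] is positive, the coefficient [sigma (s, X (s - r))] of
    the noise is known on [[0, (k + 1) r]] as soon as [X] is known on [[-r, k r]],
    so the equation is solved step by step: [X_0] solves the equation without
    noise, [X_(k+1)] solves the equation driven by the integral of
    [sigma (s, X_k (s - r))], and [X_(k+1) = X_k] on [[-r, k r]]. Each step is an
    ordinary delay equation [x = eta 0 + z + int b (s, x) ds] with a given
    Hoelder path [z], solved by Picard iteration in an exponentially weighted
    norm.

    The only analytic input is a Young estimate for the Zaehle integral,
    [|I t - I s - kappa f s (g t - g s)| <= K [f] [g] (t - s)^(mu + lam)], for
    Hoelder [f] and [g]. For smooth [f] and [g] both fractional derivatives are
    integrals of [f'] and [g'] against power kernels, and Fubini and the Beta
    integral give [I t = kappa int_0^t f g'] (the value of [kappa] is never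
    needed); the general case follows by approximating with Steklov means.

    As finitely many steps reach [T], the solution is bounded by a polynomial in
    the Hoelder constant of the driving path. By Kolmogorov's dyadic chaining
    argument that constant has moments of all orders for the fractional Brownian
    motion, so the solution has all moments.

    For measurability, a path that is Hoelder with a random measurable constant
    is a measurable function of its values on a grid up to a uniformly small
    error, and on Hoelder balls the uniform topology is finer than the one of
    [W_0^(alpha, infinity)]. *)

Require Import Defs.
From mathcomp Require Import all_boot all_order all_algebra.
From mathcomp Require Import all_classical all_reals all_analysis.
From mathcomp Require Import measurable_realfun zify ring lra.

Set Implicit Arguments.
Unset Strict Implicit.
Unset Printing Implicit Defensive.
Import Order.TTheory GRing.Theory Num.Theory.
Import numFieldNormedType.Exports.

Local Open Scope classical_set_scope.
Local Open Scope ring_scope.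

(** * Lebesgue integrals of power kernels *)

(** The exponents are arranged so that no regularity is lost from one step to the next. Paths are
    kept Hoelder of order [1 - alpha]: the primitive of an [L^rho] drift with [rho >= 1 / alpha] is
    that regular, and [alpha < 1/2] puts this order above [alpha], as the norm of
    [W_0^(alpha, infinity)] requires. Then [sigma (s, X (s - r))] has order
    [min beta (1 - alpha) > alpha] and the driving path an order strictly between [1 - alpha] and
    [H]. These orders sum to more than 1, and the integral is again of order [1 - alpha], powers of
    [T] paying for the difference.

    No paths are glued: every iterate lives on all of [[-r, T]] and is merely correct up to a
    multiple of [r]. Constants are tracked through [1 + C], which each step multiplies by at most a
    factor affine in the Hoelder constant of the driving path. This works because the linear growth
    of [b] alone gives the a priori bound; its local Lipschitz constant is chosen afterwards.

    Kolmogorov's bound holds off a null set, whereas a solution must have all its trajectories in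
    the space; on that null set the driving path is replaced by 0. *)

Section lebesgue_affine.
Context {R : realType}.
Local Notation mu := (@lebesgue_measure R).

(** Lebesgue measure is characterised by its values on half-open intervals, so it is enough that the
    image of [c mu] under [x -> a + c x] has the right value on each []u, v]]. *)
Lemma pushforward_lebesgue_scale (a c : R) (A : set R) : 0 < c -> measurable A ->
  pushforward mu (fun x : measurableTypeR R => a + c * x : measurableTypeR R) A
    = ((c^-1)%:E * mu A)%E.
Proof.
move=> c0 mA.
have c0' : 0 <= c by exact: ltW.
have mphi : measurable_fun [set: R]
    (fun x : measurableTypeR R => a + c * x : measurableTypeR R).
  by apply: measurable_funD => //; exact: measurable_funM.
have -> : mu A = pushforward [the measure _ _ of mscale (NngNum c0') mu]
    (fun x : measurableTypeR R => a + c * x : measurableTypeR R) A.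
  apply: lebesgue_measure_unique => //= _ [[u v]] _ <-.
  rewrite /pushforward /= /mscale /=.
  have -> : (fun x : R => a + c * x) @^-1` `]u, v]
      = `](u - a) / c, (v - a) / c]%classic.
    apply/seteqP; split=> x /=; rewrite !in_itv/= ltr_pdivrMr// ler_pdivlMr//;
      by move=> /andP[? ?]; apply/andP; split; lra.
  rewrite !lebesgue_measure_itv/= !lte_fin ltr_pM2r ?invr_gt0// ltrD2r.
  case: ifPn => // _; last by rewrite mule0.
  rewrite -!EFinD -EFinM; congr EFin; field.
  by rewrite gt_eqF.
rewrite /pushforward /= /mscale /= muleA -EFinM mulVf ?mul1e//.
by rewrite gt_eqF.
Qed.

Lemma pushforward_lebesgue_reflect (a : R) (A : set R) : measurable A ->
  pushforward mu (fun x : measurableTypeR R => a - x : measurableTypeR R) A = mu A.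
Proof.
move=> mA.
have mphi : measurable_fun [set: R]
    (fun x : measurableTypeR R => a - x : measurableTypeR R).
  exact: measurable_funB.
apply/esym/lebesgue_measure_unique => //= _ [[u v]] _ <-.
rewrite /= /pushforward /=.
have -> : (fun x : R => a - x) @^-1` `]u, v] = `[a - v, a - u[%classic.
  apply/seteqP; split=> x /=; rewrite !in_itv/= ;
    by move=> /andP[? ?]; apply/andP; split; lra.
rewrite !lebesgue_measure_itv/= !lte_fin ltrD2l ltrN2.
case: ifPn => // _; rewrite -!EFinD; congr EFin; ring.
Qed.

Lemma ge0_integral_scale (a c : R) (D : set R) (h : R -> \bar R) :
  0 < c -> measurable D -> measurable_fun setT h -> (forall x, (0 <= h x)%E) ->
  (\int[mu]_(x in D) h x =
    c%:E * \int[mu]_(x in (fun x => a + c * x)%R @^-1` D) h (a + c * x)%R)%E.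
Proof.
move=> c0 mD mh h0.
have mphi : measurable_fun [set: R]
    (fun x : measurableTypeR R => a + c * x : measurableTypeR R).
  by apply: measurable_funD => //; exact: measurable_funM.
have := @ge0_integral_pushforward _ _ (measurableTypeR R) (measurableTypeR R) R
  _ mphi mu _ _ mD (measurable_funTS mh) (fun y _ => h0 y).
move=> /esym; rewrite /comp => ->.
have c0' : 0 <= c^-1 by rewrite invr_ge0 ltW.
pose m := [the measure (measurableTypeR R) R of mscale (NngNum c0') mu].
transitivity (c%:E * \int[m]_(x in D) h x)%E; last first.
  congr (_ * _)%E; apply: eq_measure_integral => A mA _.
  by rewrite /m /= /mscale /= pushforward_lebesgue_scale.
rewrite ge0_integral_mscale//; last exact: measurable_funTS.
by rewrite /= muleA -EFinM mulfV ?mul1e// gt_eqF.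
Qed.

Lemma ge0_integral_reflect (a : R) (D : set R) (h : R -> \bar R) :
  measurable D -> measurable_fun setT h -> (forall x, (0 <= h x)%E) ->
  (\int[mu]_(x in D) h x = \int[mu]_(x in (fun x => a - x)%R @^-1` D) h (a - x)%R)%E.
Proof.
move=> mD mh h0.
have mphi : measurable_fun [set: R]
    (fun x : measurableTypeR R => a - x : measurableTypeR R).
  exact: measurable_funB.
have := @ge0_integral_pushforward _ _ (measurableTypeR R) (measurableTypeR R) R
  _ mphi mu _ _ mD (measurable_funTS mh) (fun y _ => h0 y).
move=> /esym; rewrite /comp => ->.
by apply: eq_measure_integral => A mA _ /=; rewrite pushforward_lebesgue_reflect.
Qed.

(** Image measures give the formula for nonnegative functions; the positive and negative parts of
    [h] are transported separately. *)
Lemma integral_shift (a : R) (D : set R) (h : R -> \bar R) :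
  measurable D -> measurable_fun setT h ->
  (\int[mu]_(x in D) h x = \int[mu]_(x in (fun x => a + x)%R @^-1` D) h (a + x)%R)%E.
Proof.
move=> mD mh.
have E (k : R -> \bar R) : measurable_fun setT k -> (forall x, (0 <= k x)%E) ->
    (\int[mu]_(x in D) k x
       = \int[mu]_(x in (fun x => a + x)%R @^-1` D) k (a + x)%R)%E.
  move=> mk k0; rewrite (ge0_integral_scale a ltr01 mD mk k0) mul1e.
  by under [in LHS]eq_fun do rewrite mul1r; under eq_integral do rewrite mul1r.
rewrite integralE [RHS]integralE; congr (_ - _)%E.
- transitivity (\int[mu]_(x in (fun x => a + x)%R @^-1` D) h^\+ (a + x)%R)%E.
    by apply: E => //; exact: measurable_funepos.
  by apply: eq_integral => x _; rewrite !funeposE.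
- transitivity (\int[mu]_(x in (fun x => a + x)%R @^-1` D) h^\- (a + x)%R)%E.
    by apply: E => //; exact: measurable_funeneg.
  by apply: eq_integral => x _; rewrite !funenegE.
Qed.

Lemma integral_reflect (a : R) (D : set R) (h : R -> \bar R) :
  measurable D -> measurable_fun setT h ->
  (\int[mu]_(x in D) h x = \int[mu]_(x in (fun x => a - x)%R @^-1` D) h (a - x)%R)%E.
Proof.
move=> mD mh; rewrite integralE [RHS]integralE; congr (_ - _)%E.
- transitivity (\int[mu]_(x in (fun x => a - x)%R @^-1` D) h^\+ (a - x)%R)%E.
    by apply: ge0_integral_reflect => //; exact: measurable_funepos.
  by apply: eq_integral => x _; rewrite !funeposE.
- transitivity (\int[mu]_(x in (fun x => a - x)%R @^-1` D) h^\- (a - x)%R)%E.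
    by apply: ge0_integral_reflect => //; exact: measurable_funeneg.
  by apply: eq_integral => x _; rewrite !funenegE.
Qed.

Lemma Rintegral_shift (a u v : R) (h : R -> R) : measurable_fun setT h ->
  \int[mu]_(x in `]u, v[) h x = \int[mu]_(x in `]u - a, v - a[) h (a + x).
Proof.
move=> mh; congr fine; rewrite (integral_shift a)//; last exact/measurable_EFinP.
congr (integral _ _ _); apply/seteqP; split => x /=; rewrite !in_itv/=; lra.
Qed.

Lemma Rintegral_reflect (a u v : R) (h : R -> R) : measurable_fun setT h ->
  \int[mu]_(x in `]u, v[) h x = \int[mu]_(x in `]a - v, a - u[) h (a - x).
Proof.
move=> mh; congr fine; rewrite (integral_reflect a)//; last exact/measurable_EFinP.
congr (integral _ _ _); apply/seteqP; split => x /=; rewrite !in_itv/=; lra.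
Qed.

(** The fundamental theorem of calculus for [y^p / p], away from the singularity at 0. Negative [p]
    is allowed on purpose: the hypersingular kernels of the fractional derivatives need it. *)
Lemma integral_powR_itv (p e x : R) : p != 0 -> 0 < e -> e < x ->
  (\int[mu]_(y in `]e, x[) (y `^ (p - 1))%:E = ((x `^ p - e `^ p) / p)%:E)%E.
Proof.
move=> p0 e0 ex.
have -> : (\int[mu]_(y in `]e, x[) (y `^ (p - 1))%:E
    = \int[mu]_(y in `[e, x]) (y `^ (p - 1))%:E)%E.
  rewrite [RHS](@integral_itv_bndoo _ e x)//.
  apply: measurableT_comp => //.
  by apply: measurable_funTS; exact: measurable_powR.
pose F (y : R) := p^-1 * y `^ p.
have dF (y : R) : 0 < y -> is_derive y 1 F (y `^ (p - 1)).
  move=> y0; have H := is_derive1_powR p y0.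
  apply: (@is_derive_eq _ _ _ _ _ _ _ _ (is_deriveZ _ _)).
  by rewrite /GRing.scale /= mulrA mulVf// mul1r.
have dp (q y : R) : 0 < y -> derivable (fun z : R => z `^ q) y 1.
  by move=> y0; have [] := is_derive1_powR q y0.
have cvgF (y : R) : 0 < y -> {for y, continuous F}.
  move=> y0; apply: differentiable_continuous; apply/derivable1_diffP.
  by have [] := dF _ y0.
rewrite (@continuous_FTC2 _ _ F)//.
- by rewrite -EFinB /F -mulrBr mulrC.
- apply: continuous_in_subspaceT => y; rewrite inE/= in_itv/= => /andP[ey _].
  apply: differentiable_continuous; apply/derivable1_diffP; apply: dp.
  exact: lt_le_trans ey.
- split.
  + move=> y; rewrite in_itv/= => /andP[ey _].
    by have [] := dF y (lt_trans e0 ey).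
  + exact/cvg_at_right_filter/cvgF.
  + exact/cvg_at_left_filter/cvgF/(lt_trans e0).
- move=> y; rewrite in_itv/= => /andP[ey _].
  by rewrite derive1E; have [_ ->] := dF y (lt_trans e0 ey).
Qed.

Lemma integral_powR0 (p x : R) : 0 < p -> 0 <= x ->
  (\int[mu]_(y in `]0%R, x[) (y `^ (p - 1))%:E = (x `^ p / p)%:E)%E.
Proof.
move=> p0; rewrite le_eqVlt => /predU1P[<-|x0].
  by rewrite set_itvoo0 integral_set0 powR0 ?gt_eqF// mul0r.
have xp0 : 0 < x `^ p by exact: powR_gt0.
(* Chosen so that [e n]^ p = x [^ p / n.+2]: the integral over []e n, x[] is then explicit and
   converges with the harmonic sequence. With [n.+2] instead of [n.+1], [e n < x] holds already at
   [n = 0]. *)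
pose e n := (x `^ p / n.+2%:R) `^ p^-1.
have p0' : p != 0 by rewrite gt_eqF.
have ep n : e n `^ p = x `^ p / n.+2%:R.
  by rewrite /e -powRrM mulVf// powRr1// divr_ge0// ltW.
have e0 n : 0 < e n by rewrite /e powR_gt0// divr_gt0.
have ltp u v : 0 <= u -> 0 < v -> u `^ p < v `^ p -> u < v.
  move=> u0 v0; apply: contraTT; rewrite -!leNgt => vu.
  by apply: ge0_ler_powR; rewrite ?nnegrE// ltW.
have ex n : e n < x.
  apply: ltp => //; first exact: ltW.
  by rewrite ep ltr_pdivrMr// ltr_pMr// ltr1n.
have cvge : (fun n => x `^ p / n.+2%:R) @ \oo --> (0 : R).
  rewrite -[X in _ --> X](mulr0 (x `^ p)); apply: cvgMr.
  by have := @cvg_harmonic R; rewrite -cvg_shiftS; apply.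
have nde : nondecreasing_seq (fun n => `]e n, x[%classic).
  move=> m n mn; apply/subsetPset => y /=; rewrite !in_itv/= => /andP[emy ->].
  rewrite andbT (le_lt_trans _ emy)// /e ge0_ler_powR ?nnegrE ?invr_ge0 ?(ltW p0)//.
  - by rewrite divr_ge0// ltW.
  - by rewrite divr_ge0// ltW.
  - by rewrite ler_pM2l// lef_pV2 ?posrE// ler_nat !ltnS.
have bigE : \bigcup_n `]e n, x[%classic = `]0, x[%classic.
  apply/seteqP; split => y /=.
    by move=> [n _] /=; rewrite !in_itv/= => /andP[/(lt_trans (e0 n)) -> ->].
  rewrite in_itv/= => /andP[y0 yx].
  have yp0 : 0 < y `^ p by exact: powR_gt0.
  have /cvgrPdist_lt /(_ _ yp0) [N _ /(_ N (leqnn N)) /=] := cvge.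
  rewrite sub0r normrN ger0_norm ?divr_ge0 ?powR_ge0// -ep => /ltp yN.
  by exists N => //=; rewrite in_itv/= yx andbT yN// ltW.
have mpow n : measurable_fun `]e n, x[
    (fun y : measurableTypeR R => (y `^ (p - 1))%:E).
  apply: measurableT_comp => //.
  by apply: measurable_funTS; exact: measurable_powR.
have pow0 n (y : measurableTypeR R) : `]e n, x[%classic y ->
    (0 <= (y `^ (p - 1))%:E)%E.
  by move=> _; rewrite lee_fin powR_ge0.
have := @ge0_nondecreasing_set_cvg_integral _ (measurableTypeR R) R _ _ mu nde
  (fun n => measurable_itv _) mpow pow0.
rewrite bigE (_ : (fun n => _) =
    (fun n => ((x `^ p - x `^ p / n.+2%:R) / p)%:E)); last first.
  by apply/funext => n; rewrite integral_powR_itv// ep.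
move=> cvgI; apply/esym; move: cvgI; apply: cvg_unique => //.
apply: cvg_EFin; first by near=> n.
rewrite /comp /=; apply: cvgM; last exact: cvg_cst.
by rewrite -[X in _ --> X]subr0; apply: cvgB => //; exact: cvg_cst.
Unshelve. all: end_near. Qed.

End lebesgue_affine.

(** * Fubini's theorem on a triangle *)

Section triangle.
Context {R : realType}.
Local Notation mu := (@lebesgue_measure R).
Local Notation mR := (measurableTypeR R).

Lemma measurable_itvR (i : interval R) : @measurable _ mR [set` i].
Proof. exact: measurable_itv. Qed.

(** Fubini's theorem produces extended-real marginals that are finite only almost everywhere, while
    a nested real integral takes the [fine] part of each; this lemma passes from one to the
    other. *)
Lemma integrable_fine d (T : measurableType d) (m : {measure set T -> \bar R})
    (D : set T) (f : T -> \bar R) : measurable D -> m.-integrable D f ->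
  m.-integrable D (fun x => (fine (f x))%:E) /\
  (\int[m]_(x in D) (fine (f x))%:E = \int[m]_(x in D) f x)%E.
Proof.
move=> mD intf; have mf := measurable_int m intf.
have mff : measurable_fun D (fun x => (fine (f x))%:E).
  apply: measurableT_comp => //.
  by apply: (measurableT_comp (@fine_measurable R setT measurableT)).
split.
  apply: le_integrable intf => // x _.
  by case: (f x) => //= *; rewrite normr0 leey.
apply: ae_eq_integral => //.
by apply: filterS (integrable_ae mD intf) => x /[apply] /fineK.
Qed.

(** Extension of a kernel by zero from [a < y < x < t] to the plane, the outer variable [x] coming
    first, so that Fubini for the product measure applies to it. *)
Definition triangle (a t : R) (F : R -> R -> R) (p : mR * mR) : R :=
  if [&& a < p.2, p.2 < p.1 & p.1 < t] then F p.1 p.2 else 0.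

Lemma measurable_triangle a t F :
  measurable_fun setT (fun p : mR * mR => F p.1 p.2) ->
  measurable_fun setT (triangle a t F).
Proof.
move=> mF; apply: measurable_fun_ifT => //.
apply: measurable_and; first exact: measurable_fun_ltr.
by apply: measurable_and; exact: measurable_fun_ltr.
Qed.

Lemma integral_triangle_snd a t F x :
  (\int[mu]_y (triangle a t F (x, y))%:E =
   ((fun x => \int[mu]_(y in `]a, x[) (F x y)%:E) \_ `]a, t[) x)%E.
Proof.
rewrite patchE; case: ifPn => [|xat].
  rewrite inE/= in_itv/= => /andP[ax xt]; rewrite [RHS]integral_mkcond.
  apply: eq_integral => y _; rewrite /triangle patchE /= xt andbT.
  by case: ifPn => [/andP[ay yx]|yax]; case: ifPn => //;
    rewrite ?inE ?notin_setE/= in_itv/= ?ay ?yx// (negbTE yax).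
apply: integral0_eq => y _; rewrite /triangle /=; case: ifPn => // /and3P[ay yx xt].
by move: xat; rewrite notin_setE/= in_itv/= xt (lt_trans ay yx).
Qed.

Lemma integral_triangle_fst a t F y :
  (\int[mu]_x (triangle a t F (x, y))%:E =
   ((fun y => \int[mu]_(x in `]y, t[) (F x y)%:E) \_ `]a, t[) y)%E.
Proof.
rewrite patchE; case: ifPn => [|yat].
  rewrite inE/= in_itv/= => /andP[ay yt]; rewrite [RHS]integral_mkcond.
  apply: eq_integral => x _; rewrite /triangle patchE /= ay /=.
  by case: ifPn => [/andP[yx xt]|yxt]; case: ifPn => //;
    rewrite ?inE ?notin_setE/= in_itv/= ?xt ?yx// (negbTE yxt).
apply: integral0_eq => x _; rewrite /triangle /=; case: ifPn => // /and3P[ay yx xt].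
by move: yat; rewrite notin_setE/= in_itv/= ay (lt_trans yx xt).
Qed.

Lemma triangle_norm a t F p :
  `|triangle a t F p| = triangle a t (fun x y => `|F x y|) p.
Proof. by rewrite /triangle; case: ifPn; rewrite ?normr0. Qed.

(** The hypothesis is Tonelli's criterion for [triangle a t F], whose two marginals are the inner
    integrals on the two sides. *)
Lemma triangle_Fubini (a t : R) (F : R -> R -> R) :
  measurable_fun setT (fun p : mR * mR => F p.1 p.2) ->
  (\int[mu]_(x in `]a, t[) \int[mu]_(y in `]a, x[) (`|F x y|)%:E < +oo)%E ->
  [/\ mu.-integrable `]a, t[ (fun x => (\int[mu]_(y in `]a, x[) F x y)%:E),
      mu.-integrable `]a, t[ (fun y => (\int[mu]_(x in `]y, t[) F x y)%:E) &
      \int[mu]_(x in `]a, t[) (\int[mu]_(y in `]a, x[) F x y) =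
      \int[mu]_(y in `]a, t[) (\int[mu]_(x in `]y, t[) F x y)].
Proof.
move=> mF Foo; have mG := measurable_triangle a t mF.
have iG : (mu \x mu)%E.-integrable setT (EFin \o triangle a t F).
  apply/integrable12ltyP; first exact/measurable_EFinP.
  rewrite /comp /=; move: Foo; rewrite integral_mkcond; congr (_ < _)%E.
  apply: eq_integral => x _; rewrite -integral_triangle_snd.
  by apply: eq_integral => y _; rewrite triangle_norm.
have i1 : mu.-integrable `]a, t[
    (fun x => \int[mu]_(y in `]a, x[) (F x y)%:E)%E.
  apply/integrable_mkcond => //.
  by apply: eq_integrable (integrable_fubini_F iG) => // x _;
    rewrite -integral_triangle_snd.
have iGs : (mu \x mu)%E.-integrable setT
    (fun p : mR * mR => (triangle a t F (p.2, p.1))%:E).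
  apply/integrable12ltyP.
    apply/measurable_EFinP; apply: (measurableT_comp mG).
    exact: measurable_fun_pair.
  by apply/(@integrable21ltyP _ _ _ _ _ mu mu (EFin \o triangle a t F)) => //;
    exact/measurable_EFinP.
have i2 : mu.-integrable `]a, t[
    (fun y => \int[mu]_(x in `]y, t[) (F x y)%:E)%E.
  apply/integrable_mkcond => //.
  by apply: eq_integrable (integrable_fubini_F iGs) => // x _;
    rewrite -integral_triangle_fst.
have [j1 e1] := integrable_fine (@measurable_itvR _) i1.
have [j2 e2] := integrable_fine (@measurable_itvR _) i2.
split; [exact: j1|exact: j2|]; congr fine; rewrite e1 e2.
rewrite [LHS]integral_mkcond [RHS]integral_mkcond.
under eq_integral do rewrite -integral_triangle_snd.
under [RHS]eq_integral do rewrite -integral_triangle_fst.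
exact: (Fubini iG).
Qed.

End triangle.

(** * Power kernels and the Beta integral *)

Section triangle_power.
Context {R : realType}.
Local Notation mu := (@lebesgue_measure R).
Local Notation mR := (measurableTypeR R).

Lemma triangle_Fubini_dominated (a t : R) (F : R -> R -> R) (h : R -> R) :
  measurable_fun setT (fun p : mR * mR => F p.1 p.2) ->
  mu.-integrable `]a, t[ (EFin \o h) ->
  (forall x, a < x < t ->
    (\int[mu]_(y in `]a, x[) (`|F x y|)%:E <= (h x)%:E)%E) ->
  [/\ mu.-integrable `]a, t[ (fun x => (\int[mu]_(y in `]a, x[) F x y)%:E),
      mu.-integrable `]a, t[ (fun y => (\int[mu]_(x in `]y, t[) F x y)%:E) &
      \int[mu]_(x in `]a, t[) (\int[mu]_(y in `]a, x[) F x y) =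
      \int[mu]_(y in `]a, t[) (\int[mu]_(x in `]y, t[) F x y)].
Proof.
move=> mF ih Fh; apply: triangle_Fubini => //.
have mG := measurable_triangle a t mF.
apply: (@le_lt_trans _ _ (\int[mu]_(x in `]a, t[) (h x)%:E)%E); last first.
  exact: integrable_lty.
apply: ge0_le_integral => //.
- by move=> x _; exact: integral_ge0.
- apply/(measurable_restrictT _ (measurable_itv _)).
  rewrite (_ : _ \_ _ =
    fun x => (\int[mu]_y `|(triangle a t F (x, y))%:E|)%E); last first.
    apply/funext => x; rewrite -integral_triangle_snd.
    by apply: eq_integral => y _; rewrite /= triangle_norm.
  apply: (measurable_fun_fubini_tonelli_F
    (fun p : mR * mR => `|(triangle a t F p)%:E|%E)) => //.
  by apply: measurableT_comp => //; exact/measurable_EFinP.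
- exact: measurable_int ih.
Qed.

Lemma measurable_powRBl (s p : R) :
  measurable_fun setT (fun u : mR => (u - s) `^ p).
Proof.
apply: (measurableT_comp (measurable_powR _)) => //.
exact: measurable_funB.
Qed.

Lemma measurable_powRBr (s p : R) :
  measurable_fun setT (fun u : mR => (s - u) `^ p).
Proof.
apply: (measurableT_comp (measurable_powR _)) => //.
exact: measurable_funB.
Qed.

Lemma measurable_EFin_powRBl (D : set mR) (s p : R) :
  measurable_fun D (fun u : mR => ((u - s) `^ p)%:E).
Proof.
by apply/measurable_EFinP; apply: measurable_funTS; exact: measurable_powRBl.
Qed.

Lemma measurable_EFin_powRBr (D : set mR) (s p : R) :
  measurable_fun D (fun u : mR => ((s - u) `^ p)%:E).
Proof.
by apply/measurable_EFinP; apply: measurable_funTS; exact: measurable_powRBr.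
Qed.

Lemma integral_powRBl (p s t : R) : 0 < p -> s <= t ->
  (\int[mu]_(u in `]s, t[) ((u - s) `^ (p - 1))%:E = ((t - s) `^ p / p)%:E)%E.
Proof.
move=> p0 st; have ts0 : 0 <= t - s by rewrite subr_ge0.
have <- := integral_powR0 p0 ts0.
rewrite (integral_shift s (measurable_itv _) (measurable_EFin_powRBl _ _)).
rewrite (_ : _ @^-1` _ = `]0, t - s[%classic).
  by apply: eq_integral => x _; rewrite [s + x]addrC addrK.
by apply/seteqP; split => x /=; rewrite !in_itv/=; lra.
Qed.

Lemma integral_powRBr (p s t : R) : 0 < p -> s <= t ->
  (\int[mu]_(u in `]s, t[) ((t - u) `^ (p - 1))%:E = ((t - s) `^ p / p)%:E)%E.
Proof.
move=> p0 st; have ts0 : 0 <= t - s by rewrite subr_ge0.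
have <- := integral_powR0 p0 ts0.
rewrite (integral_reflect t (measurable_itv _) (measurable_EFin_powRBr _ _)).
rewrite (_ : _ @^-1` _ = `]0, t - s[%classic).
  by apply: eq_integral => x _; rewrite opprB addrC subrK.
by apply/seteqP; split => x /=; rewrite !in_itv/=; lra.
Qed.

Lemma integral_powRBl_itv (p s w t : R) : p != 0 -> s < w -> w < t ->
  (\int[mu]_(u in `]w, t[) ((u - s) `^ (p - 1))%:E =
     (((t - s) `^ p - (w - s) `^ p) / p)%:E)%E.
Proof.
move=> p0 sw wt; have ws0 : 0 < w - s by rewrite subr_gt0.
have wt' : w - s < t - s by rewrite ltrD2r.
have <- := integral_powR_itv p0 ws0 wt'.
rewrite (integral_shift s (measurable_itv _) (measurable_EFin_powRBl _ _)).
rewrite (_ : _ @^-1` _ = `]w - s, t - s[%classic).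
  by apply: eq_integral => x _; rewrite [s + x]addrC addrK.
by apply/seteqP; split => x /=; rewrite !in_itv/=; lra.
Qed.

Lemma integrable_powRBl (p s t : R) : 0 < p -> s <= t ->
  mu.-integrable `]s, t[ (fun u => ((u - s) `^ (p - 1))%:E).
Proof.
move=> p0 st; apply/integrableP; split; first exact: measurable_EFin_powRBl.
under eq_integral do rewrite gee0_abs ?lee_fin ?powR_ge0//.
by rewrite integral_powRBl// ltry.
Qed.

Lemma integrable_powRBr (p s t : R) : 0 < p -> s <= t ->
  mu.-integrable `]s, t[ (fun u => ((t - u) `^ (p - 1))%:E).
Proof.
move=> p0 st; apply/integrableP; split; first exact: measurable_EFin_powRBr.
under eq_integral do rewrite gee0_abs ?lee_fin ?powR_ge0//.
by rewrite integral_powRBr// ltry.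
Qed.

(** Euler's Beta integral [B (a, 1 - a)], an extended real until it is shown to be finite. *)
Definition betaK (a : R) : \bar R :=
  \int[mu]_(x in `]0, 1[) ((1 - x) `^ (a - 1) * x `^ (- a))%:E.

(** On either half of []0, 1[] one of the two factors is nonsingular and at most 2, so twice the sum
    of the two integrable kernels dominates their product. *)
Lemma betaK_fin (a : R) : 0 < a < 1 -> betaK a \is a fin_num.
Proof.
move=> /andP[a0 a1].
rewrite ge0_fin_numE; last first.
  by apply: integral_ge0 => x _; rewrite lee_fin mulr_ge0 ?powR_ge0.
have i1 := @integrable_powRBr a 0 1 a0 ler01.
have i2 : mu.-integrable `]0, 1[ (fun u : R => ((u - 0) `^ (1 - a - 1))%:E).
  by apply: integrable_powRBl => //; rewrite subr_gt0.
have i := integrableZl (@measurable_itvR _ _) 2 (integrableD (@measurable_itvR _ _) i1 i2).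
apply: le_lt_trans (integrable_lty _ i) => //; apply: ge0_le_integral => //.
- by move=> x _; rewrite lee_fin mulr_ge0 ?powR_ge0.
- apply/measurable_EFinP; apply: measurable_funM.
    by apply: measurable_funTS; exact: measurable_powRBr.
  by apply: measurable_funTS; exact: measurable_powR.
- exact: measurable_int i.
move=> x; rewrite /= in_itv/= => /andP[x0 x1].
clear i i1 i2; rewrite lee_fin subr0 (_ : 1 - a - 1 = - a); last by ring.
have half (q y : R) : 0 <= q -> q <= 1 -> 2^-1 <= y -> y `^ (- q) <= 2.
  move=> q0 q1 y2; rewrite powRN.
  have y0 : 0 < y by apply: lt_le_trans y2; rewrite invr_gt0.
  rewrite -[leRHS]invrK lef_pV2 ?posrE ?powR_gt0 ?invr_gt0//.
  apply: (@le_trans _ _ (2^-1 `^ q)).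
    by rewrite -[leLHS](@powRr1 _ (2^-1)) ?invr_ge0// ger_powR// invr_gt0 ltr0n/= invf_le1// ler1n.
  by apply: ge0_ler_powR; rewrite ?nnegrE// ltW.
have := powR_ge0 (1 - x) (a - 1); have := powR_ge0 x (- a).
have [xh|xh] := leP x 2^-1.
- have : (1 - x) `^ (a - 1) <= 2.
    by rewrite (_ : a - 1 = - (1 - a)); [apply: half; lra|ring].
  nra.
- have : x `^ (- a) <= 2 by apply: half; lra.
  nra.
Qed.

(** After the substitution [u = w + (v - w) x] the powers of [v - w] have exponents [1], [a - 1] and
    [- a], which cancel. The independence of [w] and [v] is what makes two fractional kernels
    compose to an ordinary integral. *)
Lemma integral_beta (a v w : R) : w < v ->
  (\int[mu]_(u in `]w, v[) ((v - u) `^ (a - 1) * (u - w) `^ (- a))%:E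
     = betaK a)%E.
Proof.
move=> wv; have d0 : 0 < v - w by rewrite subr_gt0.
rewrite (ge0_integral_scale w d0) //.
- rewrite (_ : _ @^-1` _ = `]0, 1[%classic); last first.
    apply/seteqP; split => x /=; rewrite !in_itv/= => /andP[h1 h2];
      apply/andP; split; nra.
  rewrite -ge0_integralZl//.
  + apply: eq_integral => x; rewrite inE/= in_itv/= => /andP[x0 x1].
    rewrite -EFinM; congr EFin.
    rewrite (_ : v - (w + (v - w) * x) = (v - w) * (1 - x)); last by ring.
    rewrite (_ : w + (v - w) * x - w = (v - w) * x); last by ring.
    rewrite !powRM ?(ltW d0) ?(ltW x0) ?subr_ge0 ?(ltW x1)//.
    have H : (v - w) * (v - w) `^ (a - 1) * (v - w) `^ (- a) = 1.
      rewrite -mulrA -powRD; last by rewrite (gt_eqF d0) implybT.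
      rewrite (_ : a - 1 - a = -1); last by ring.
      by rewrite powR_inv1 ?(ltW d0)// mulfV// (gt_eqF d0).
    transitivity ((v - w) * (v - w) `^ (a - 1) * (v - w) `^ (- a) *
      ((1 - x) `^ (a - 1) * x `^ (- a))); first by ring.
    by rewrite H mul1r.
  + apply/measurable_EFinP; apply: measurable_funTS.
    apply: measurable_funM.
      apply: (measurableT_comp (measurable_powR _)); apply: measurable_funB => //.
      by apply: measurable_funD => //; exact: measurable_funM.
    apply: (measurableT_comp (measurable_powR _)); apply: measurable_funB => //.
    by apply: measurable_funD => //; exact: measurable_funM.
  + by move=> x _; rewrite lee_fin mulr_ge0 ?powR_ge0.
  + by rewrite lee_fin ltW.
- apply/measurable_EFinP; apply: measurable_funM.
    exact: measurable_powRBr.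
  exact: measurable_powRBl.
- by move=> x; rewrite lee_fin mulr_ge0 ?powR_ge0.
Qed.

End triangle_power.

Section Rintegral_bounds.
Context d {T : measurableType d} {R : realType} (m : {measure set T -> \bar R}).

Lemma integrable_boundedM (D : set T) (h g : T -> R) (K : R) :
  measurable D -> measurable_fun D h -> (forall x, D x -> `|h x| <= K) ->
  m.-integrable D (EFin \o g) -> m.-integrable D (fun x => (h x * g x)%:E).
Proof.
move=> mD mh hK ig; have := integrableZl mD K ig; apply: le_integrable => //.
  apply/measurable_EFinP; apply: measurable_funM => //.
  by apply/measurable_EFinP; exact: measurable_int ig.
move=> x Dx /=; rewrite lee_fin !normrM ler_wpM2r//.
by rewrite (le_trans (hK x Dx))// ler_norm.
Qed.

Lemma le_normr_Rintegral_dom (D : set T) (f h : T -> R) :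
  measurable D -> measurable_fun D f -> m.-integrable D (EFin \o h) ->
  (forall x, D x -> `|f x| <= h x) ->
  `|\int[m]_(x in D) f x| <= \int[m]_(x in D) h x.
Proof.
move=> mD mf ih fh.
have i_f : m.-integrable D (EFin \o f).
  apply: le_integrable ih => //; first exact/measurable_EFinP.
  by move=> x Dx /=; rewrite lee_fin (le_trans (fh x Dx))// ler_norm.
apply: (le_trans (le_normr_Rintegral _ i_f)) => //.
by apply: le_Rintegral => //; exact: integrable_norm.
Qed.

End Rintegral_bounds.

(** * The Zaehle integral *)

Section Zaehle_smooth.
Context {R : realType}.
Local Notation mu := (@lebesgue_measure R).
Local Notation mR := (measurableTypeR R).
Implicit Types (a s t K : R) (f g phi psi : R -> R).

Lemma powRDgt0 (x p q : R) : 0 < x -> x `^ (p + q) = x `^ p * x `^ q.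
Proof. by move=> x0; rewrite powRD// (gt_eqF x0) implybT. Qed.

Lemma powRS (x p : R) : 0 < x -> x `^ p * x = x `^ (p + 1).
Proof. by move=> x0; rewrite powRDgt0// powRr1// ltW. Qed.

(** Up to sign and a Gamma factor, the right-sided Weyl-Marchaud derivative of order [a] of
    [g - g t]; at order [1 - alpha] it is the second factor in [zaehle_int]. Likewise [zleft] is the
    left-sided derivative, the first factor. *)
Definition zker a g t s : R :=
  (g t - g s) / (t - s) `^ a +
  a * \int[mu]_(u in `]s, t[) ((g u - g s) / (u - s) `^ (1 + a)).

Definition zleft a f s : R :=
  f s / s `^ a + a * \int[mu]_(u in `]0, s[) ((f s - f u) / (s - u) `^ (a + 1)).

(** The notion of smoothness used here: an indefinite integral of a bounded measurable function. It
    is stable under shifts and reflections, and Steklov means have it. *)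
Definition primitive f phi : Prop :=
  [/\ measurable_fun setT phi, exists2 K : R, 0 <= K & forall x, `|phi x| <= K &
      forall u v, u <= v -> f v - f u = \int[mu]_(x in `]u, v[) phi x].

Lemma lebesgue_measure_oo (u v : R) : u <= v -> mu `]u, v[%classic = (v - u)%:E.
Proof.
move=> uv; rewrite lebesgue_measure_itv/= lte_fin; case: ltP => // vu.
by rewrite (@le_anti _ R u v) ?uv// subrr.
Qed.

Lemma integrable_bounded_itv (u v K : R) phi :
  measurable_fun setT phi -> (forall x, `|phi x| <= K) ->
  mu.-integrable `]u, v[ (EFin \o phi).
Proof.
move=> mphi phiK; apply: measurable_bounded_integrable => //.
- by rewrite /= lebesgue_measure_itv/=; case: ifPn => _; rewrite ?ltry// -EFinB ltry.
- exact: measurable_funTS.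
- by exists K; split; [exact: num_real|move=> M KM x _ /=; exact: le_trans (ltW KM)].
Qed.

Lemma Rintegral_cst_itv (u v K : R) : u <= v ->
  \int[mu]_(x in `]u, v[) K = K * (v - u).
Proof.
move=> uv; rewrite Rintegral_cst//; by rewrite /= lebesgue_measure_oo.
Qed.

Lemma Rintegral_powRBl (p s t : R) : 0 < p -> s <= t ->
  \int[mu]_(u in `]s, t[) (u - s) `^ (p - 1) = (t - s) `^ p / p.
Proof. by move=> p0 st; rewrite /Rintegral integral_powRBl. Qed.

Lemma Rintegral_powRBr (p s t : R) : 0 < p -> s <= t ->
  \int[mu]_(u in `]s, t[) (t - u) `^ (p - 1) = (t - s) `^ p / p.
Proof. by move=> p0 st; rewrite /Rintegral integral_powRBr. Qed.

Lemma integrable_powRBl_itv (p s w t : R) : p != 0 -> s < w -> w < t ->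
  mu.-integrable `]w, t[ (fun u => ((u - s) `^ (p - 1))%:E).
Proof.
move=> p0 sw wt; apply/integrableP; split; first exact: measurable_EFin_powRBl.
under eq_integral do rewrite gee0_abs ?lee_fin ?powR_ge0//.
by rewrite integral_powRBl_itv// ltry.
Qed.

Lemma measurable_fun1 (h : R -> R) : measurable_fun setT h ->
  measurable_fun setT (fun p : mR * mR => h p.1).
Proof. by move=> mh; exact: (measurableT_comp mh). Qed.

Lemma measurable_fun2 (h : R -> R) : measurable_fun setT h ->
  measurable_fun setT (fun p : mR * mR => h p.2).
Proof. by move=> mh; exact: (measurableT_comp mh). Qed.

Lemma measurable_powRB12 (q : R) :
  measurable_fun setT (fun p : mR * mR => (p.1 - p.2) `^ q).
Proof.
apply: (measurableT_comp (measurable_powR _)) => //.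
exact: measurable_funB.
Qed.

Lemma integral_norm_bounded_powRBr (K q s : R) phi : measurable_fun setT phi ->
  0 <= K -> (forall x, `|phi x| <= K) -> 0 < q -> 0 <= s ->
  (\int[mu]_(w in `]0%R, s[) (`|phi w * (s - w) `^ (q - 1)|)%:E
    <= (K * ((s - 0) `^ q / q))%:E)%E.
Proof.
move=> mphi K0 phiK q0 s0.
have <- := @Rintegral_powRBr q 0 s q0 s0; rewrite -RintegralZl//; last first.
  exact: integrable_powRBr.
have iK : mu.-integrable `]0, s[ (fun w => (K * (s - w) `^ (q - 1))%:E).
  exact: (integrableZl (@measurable_itvR _ _) K (integrable_powRBr q0 s0)).
rewrite /Rintegral fineK; last exact: integrable_fin_num iK.
apply: ge0_le_integral => //.
- apply/measurable_EFinP; apply: measurableT_comp => //.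
  apply: measurable_funM; apply: measurable_funTS => //.
  exact: measurable_powRBr.
- exact: measurable_int iK.
- move=> w _; rewrite lee_fin normrM [`|_ `^ _|]ger0_norm ?powR_ge0//.
  by rewrite ler_wpM2r ?powR_ge0.
Qed.

(** Write [g u - g s] as the integral of [psi] over []s, u[] and exchange the integrals: integrating
    [a (u - s)^-(1 + a)] over [u] in []w, t[] gives [(w - s)^-a - (t - s)^-a], and the second term
    cancels the boundary term of [zker]. *)
Lemma zker_primitive a s t g psi : 0 < a < 1 -> s < t -> primitive g psi ->
  zker a g t s = \int[mu]_(v in `]s, t[) (psi v * (v - s) `^ (- a)).
Proof.
move=> /andP[a0 a1] st [mpsi [K K0 psiK] gE].
pose F u w := psi w * (u - s) `^ (- (1 + a)).
have mF : measurable_fun setT (fun p : mR * mR => F p.1 p.2).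
  apply: measurable_funM; first exact: measurable_fun2.
  exact: (measurable_fun1 (measurable_powRBl _ _)).
have a1' : 0 < 1 - a by rewrite subr_gt0.
have aN0 : a != 0 by rewrite gt_eqF.
have st' := ltW st.
have ipw : mu.-integrable `]s, t[ (fun u => ((u - s) `^ (- a))%:E).
  have -> : - a = 1 - a - 1 by ring.
  exact: integrable_powRBl.
have ih : mu.-integrable `]s, t[ (EFin \o (fun u => K * (u - s) `^ (- a))).
  exact: (integrableZl (@measurable_itvR _ _) K ipw).
have psiin u : mu.-integrable `]s, u[ (EFin \o psi).
  exact: integrable_bounded_itv psiK.
(* The kernel [(u - s)^-(1 + a)] is not integrable at [s], but the inner interval has length
   [u - s]. This gains one power and leaves the integrable bound [K (u - s)^-a]. *)
have Fh u : s < u < t ->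
    (\int[mu]_(w in `]s, u[) (`|F u w|)%:E <= (K * (u - s) `^ (- a))%:E)%E.
  move=> /andP[su ut].
  have us : 0 < u - s by rewrite subr_gt0.
  have -> : (K * (u - s) `^ (- a))%:E =
     (\int[mu]_(w in `]s, u[) (cst (K * (u - s) `^ (- (1 + a)))%:E) w)%E.
    rewrite integral_cst// /= lebesgue_measure_oo ?(ltW su)// -EFinM.
    congr EFin; rewrite -mulrA; congr (_ * _).
    by rewrite powRS//; congr (_ `^ _); ring.
  apply: ge0_le_integral => //.
  - apply/measurable_EFinP; apply: measurableT_comp => //.
    by apply: measurable_funM => //; exact: measurable_funTS.
  - move=> w _; rewrite lee_fin /F normrM [`|_ `^ _|]ger0_norm ?powR_ge0//.
    by rewrite ler_wpM2r ?powR_ge0.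
have [_ _ FE] := triangle_Fubini_dominated mF ih Fh.
rewrite /zker.
have -> : \int[mu]_(u in `]s, t[) ((g u - g s) / (u - s) `^ (1 + a)) =
    \int[mu]_(u in `]s, t[) (\int[mu]_(w in `]s, u[) F u w).
  apply: eq_Rintegral => u; rewrite inE/= in_itv/= => /andP[su ut].
  rewrite /F (RintegralZr _ (@measurable_itvR _ _) (psiin u)).
  by rewrite -(gE _ _ (ltW su)) powRN.
rewrite FE (gE _ _ st').
have -> : \int[mu]_(y in `]s, t[) (\int[mu]_(x in `]y, t[) F x y) =
   \int[mu]_(y in `]s, t[)
     (a^-1 * (psi y * (y - s) `^ (- a) - psi y * (t - s) `^ (- a))).
  apply: eq_Rintegral => w; rewrite inE/= in_itv/= => /andP[sw wt].
  rewrite /F (_ : - (1 + a) = - a - 1); last by ring.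
  have a0' : - a != 0 by rewrite oppr_eq0 gt_eqF.
  have := integral_powRBl_itv a0' sw wt.
  move=> E; have iw : mu.-integrable `]w, t[ (fun u => ((u - s) `^ (- a - 1))%:E).
    exact: integrable_powRBl_itv.
  rewrite (RintegralZl _ (@measurable_itvR _ _) iw).
  by rewrite /Rintegral E /=; field; rewrite gt_eqF.
have i1 : mu.-integrable `]s, t[ (fun v => (psi v * (v - s) `^ (- a))%:E).
  exact: (integrable_boundedM (@measurable_itvR _ _) (measurable_funTS mpsi)
    (fun x _ => psiK x) ipw).
have i2 : mu.-integrable `]s, t[ (fun v => (psi v * (t - s) `^ (- a))%:E).
  exact: (integrableZr (@measurable_itvR _ _) _ (psiin t)).
have i12 : mu.-integrable `]s, t[
    (fun v => (psi v * (v - s) `^ (- a) - psi v * (t - s) `^ (- a))%:E).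
  exact: (integrableB (@measurable_itvR _ _) i1 i2).
rewrite (RintegralZl _ (@measurable_itvR _ _) i12).
rewrite (RintegralB (@measurable_itvR _ _) i1 i2).
rewrite (RintegralZr _ (@measurable_itvR _ _) (psiin t)).
by rewrite mulrA (divff aN0) mul1r powRN addrC; exact: subrK.
Qed.

Lemma primitive_lipschitz f phi : primitive f phi ->
  exists2 K : R, 0 <= K & forall u v, `|f u - f v| <= K * `|u - v|.
Proof.
move=> [mphi [K K0 phiK] fE]; exists K => //.
have H u v : u <= v -> `|f v - f u| <= K * `|v - u|.
  move=> uv; rewrite fE// [`|v - u|]ger0_norm ?subr_ge0// -Rintegral_cst_itv//.
  apply: le_normr_Rintegral_dom => //.
  - exact: measurable_funTS.
  - by apply: (@integrable_bounded_itv _ _ `|K|).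
move=> u v; have [uv|/ltW vu] := leP u v; last exact: H.
by rewrite distrC (distrC u); exact: H.
Qed.

Lemma measurable_primitive f phi : primitive f phi -> measurable_fun setT f.
Proof.
move=> /primitive_lipschitz[K K0 fK]; apply: continuous_measurable_fun => x.
apply/cvgrPdist_le => e e0; near=> y.
rewrite (le_trans (fK _ _))//.
have : `|x - y| <= e / (K + 1).
  near: y; apply: cvgr_dist_le => //.
  by rewrite divr_gt0// ltr_wpDl.
have K1 : 0 < K + 1 by rewrite ltr_wpDl.
rewrite ler_pdivlMr// mulrC => h; apply: le_trans h.
by rewrite ler_wpM2r// lerDl.
Unshelve. all: end_near. Qed.

Lemma integrable_primitiveM (u v : R) f phi g psi :
  primitive f phi -> primitive g psi ->
  mu.-integrable `]u, v[ (fun x => (f x * psi x)%:E).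
Proof.
move=> pf [mpsi [K K0 psiK] _]; have [L L0 fL] := primitive_lipschitz pf.
apply: (@integrable_boundedM _ _ _ mu _ f psi (`|f u| + L * `|v - u|)).
- exact: measurable_itvR.
- exact: measurable_funTS (measurable_primitive pf).
- move=> x; rewrite /= in_itv/= => /andP[ux xv].
  rewrite -[f x](subrK (f u)) addrC (le_trans (ler_normD _ _))// lerD2l.
  rewrite (le_trans (fL _ _))// ler_wpM2l// !gtr0_norm ?subr_gt0//.
    by rewrite lerD2r ltW.
  exact: lt_trans xv.
- exact: integrable_bounded_itv psiK.
Qed.

(** The reflection [u -> s - u] turns the left derivative into a right one, up to the boundary value
    of [f] at 0. Estimates and limits are therefore proved for [zker] only. *)
Lemma zleft_zker a f s : measurable_fun setT f -> 0 < s ->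
  zleft a f s = f 0 / s `^ a + zker a (fun x => - f (s - x)) s 0.
Proof.
move=> mf s0; have sa0 : s `^ a != 0 by rewrite gt_eqF// powR_gt0.
have mh : measurable_fun setT (fun u : R => (f s - f u) / (s - u) `^ (a + 1)).
  apply: measurable_funM; first exact: measurable_funB.
  rewrite (_ : (fun _ => _) = fun u : mR => (s - u) `^ (- (a + 1))).
    exact: measurable_powRBr.
  by apply/funext => u; rewrite powRN.
have E : \int[mu]_(u in `]0, s[) ((f s - f u) / (s - u) `^ (a + 1)) =
  \int[mu]_(u in `]0, s[) ((- f (s - u) - - f (s - 0)) / (u - 0) `^ (1 + a)).
  rewrite (Rintegral_reflect s _ _ mh) subrr subr0.
  apply: eq_Rintegral => x _; congr (_ / _); first by ring.
  by rewrite [1 + a]addrC; congr (_ `^ _); ring.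
rewrite /zleft /zker E !subr0 subrr; field.
exact: sa0.
Qed.

Lemma zleft_primitive a s f phi : 0 < a < 1 -> 0 < s -> primitive f phi ->
  zleft a f s = f 0 * s `^ (- a) +
    \int[mu]_(w in `]0, s[) (phi w * (s - w) `^ (- a)).
Proof.
move=> a01 s0 pf; have mf := measurable_primitive pf.
have [mphi [K K0 phiK] fE] := pf.
rewrite zleft_zker// powRN; congr (_ + _).
have mphis : measurable_fun setT (fun x : R => phi (s - x)).
  apply: (measurableT_comp mphi); exact: measurable_funB.
have pg : primitive (fun x => - f (s - x)) (fun x => phi (s - x)).
  split => //; first by exists K.
  move=> u v uv; rewrite opprK addrC fE; last by rewrite lerD2l lerN2.
  by rewrite (Rintegral_reflect s _ _ mphi) !opprB ![s + _]addrC !subrK.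
rewrite (zker_primitive a01 s0 pg).
have mh : measurable_fun setT (fun v : R => phi (s - v) * (v - 0) `^ (- a)).
  by apply: measurable_funM => //; exact: measurable_powRBl.
rewrite (Rintegral_reflect s _ _ mh) subrr subr0; apply: eq_Rintegral => x _.
by rewrite subr0 opprB [s + _]addrC subrK.
Qed.

End Zaehle_smooth.

(** * Composition of the two fractional derivatives of smooth paths *)

Section Zaehle_smooth_identity.
Context {R : realType}.
Local Notation mu := (@lebesgue_measure R).
Local Notation mR := (measurableTypeR R).
Variables (a t : R) (f phi g psi : R -> R).
Hypotheses (a01 : 0 < a < 1) (t0 : 0 < t).
Hypotheses (pf : primitive f phi) (pg : primitive g psi).

Let DL0 s := \int[mu]_(w in `]0, s[) (phi w * (s - w) `^ (- a)).
(** The left derivative in its integrated form, cut off outside []0, t[]: a function measurable on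
    the whole line, as Fubini's theorem on the plane demands. *)
Let DL := (fun s => f 0 * s `^ (- a) + DL0 s) \_ `]0, t[.

Let a0 : 0 < a. Proof. by case/andP: a01. Qed.
Let a1 : a < 1. Proof. by case/andP: a01. Qed.
Let a1' : 0 < 1 - a. Proof. by rewrite subr_gt0. Qed.
Let ea : - a = 1 - a - 1. Proof. by ring. Qed.
Let mphi : measurable_fun setT phi. Proof. by case: pf. Qed.
Let mpsi : measurable_fun setT psi. Proof. by case: pg. Qed.

Lemma zleft_DL0 s : 0 < s -> zleft a f s = f 0 * s `^ (- a) + DL0 s.
Proof. by move=> s0; rewrite (zleft_primitive a01 s0 pf). Qed.

Let mphipow : measurable_fun setT
  (fun p : mR * mR => phi p.2 * (p.1 - p.2) `^ (- a)).
Proof.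
apply: measurable_funM; first exact: measurable_fun2.
exact: measurable_powRB12.
Qed.

Lemma integral_norm_DL0 (K s : R) : 0 <= K -> (forall x, `|phi x| <= K) ->
  0 <= s -> s <= t ->
  (\int[mu]_(w in `]0%R, s[) (`|phi w * (s - w) `^ (- a)|)%:E
    <= (K * (t `^ (1 - a) / (1 - a)))%:E)%E.
Proof.
move=> K0 phiK s0 st.
have := integral_norm_bounded_powRBr mphi K0 phiK a1' s0; rewrite -ea => h.
apply: (le_trans h).
rewrite lee_fin subr0 ler_wpM2l// ler_wpM2r ?invr_ge0 ?(ltW a1')//.
by apply: ge0_ler_powR; rewrite ?nnegrE// ltW.
Qed.

Lemma integrable_DL0 : mu.-integrable `]0, t[ (EFin \o DL0).
Proof.
have [_ [K K0 phiK] _] := pf.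
have ih : mu.-integrable `]0, t[ (EFin \o cst (K * (t `^ (1 - a) / (1 - a)))).
  exact: (@integrable_bounded_itv R _ _ `|K * (t `^ (1 - a) / (1 - a))|).
have Fh s : 0 < s < t ->
    (\int[mu]_(w in `]0%R, s[) (`|phi w * (s - w) `^ (- a)|)%:E
    <= (K * (t `^ (1 - a) / (1 - a)))%:E)%E.
  by move=> /andP[s0 st]; apply: integral_norm_DL0 => //; exact: ltW.
have [h _ _] := triangle_Fubini_dominated mphipow ih Fh; exact: h.
Qed.

Lemma DL0_le (K s : R) : 0 <= K -> (forall x, `|phi x| <= K) -> 0 < s < t ->
  `|DL0 s| <= K * (t `^ (1 - a) / (1 - a)).
Proof.
move=> K0 phiK /andP[s0 st].
have i1 : mu.-integrable `]0, s[ (fun w => (phi w * (s - w) `^ (- a))%:E).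
  apply: (integrable_boundedM (@measurable_itvR _ _) (measurable_funTS mphi)
    (fun x _ => phiK x)).
  by rewrite ea; exact: integrable_powRBr a1' (ltW s0).
rewrite -lee_fin.
rewrite (EFin_normr_Rintegral (@measurable_itvR _ _) i1).
apply: (le_trans (le_abse_integral _ (@measurable_itvR _ _) (measurable_int _ i1))).
exact: (integral_norm_DL0 K0 phiK (ltW s0) (ltW st)).
Qed.

Lemma measurable_DL : measurable_fun setT DL.
Proof.
apply/(measurable_restrictT _ (@measurable_itvR _ _)); apply: measurable_funD.
  apply: measurable_funM => //; apply: measurable_funTS; exact: measurable_powR.
by apply/measurable_EFinP; exact: measurable_int integrable_DL0.
Qed.

Lemma DLE s : 0 < s < t -> DL s = zleft a f s.
Proof.
move=> s0t; rewrite /DL patchE ifT; last by rewrite inE/= in_itv.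
by rewrite zleft_DL0//; case/andP: s0t.
Qed.

(** The value [f 0] produces the singularity [s^-a]; the bounded remainder is absorbed in it through
    [t^(1 - a) = t t^-a <= t s^-a]. *)
Lemma DL_le : exists2 C, 0 <= C & forall s, 0 < s < t -> `|DL s| <= C * s `^ (- a).
Proof.
have [_ [K K0 phiK] _] := pf.
exists (`|f 0| + K * (t / (1 - a))).
  by rewrite addr_ge0// mulr_ge0// divr_ge0 ?(ltW t0)// (ltW a1').
move=> s /[dup] s0t /andP[s0 st]; rewrite DLE// zleft_DL0//.
rewrite (le_trans (ler_normD _ _))// mulrDl lerD//.
  by rewrite normrM [`|_ `^ _|]ger0_norm// powR_ge0.
apply: (le_trans (DL0_le K0 phiK s0t)).
rewrite -mulrA ler_wpM2l// mulrAC ler_wpM2r ?invr_ge0 ?(ltW a1')//.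
have -> : t `^ (1 - a) = t * t `^ (- a) by rewrite powRDgt0// powRr1 ?(ltW t0).
rewrite ler_wpM2l ?(ltW t0)// !powRN lef_pV2 ?posrE ?powR_gt0//.
by apply: ge0_ler_powR; rewrite ?nnegrE ltW.
Qed.

Let B := fine (betaK a).

Lemma Rintegral_beta v w : w < v ->
  \int[mu]_(u in `]w, v[) ((v - u) `^ (a - 1) * (u - w) `^ (- a)) = B.
Proof. by move=> wv; rewrite /Rintegral (integral_beta _ wv). Qed.

Lemma integrable_beta v w : w < v ->
  mu.-integrable `]w, v[ (fun u => ((v - u) `^ (a - 1) * (u - w) `^ (- a))%:E).
Proof.
move=> wv; apply/integrableP; split.
  apply/measurable_EFinP; apply: measurable_funTS; apply: measurable_funM.
    exact: measurable_powRBr.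
  exact: measurable_powRBl.
under eq_integral do rewrite gee0_abs ?lee_fin ?mulr_ge0 ?powR_ge0//.
by rewrite integral_beta// ltey_eq betaK_fin.
Qed.

(** Abel's inversion: the fractional integral of order [a] undoes the derivative. Composed with
    [(v - s)^(a - 1)], both [s^-a] and [(s - w)^-a] integrate to the Beta constant, leaving [f 0]
    plus the integral of [phi], which is [f v]. *)
Lemma Rintegral_zleft_kernel v : 0 < v < t ->
  \int[mu]_(s in `]0, v[) (DL s * (v - s) `^ (a - 1)) = B * f v.
Proof.
move=> /andP[v0 vt]; have [_ [K K0 phiK] fE] := pf.
have v0' := ltW v0; have vt' := ltW vt.
pose F s w := phi w * (s - w) `^ (- a) * (v - s) `^ (a - 1).
have mF : measurable_fun setT (fun p : mR * mR => F p.1 p.2).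
  apply: measurable_funM => //; exact: (measurable_fun1 (measurable_powRBr _ _)).
have ipv : mu.-integrable `]0, v[ (fun s => ((v - s) `^ (a - 1))%:E).
  exact: integrable_powRBr.
have ih := integrableZl (@measurable_itvR R _) (K * (t `^ (1 - a) / (1 - a))) ipv.
have Fh s : 0 < s < v -> (\int[mu]_(w in `]0%R, s[) (`|F s w|)%:E
    <= (K * (t `^ (1 - a) / (1 - a)) * (v - s) `^ (a - 1))%:E)%E.
  move=> /andP[s0 sv]; rewrite /F.
  have -> : (\int[mu]_(w in `]0%R, s[)
        (`|phi w * (s - w) `^ (- a) * (v - s) `^ (a - 1)|)%:E
      = \int[mu]_(w in `]0%R, s[) (((v - s) `^ (a - 1))%:E *
        (`|phi w * (s - w) `^ (- a)|)%:E))%E.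
    apply: eq_integral => w _.
    by rewrite normrM [X in (_ * X)%R]ger0_norm ?powR_ge0// mulrC EFinM.
  rewrite ge0_integralZl//.
  - rewrite mulrC EFinM lee_wpmul2l ?lee_fin ?powR_ge0//.
    by apply: integral_norm_DL0 => //; apply: ltW => //; exact: lt_trans vt.
  - apply/measurable_EFinP; apply: measurableT_comp => //.
    apply: measurable_funM; apply: measurable_funTS => //.
    exact: measurable_powRBr.
  - by rewrite lee_fin powR_ge0.
have [j1 j2 FE] := triangle_Fubini_dominated mF ih Fh.
have E1 s : s \in `]0, v[%classic -> DL s * (v - s) `^ (a - 1) =
    f 0 * ((v - s) `^ (a - 1) * (s - 0) `^ (- a))
     + \int[mu]_(w in `]0, s[) F s w.
  rewrite inE/= in_itv/= => /andP[s0 sv].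
  have i1 : mu.-integrable `]0, s[ (fun w => (phi w * (s - w) `^ (- a))%:E).
    apply: (integrable_boundedM (@measurable_itvR _ _) (measurable_funTS mphi)
      (fun x _ => phiK x)).
    by rewrite ea; exact: integrable_powRBr a1' (ltW s0).
  have s0t : 0 < s < t by rewrite s0 (lt_trans sv vt).
  rewrite (DLE s0t) (zleft_DL0 s0) /F.
  rewrite (RintegralZr _ (@measurable_itvR _ _) i1) mulrDl subr0 -/(DL0 s).
  by congr (_ + _); ring.
transitivity (\int[mu]_(s in `]0, v[)
   (f 0 * ((v - s) `^ (a - 1) * (s - 0) `^ (- a)) + \int[mu]_(w in `]0, s[) F s w)).
  exact: eq_Rintegral.
have i0 : mu.-integrable `]0, v[
    (EFin \o (fun s => f 0 * ((v - s) `^ (a - 1) * (s - 0) `^ (- a)))).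
  exact: (integrableZl (@measurable_itvR R _) _ (integrable_beta v0)).
rewrite (RintegralD (@measurable_itvR _ _) i0 j1).
rewrite (RintegralZl _ (@measurable_itvR _ _) (integrable_beta v0)).
rewrite (Rintegral_beta v0) FE.
have E2 w : w \in `]0, v[%classic -> \int[mu]_(s in `]w, v[) F s w = phi w * B.
  rewrite inE/= in_itv/= => /andP[w0 wv]; rewrite -(Rintegral_beta wv).
  rewrite -(RintegralZl _ (@measurable_itvR _ _) (integrable_beta wv)).
  by apply: eq_Rintegral => s _; rewrite /F; ring.
have iphi : mu.-integrable `]0, v[ (EFin \o phi).
  exact: integrable_bounded_itv phiK.
have -> : \int[mu]_(w in `]0, v[) (\int[mu]_(s in `]w, v[) F s w) =
    \int[mu]_(w in `]0, v[) (phi w * B) by exact: eq_Rintegral.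
rewrite (RintegralZr _ (@measurable_itvR _ _) iphi).
by rewrite -(fE _ _ v0'); ring.
Qed.

(** Expand [zker (1 - a) g t s] as the integral of [psi v (v - s)^(a - 1)] over [v > s] and exchange
    the integrals: the inner one is Abel's inversion. The integrability is recorded because it
    carries the measurability of the integrand, used in the estimates and limits below. *)
Lemma zaehle_smooth_gt0 :
  mu.-integrable `]0, t[ (fun s => (zleft a f s * zker (1 - a) g t s)%:E) /\
  \int[mu]_(s in `]0, t[) (zleft a f s * zker (1 - a) g t s) =
  B * \int[mu]_(v in `]0, t[) (f v * psi v).
Proof.
have [_ [K K0 psiK] gE] := pg.
have [C C0 DLC] := DL_le.
pose F v s := DL s * psi v * (v - s) `^ (a - 1).
have mF : measurable_fun setT (fun p : mR * mR => F p.1 p.2).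
  apply: measurable_funM.
    apply: measurable_funM; first exact: (measurable_fun2 measurable_DL).
    exact: (measurable_fun1 mpsi).
  exact: measurable_powRB12.
have ih : mu.-integrable `]0, t[ (EFin \o cst (C * K * B)).
  exact: (@integrable_bounded_itv R _ _ `|C * K * B|).
have Fh v : 0 < v < t ->
    (\int[mu]_(s in `]0%R, v[) (`|F v s|)%:E <= (C * K * B)%:E)%E.
  move=> /andP[v0 vt].
  have -> : (C * K * B)%:E = (\int[mu]_(s in `]0%R, v[)
      (C * K * ((v - s) `^ (a - 1) * (s - 0) `^ (- a)))%:E)%E.
    rewrite EFinM /B fineK ?betaK_fin// -(integral_beta a v0).
    rewrite -ge0_integralZl//.
    - exact: measurable_int (integrable_beta v0).
    - by move=> s _; rewrite lee_fin mulr_ge0 ?powR_ge0.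
    - by rewrite lee_fin mulr_ge0.
  apply: ge0_le_integral => //.
  - apply/measurable_EFinP; apply: measurableT_comp => //.
    apply: measurable_funTS; apply: measurable_funM.
      apply: measurable_funM => //; exact: measurable_DL.
    exact: measurable_powRBr.
  - exact: measurable_int (integrableZl (@measurable_itvR R _) _ (integrable_beta v0)).
  - move=> s; rewrite /= in_itv/= => /andP[s0 sv]; rewrite lee_fin /F !normrM subr0.
    rewrite [`|_ `^ _|]ger0_norm ?powR_ge0//.
    have := DLC s; rewrite s0 (lt_trans sv vt) => /(_ isT) h.
    have := psiK v; have := powR_ge0 (v - s) (a - 1) => p0 pK.
    rewrite [leRHS](_ : _ = (C * s `^ (- a)) * K * (v - s) `^ (a - 1)); last by ring.
    by rewrite ler_wpM2r// ler_pM.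
have [_ j2 FE] := triangle_Fubini_dominated mF ih Fh.
have E1 s : s \in `]0, t[%classic ->
    zleft a f s * zker (1 - a) g t s = \int[mu]_(v in `]s, t[) F v s.
  rewrite inE/= in_itv/= => /andP[s0 st].
  have a01' : 0 < 1 - a < 1 by apply/andP; split; [exact: a1'|rewrite gtrBl; exact: a0].
  rewrite (zker_primitive a01' st pg) -DLE; last by rewrite s0.
  have ip : mu.-integrable `]s, t[ (fun v => (psi v * (v - s) `^ (- (1 - a)))%:E).
    apply: (integrable_boundedM (@measurable_itvR _ _) (measurable_funTS mpsi)
      (fun x _ => psiK x)).
    have -> : - (1 - a) = a - 1 by ring.
    by apply: integrable_powRBl; [exact: a0|exact: ltW].
  rewrite -(RintegralZl _ (@measurable_itvR _ _) ip).
  by apply: eq_Rintegral => v _; rewrite /F (_ : - (1 - a) = a - 1); ring.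
split.
  apply: eq_integrable j2; first exact: measurable_itvR.
  by move=> s st; rewrite (E1 s st).
transitivity (\int[mu]_(s in `]0, t[) (\int[mu]_(v in `]s, t[) F v s)).
  exact: eq_Rintegral.
rewrite -FE.
have E2 v : v \in `]0, t[%classic ->
    \int[mu]_(s in `]0, v[) F v s = B * (f v * psi v).
  rewrite inE/= in_itv/= => /andP[v0 vt].
  have -> : B * (f v * psi v) = psi v * (B * f v) by ring.
  have v0t : 0 < v < t by rewrite v0.
  rewrite -(Rintegral_zleft_kernel v0t) -RintegralZl.
  - by apply: eq_Rintegral => s _; rewrite /F; ring.
  - exact: measurable_itvR.
  - have ib := integrableZl (@measurable_itvR R _) C (integrable_beta v0).
    apply: le_integrable ib; first exact: measurable_itvR.
      apply/measurable_EFinP; apply: measurable_funTS; apply: measurable_funM.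
        exact: measurable_DL.
      exact: measurable_powRBr.
    move=> s; rewrite /= in_itv/= => /andP[s0 sv]; rewrite lee_fin subr0.
    have h := DLC s; rewrite s0 (lt_trans sv vt) in h.
    have p1 := powR_ge0 (v - s) (a - 1); have p2 := powR_ge0 s (- a).
    have p3 : 0 <= C * ((v - s) `^ (a - 1) * s `^ (- a)) by rewrite !mulr_ge0.
    rewrite normrM (ger0_norm p1) (ger0_norm p3).
    rewrite [leRHS](_ : _ = (C * s `^ (- a)) * (v - s) `^ (a - 1)); last by ring.
    exact: (ler_wpM2r p1 (h isT)).
transitivity (\int[mu]_(v in `]0, t[) (B * (f v * psi v))).
  exact: eq_Rintegral.
exact: (RintegralZl _ (@measurable_itvR _ _) (integrable_primitiveM 0 t pf pg)).
Qed.

End Zaehle_smooth_identity.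

Lemma zaehle_smooth {R : realType} (a t : R) (f phi g psi : R -> R) :
  0 < a < 1 -> 0 <= t -> primitive f phi -> primitive g psi ->
  (@lebesgue_measure R).-integrable `]0, t[
    (fun s => (zleft a f s * zker (1 - a) g t s)%:E) /\
  \int[lebesgue_measure]_(s in `]0, t[) (zleft a f s * zker (1 - a) g t s) =
  fine (betaK a) * \int[lebesgue_measure]_(v in `]0, t[) (f v * psi v).
Proof.
move=> a01; rewrite le_eqVlt => /predU1P[<- _ _|t0 pf pg].
  by rewrite set_itvoo0 !Rintegral_set0 mulr0; split => //; exact: integrable_set0.
exact: (@zaehle_smooth_gt0 R a t f phi g psi).
Qed.

Section holder_on_line.
Context {R : realType} {V : normedModType R}.

Definition holder_on_line (C l : R) (f : R -> V) : Prop :=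
  forall x y, `|f x - f y| <= C * `|x - y| `^ l.

Lemma holder_on_line_continuous (C l : R) (f : R -> V) : 0 <= C -> 0 < l ->
  holder_on_line C l f -> continuous f.
Proof.
move=> C0 l0 fC x; apply/cvgrPdist_le => e e0; near=> y.
rewrite (le_trans (fC _ _))//.
have : `|x - y| <= (e / (C + 1)) `^ l^-1.
  near: y; apply: cvgr_dist_le => //.
  by rewrite powR_gt0// divr_gt0// ltr_wpDl.
have C1 : 0 < C + 1 by rewrite ltr_wpDl.
have eC : 0 <= e / (C + 1) by rewrite divr_ge0// ltW.
move=> h; have : `|x - y| `^ l <= e / (C + 1).
  apply: (@le_trans _ _ (((e / (C + 1)) `^ l^-1) `^ l)).
    by apply: ge0_ler_powR; rewrite ?nnegrE ?powR_ge0// ltW.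
  by rewrite -powRrM mulVf ?gt_eqF// powRr1.
rewrite ler_pdivlMr// mulrC; apply: le_trans.
by rewrite ler_wpM2r ?powR_ge0// lerDl.
Unshelve. all: end_near. Qed.

End holder_on_line.

(** * Steklov means *)

Section Steklov.
Context {R : realType}.
Local Notation mu := (@lebesgue_measure R).
Local Notation mR := (measurableTypeR R).
Implicit Types (f g : R -> R).

Lemma Rintegral_split (u v w : R) f : u <= v -> v <= w ->
  mu.-integrable `]u, w[ (EFin \o f) ->
  \int[mu]_(x in `]u, w[) f x =
  \int[mu]_(x in `]u, v[) f x + \int[mu]_(x in `]v, w[) f x.
Proof.
rewrite le_eqVlt => /predU1P[-> _ _|uv].
  by rewrite set_itvoo0 Rintegral_set0 add0r.
rewrite le_eqVlt => /predU1P[-> _|vw iw].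
  by rewrite set_itvoo0 Rintegral_set0 addr0.
have E : `]u, w[%classic = `]u, v] `|` `]v, w[ :> set mR.
  apply/seteqP; split => x /=; rewrite !in_itv/=.
    by move=> /andP[-> ->]; case: (leP x v) => //= _; [left|right].
  move=> [/andP[-> xv]|/andP[vx ->]]; first by rewrite (le_lt_trans xv).
  by rewrite (lt_trans uv).
have iuv : mu.-integrable `]u, v[ (EFin \o f).
  apply: (integrableS (@measurable_itvR _ _) (@measurable_itvR _ _)) iw.
  move=> x /=; rewrite !in_itv/= => /andP[-> xv] /=; exact: lt_trans vw.
have dj : [disjoint `]u, v] & `]v, w[] :> Prop.
  apply/disj_set2P; apply/seteqP; split => x //= -[]; rewrite !in_itv/=.
  by move=> /andP[_ xv] /andP[vx _]; rewrite leNgt vx in xv.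
rewrite E (Rintegral_setU (@measurable_itvR _ _) (@measurable_itvR _ _) _ dj).
  by congr (_ + _); exact/esym/(Rintegral_itv_bndo_bndc iuv).
by rewrite -E.
Qed.

Variables (f : R -> R) (M C l h : R).
Hypotheses (h0 : 0 < h) (fM : forall x, `|f x| <= M).
Hypotheses (C0 : 0 <= C) (l0 : 0 < l) (fC : holder_on_line C l f).

Definition steklov x := h^-1 * \int[mu]_(y in `]x, x + h[) f y.

Let mf : measurable_fun setT f.
Proof.
apply: continuous_measurable_fun; exact: holder_on_line_continuous C0 l0 fC.
Qed.

Let mfs x : measurable_fun setT (fun y : R => f (x + y)).
Proof. by apply: (measurableT_comp mf); exact: measurable_funD. Qed.

Let ifs (u v : R) : mu.-integrable `]u, v[ (EFin \o f).
Proof. exact: integrable_bounded_itv fM. Qed.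

Let ifx (x u v : R) : mu.-integrable `]u, v[ (fun y => (f (x + y))%:E).
Proof. exact: (integrable_bounded_itv u v (mfs x) (fun y => fM _)). Qed.

Let icst (u v c : R) : mu.-integrable `]u, v[ (fun=> c%:E).
Proof. exact: (@integrable_bounded_itv R u v `|c| (cst c)). Qed.

Lemma steklovE x : steklov x = h^-1 * \int[mu]_(y in `]0, h[) f (x + y).
Proof.
by rewrite /steklov (Rintegral_shift x _ _ mf) subrr [x + h]addrC addrK.
Qed.

Let average_le (k : R -> R) (c : R) : measurable_fun setT k ->
  (forall y, 0 < y < h -> `|k y| <= c) ->
  `|h^-1 * \int[mu]_(y in `]0, h[) k y| <= c.
Proof.
move=> mk kc; rewrite normrM ger0_norm ?invr_ge0 ?(ltW h0)// mulrC ler_pdivrMr//.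
rewrite -[X in c * X](subr0 h) -(Rintegral_cst_itv c (ltW h0)).
apply: le_normr_Rintegral_dom.
- exact: measurable_itvR.
- exact: measurable_funTS.
- exact: icst.
- by move=> y; rewrite /= in_itv/=; exact: kc.
Qed.

(** Averaging does not increase the modulus of continuity: the constant is that of [f], whatever [h]
    is, which allows a passage to the limit in the Young estimate. *)
Lemma steklov_holder : holder_on_line C l steklov.
Proof.
move=> x y; rewrite !steklovE -mulrBr.
rewrite -(RintegralB (@measurable_itvR _ _) (ifx x 0 h) (ifx y 0 h)).
apply: average_le.
  exact: measurable_funB (mfs x) (mfs y).
move=> z _; rewrite (le_trans (fC _ _))//.
by have -> : x + z - (y + z) = x - y by ring.
Qed.

Lemma steklov_bound x : `|steklov x| <= M.
Proof. by rewrite steklovE; apply: average_le => //. Qed.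

Lemma steklov_dist x : `|steklov x - f x| <= C * h `^ l.
Proof.
have -> : f x = h^-1 * \int[mu]_(y in `]0, h[) f x.
  by rewrite Rintegral_cst_itv ?(ltW h0)// subr0; field; rewrite gt_eqF.
rewrite steklovE -mulrBr.
rewrite -(RintegralB (@measurable_itvR _ _) (ifx x 0 h) (icst 0 h (f x))).
apply: average_le; first exact: measurable_funB (mfs x) (measurable_cst _).
move=> z /andP[z0 zh]; rewrite (le_trans (fC _ _))// ler_wpM2l//.
rewrite addrC addKr ger0_norm ?(ltW z0)//.
by apply: ge0_ler_powR; rewrite ?nnegrE ltW.
Qed.

(** The density is the difference quotient of [f]. Its bound blows up as [h] tends to 0, but the
    estimates for smooth paths see only Hoelder constants. *)
Lemma steklov_primitive :
  primitive steklov (fun w => h^-1 * (f (h + w) - f w)).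
Proof.
have M0 : 0 <= M by apply: le_trans (fM 0).
split.
- by apply: measurable_funM => //; exact: measurable_funB.
- exists (h^-1 * (M + M)); first by rewrite mulr_ge0 ?addr_ge0// invr_ge0 ltW.
  move=> x; rewrite normrM ger0_norm ?invr_ge0 ?(ltW h0)//.
  rewrite ler_wpM2l ?invr_ge0 ?(ltW h0)// (le_trans (ler_normB _ _))//.
  by rewrite lerD.
- move=> u v uv; rewrite /steklov.
  have iB : mu.-integrable `]u, v[ (fun w => (f (h + w) - f w)%:E).
    exact: (integrableB (@measurable_itvR _ _) (ifx h u v) (ifs u v)).
  rewrite (RintegralZl _ (@measurable_itvR _ _) iB) -mulrBr; congr (_ * _).
  rewrite (RintegralB (@measurable_itvR _ _) (ifx h u v) (ifs u v)).
  have := Rintegral_shift h (u + h) (v + h) mf; rewrite !addrK => <-.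
  have huv : u + h <= v + h by rewrite lerD2r.
  have uh : u <= u + h by rewrite lerDl ltW.
  have vh : v <= v + h by rewrite lerDl ltW.
  have E1 := Rintegral_split uh huv (ifs _ _).
  rewrite (Rintegral_split uv vh (ifs _ _)) in E1.
  apply/eqP; rewrite subr_eq addrAC [X in _ == X - _]addrC -E1.
  by rewrite [X in _ == X - _]addrC addrK.
Qed.

End Steklov.

(** * The Young estimate for Hoelder paths on the line *)

Section Zaehle_Holder.
Context {R : realType}.
Local Notation mu := (@lebesgue_measure R).
Local Notation mR := (measurableTypeR R).
Implicit Types (f g : R -> R).

Lemma le_limit (u : R^nat) (l c : R) :
  u @ \oo --> l -> (forall n, u n <= c) -> l <= c.
Proof.
move=> ul uc; rewrite -(cvg_lim _ ul)//.
by apply: limr_le; [apply/cvg_ex; exists l|near=> n].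
Unshelve. all: end_near. Qed.

Lemma norm_le_limit (u : R^nat) (l c : R) :
  u @ \oo --> l -> (forall n, `|u n| <= c) -> `|l| <= c.
Proof. by move=> /cvg_norm; exact: le_limit. Qed.

Lemma Rintegral_dominated_cvg (D : set mR) (u : (R -> R)^nat) (v h : R -> R) :
  measurable D -> (forall n, measurable_fun D (u n)) ->
  (forall x, D x -> (u ^~ x) @ \oo --> v x) ->
  mu.-integrable D (EFin \o h) -> (forall n x, D x -> `|u n x| <= h x) ->
  (fun n => \int[mu]_(x in D) u n x) @ \oo --> \int[mu]_(x in D) v x.
Proof.
move=> mD mun uv ih uh.
have mv : measurable_fun D v by exact: measurable_fun_cvg uv.
have [||||| iv _ cv] := @dominated_convergence _ mR R mu D mD
  (fun n => EFin \o u n) (EFin \o v) (EFin \o h).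
- by move=> n; exact/measurable_EFinP.
- exact/measurable_EFinP.
- by apply: aeW => x Dx; apply: cvg_EFin; [near=> n|exact: uv].
- exact: ih.
- by apply: aeW => x n Dx; rewrite lee_fin; exact: uh.
apply: fine_cvg; rewrite fineK; [exact: cv|exact: integrable_fin_num iv].
Unshelve. all: end_near. Qed.

Lemma holder_measurable (C l : R) f : 0 <= C -> 0 < l ->
  holder_on_line C l f -> measurable_fun setT f.
Proof.
move=> C0 l0 fC; apply: continuous_measurable_fun.
exact: holder_on_line_continuous C0 l0 fC.
Qed.

Lemma measurable_zker_integrand a s g : measurable_fun setT g ->
  measurable_fun setT (fun u : R => (g u - g s) / (u - s) `^ (1 + a)).
Proof.
move=> mg; apply: measurable_funM; first exact: measurable_funB.
rewrite (_ : (fun _ => _) = fun u : mR => (u - s) `^ (- (1 + a))).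
  exact: measurable_powRBl.
by apply/funext => u; rewrite powRN.
Qed.

Lemma zker_integrand_le (a l C s t u : R) g : 0 < a < l -> 0 <= C ->
  holder_on_line C l g -> s < u ->
  `|(g u - g s) / (u - s) `^ (1 + a)| <= C * (u - s) `^ (l - a - 1).
Proof.
move=> /andP[a0 al] C0 gC su; have us : 0 < u - s by rewrite subr_gt0.
rewrite normrM normfV [`|_ `^ _|]ger0_norm ?powR_ge0//.
have -> : l - a - 1 = l + - (1 + a) by ring.
rewrite (powRDgt0 _ _ us) [X in _ * (_ * X)]powRN mulrA.
rewrite ler_wpM2r ?invr_ge0 ?powR_ge0//.
by have := gC u s; rewrite [`|u - s|]ger0_norm ?(ltW us).
Qed.

Lemma integrable_zker_bound (a l C s t : R) : 0 < a < l -> s <= t ->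
  mu.-integrable `]s, t[ (EFin \o (fun u => C * (u - s) `^ (l - a - 1))).
Proof.
move=> /andP[a0 al] st; have la : 0 < l - a by rewrite subr_gt0.
exact: (integrableZl (@measurable_itvR R _) C (integrable_powRBl la st)).
Qed.

(** The boundary term of [zker] contributes 1, the integral [a / (l - a)], both in units of
    [C (t - s)^(l - a)]. *)
Definition zker_const (a l : R) : R := 1 + a / (l - a).

Lemma zker_const_ge0 (a l : R) : 0 < a < l -> 0 <= zker_const a l.
Proof.
move=> /andP[a0 al]; rewrite /zker_const addr_ge0// divr_ge0 ?subr_ge0//;
  exact: ltW.
Qed.

Lemma zker_le (a l C s t : R) g : 0 < a < l -> 0 <= C ->
  holder_on_line C l g -> s < t ->
  `|zker a g t s| <= C * zker_const a l * (t - s) `^ (l - a).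
Proof.
move=> al C0 gC st; have /andP[a0 al'] := al.
have la : 0 < l - a by rewrite subr_gt0.
have l0 : 0 < l by exact: lt_trans al'.
have mg := holder_measurable C0 l0 gC.
have ts : 0 < t - s by rewrite subr_gt0.
have H1 : `|(g t - g s) / (t - s) `^ a| <= C * (t - s) `^ (l - a).
  rewrite normrM normfV [`|_ `^ _|]ger0_norm ?powR_ge0//.
  rewrite (powRDgt0 _ _ ts) powRN mulrA.
  rewrite ler_wpM2r ?invr_ge0 ?powR_ge0//.
  by have := gC t s; rewrite [`|t - s|]ger0_norm ?(ltW ts).
have H2 : `|\int[mu]_(u in `]s, t[) ((g u - g s) / (u - s) `^ (1 + a))|
    <= C * ((t - s) `^ (l - a) / (l - a)).
  rewrite -(Rintegral_powRBl la (ltW st)).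
  rewrite -(RintegralZl _ (@measurable_itvR _ _) (integrable_powRBl la (ltW st))).
  apply: le_normr_Rintegral_dom.
  - exact: measurable_itvR.
  - exact: (measurable_funTS (measurable_zker_integrand a s mg)).
  - exact: integrable_zker_bound al (ltW st).
  - move=> u; rewrite /= in_itv/= => /andP[su _].
    exact: zker_integrand_le al C0 gC su.
rewrite /zker (le_trans (ler_normD _ _))//.
rewrite [X in _ + X]normrM (gtr0_norm a0).
have -> : C * zker_const a l * (t - s) `^ (l - a) = C * (t - s) `^ (l - a) +
   a * (C * ((t - s) `^ (l - a) / (l - a))) by rewrite /zker_const; ring.
by apply: lerD => //; rewrite ler_wpM2l// ltW.
Qed.

(** Pointwise convergence suffices, because a common Hoelder constant provides the majorant
    [C (u - s)^(l - a - 1)]. *)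
Lemma zker_cvg (a l C s t : R) (gn : (R -> R)^nat) g : 0 < a < l -> 0 <= C ->
  (forall n, holder_on_line C l (gn n)) ->
  (forall x, (gn ^~ x) @ \oo --> g x) -> s < t ->
  (fun n => zker a (gn n) t s) @ \oo --> zker a g t s.
Proof.
move=> al C0 gnC gng st; have /andP[a0 al'] := al.
have l0 : 0 < l by exact: lt_trans al'.
apply: cvgD.
  by apply: cvgM; [apply: cvgB; exact: gng|exact: cvg_cst].
apply: cvgM; first exact: cvg_cst.
apply: (Rintegral_dominated_cvg (h := fun u => C * (u - s) `^ (l - a - 1))).
- exact: measurable_itvR.
- move=> n; apply: measurable_funTS; apply: measurable_zker_integrand.
  exact: holder_measurable C0 l0 (gnC n).
- by move=> x _; apply: cvgM; [apply: cvgB; exact: gng|exact: cvg_cst].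
- exact: integrable_zker_bound al (ltW st).
- move=> n u; rewrite /= in_itv/= => /andP[su _].
  exact: zker_integrand_le al C0 (gnC n) su.
Qed.

Lemma holder_reflect (C l s : R) f : holder_on_line C l f ->
  holder_on_line C l (fun x => - f (s - x)).
Proof.
move=> fC x y; rewrite -opprD normrN (le_trans (fC _ _))//.
have -> : s - x - (s - y) = y - x by ring.
by rewrite distrC.
Qed.

Lemma zleft_le (a l C s : R) f : 0 < a < l -> 0 <= C ->
  holder_on_line C l f -> 0 < s ->
  `|zleft a f s| <= `|f 0| * s `^ (- a) + C * zker_const a l * s `^ (l - a).
Proof.
move=> al C0 fC s0; have /andP[a0 al'] := al.
have l0 : 0 < l by exact: lt_trans al'.
rewrite (zleft_zker _ (holder_measurable C0 l0 fC) s0).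
rewrite (le_trans (ler_normD _ _))// lerD//.
  by rewrite normrM powRN normfV [`|_ `^ _|]ger0_norm ?powR_ge0.
by have := zker_le al C0 (@holder_reflect _ _ s _ fC) s0; rewrite subr0.
Qed.

Lemma zleft_cvg (a l C s : R) (fn : (R -> R)^nat) f : 0 < a < l -> 0 <= C ->
  (forall n, holder_on_line C l (fn n)) -> holder_on_line C l f ->
  (forall x, (fn ^~ x) @ \oo --> f x) -> 0 < s ->
  (fun n => zleft a (fn n) s) @ \oo --> zleft a f s.
Proof.
move=> al C0 fnC fC fnf s0; have /andP[a0 al'] := al.
have l0 : 0 < l by exact: lt_trans al'.
rewrite (zleft_zker _ (holder_measurable C0 l0 fC) s0).
under eq_fun do rewrite (zleft_zker _ (holder_measurable C0 l0 (fnC _)) s0).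
apply: cvgD; first by apply: cvgM; [exact: fnf|exact: cvg_cst].
apply: (zker_cvg al C0) => //.
- by move=> n; exact: holder_reflect.
- by move=> x; apply: cvgN; exact: fnf.
Qed.

Lemma powR_harmonic_cvg0 (p : R) : 0 < p ->
  (fun n => n.+1%:R^-1 `^ p) @ \oo --> (0 : R).
Proof.
move=> /powR_cvg0 /cvg_at_rightP; apply; split => //; exact: cvg_harmonic.
Qed.

Definition zint (a : R) f g (t : R) : R :=
  \int[mu]_(s in `]0, t[) (zleft a f s * zker (1 - a) g t s).

Lemma zint0 (a : R) f g : zint a f g 0 = 0.
Proof. by rewrite /zint set_itvoo0 Rintegral_set0. Qed.

Lemma primitive_shift (s c : R) f phi : primitive f phi ->
  primitive (fun x => f (s + x) - c) (fun x => phi (s + x)).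
Proof.
move=> [mphi [K K0 phiK] fE]; split.
- by apply: (measurableT_comp mphi); exact: measurable_funD.
- by exists K.
- move=> u v uv; have suv : s + u <= s + v by rewrite lerD2l.
  have := fE _ _ suv; rewrite (Rintegral_shift s _ _ mphi).
  have -> : s + u - s = u by ring.
  have -> : s + v - s = v by ring.
  by move=> <-; ring.
Qed.

(** The integral over []0, t[] is nonlocal, so its increments are not visibly integrals over []s,
    t[]. For smooth paths each term is the Beta constant times an integral of [f psi]; the left side
    is thus that of [(f - f s) psi] over []s, t[], which after a shift is a [zint] started at 0 with
    an integrand vanishing there. *)
Lemma zint_smooth_increment (a s t : R) f phi g psi : 0 < a < 1 ->
  0 <= s -> s <= t -> primitive f phi -> primitive g psi ->
  zint a f g t - zint a f g s - fine (betaK a) * (f s * (g t - g s)) =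
  zint a (fun x => f (s + x) - f s) (fun x => g (s + x) - 0) (t - s).
Proof.
move=> a01 s0 st pf pg; have t0 : 0 <= t by exact: le_trans st.
have ts0 : 0 <= t - s by rewrite subr_ge0.
have [mpsi [K K0 psiK] gE] := pg.
have [_ E1] := zaehle_smooth a01 t0 pf pg.
have [_ E2] := zaehle_smooth a01 s0 pf pg.
have [_ E3] := zaehle_smooth a01 ts0 (primitive_shift s (f s) pf)
  (primitive_shift s 0 pg).
rewrite /zint E1 E2 E3 -!mulrBr; congr (_ * _).
have mf := measurable_primitive pf.
have mfpsi : measurable_fun setT (fun x : R => (f x - f s) * psi x).
  by apply: measurable_funM => //; exact: measurable_funB.
have := Rintegral_shift s s t mfpsi; rewrite subrr => <-.
rewrite (Rintegral_split s0 st (integrable_primitiveM 0 t pf pg)).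
have ipsi : mu.-integrable `]s, t[ (EFin \o psi).
  exact: integrable_bounded_itv psiK.
have ic : mu.-integrable `]s, t[ (fun x => (f s * psi x)%:E).
  exact: (integrableZl (@measurable_itvR R _) _ ipsi).
rewrite [X in X - _ - _ = _]addrC addrK (gE _ _ st).
rewrite -(RintegralZl _ (@measurable_itvR _ _) ipsi).
rewrite -(RintegralB (@measurable_itvR _ _) (integrable_primitiveM s t pf pg) ic).
by apply: eq_Rintegral => x _; rewrite mulrBl.
Qed.

Variables (a m l : R).
Hypotheses (a01 : 0 < a < 1) (am : a < m) (al : 1 - a < l).

Let a0 : 0 < a. Proof. by case/andP: a01. Qed.
Let am' : 0 < a < m. Proof. by rewrite a0. Qed.
Let a1' : 0 < 1 - a. Proof. by rewrite subr_gt0; case/andP: a01. Qed.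
Let al' : 0 < 1 - a < l. Proof. by rewrite a1'. Qed.
Let m0 : 0 < m. Proof. exact: lt_trans am. Qed.
Let l0 : 0 < l. Proof. exact: lt_trans al. Qed.

Definition young_const := zker_const a m * zker_const (1 - a) l.

Lemma young_const_ge0 : 0 <= young_const.
Proof. by rewrite mulr_ge0// zker_const_ge0. Qed.

(** Since [f 0 = 0], the singular term of [zleft] disappears and the integrand is bounded by a
    multiple of [t^(m - a) t^(l - (1 - a))]; the length of the interval supplies the last factor
    [t]. *)
Lemma zint_smooth_le (Cf Cg t : R) f phi g psi : 0 <= Cf -> 0 <= Cg ->
  0 <= t -> primitive f phi -> primitive g psi ->
  holder_on_line Cf m f -> holder_on_line Cg l g -> f 0 = 0 ->
  `|zint a f g t| <= young_const * Cf * Cg * t `^ (m + l).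
Proof.
move=> Cf0 Cg0; rewrite le_eqVlt => /predU1P[<- *|t0 pf pg fC gC f00].
  rewrite zint0 normr0; apply: mulr_ge0; last exact: powR_ge0.
  apply: mulr_ge0 => //; apply: mulr_ge0 => //; exact: young_const_ge0.
have [ifg _] := zaehle_smooth a01 (ltW t0) pf pg.
have p1 : 0 <= m - a by rewrite subr_ge0 ltW.
have p2 : 0 <= l - (1 - a) by rewrite subr_ge0 ltW.
have k1 := zker_const_ge0 am'; have k2 := zker_const_ge0 al'.
pose c := (Cf * zker_const a m * t `^ (m - a)) *
  (Cg * zker_const (1 - a) l * t `^ (l - (1 - a))).
have -> : young_const * Cf * Cg * t `^ (m + l) = c * (t - 0).
  have -> : m + l = (m - a) + (l - (1 - a)) + 1 by ring.
  rewrite (powRDgt0 _ 1 t0) (powRDgt0 (m - a) _ t0) powRr1 ?(ltW t0)//.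
  by rewrite /young_const /c; ring.
rewrite -(Rintegral_cst_itv c (ltW t0)).
apply: le_normr_Rintegral_dom.
- exact: measurable_itvR.
- by apply/measurable_EFinP; exact: measurable_int ifg.
- exact: (@integrable_bounded_itv R _ _ `|c| (cst c)).
- move=> s; rewrite /= in_itv/= => /andP[s0 st]; rewrite normrM.
  apply: ler_pM => //.
    apply: (le_trans (zleft_le am' Cf0 fC s0)).
    rewrite f00 normr0 mul0r add0r ler_wpM2l ?mulr_ge0//.
    by apply: ge0_ler_powR; rewrite ?nnegrE// ltW.
  apply: (le_trans (zker_le al' Cg0 gC st)).
  rewrite ler_wpM2l ?mulr_ge0//.
  apply: ge0_ler_powR; rewrite ?nnegrE//.
  - by rewrite subr_ge0 ltW.
  - exact: ltW.
  - by rewrite gerBl ltW.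
Qed.

Lemma zint_cvg (Cf Cg M t : R) (fn gn : (R -> R)^nat) f g :
  0 <= Cf -> 0 <= Cg -> 0 <= t ->
  (forall n, exists phi, primitive (fn n) phi) ->
  (forall n, exists psi, primitive (gn n) psi) ->
  (forall n, holder_on_line Cf m (fn n)) ->
  (forall n, holder_on_line Cg l (gn n)) ->
  (forall n, `|fn n 0| <= M) -> holder_on_line Cf m f ->
  (forall x, (fn ^~ x) @ \oo --> f x) -> (forall x, (gn ^~ x) @ \oo --> g x) ->
  (fun n => zint a (fn n) (gn n) t) @ \oo --> zint a f g t.
Proof.
move=> Cf0 Cg0 t0 pf pg fC gC fM fC' cf cg.
have M0 : 0 <= M by exact: le_trans (fM 0).
have p1 : 0 <= m - a by rewrite subr_ge0 ltW.
have p2 : 0 <= l - (1 - a) by rewrite subr_ge0 ltW.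
have k1 := zker_const_ge0 am'; have k2 := zker_const_ge0 al'.
pose c1 := Cf * zker_const a m * t `^ (m - a).
pose c2 := Cg * zker_const (1 - a) l * t `^ (l - (1 - a)).
have c10 : 0 <= c1 by rewrite !mulr_ge0// powR_ge0.
have c20 : 0 <= c2 by rewrite !mulr_ge0// powR_ge0.
(* The initial values contribute [M s^-a], integrable as [a < 1]; all other powers have nonnegative
   exponents, since [a < m] and [1 - a < l], and are bounded on []0, t[]. *)
apply: (Rintegral_dominated_cvg (h := fun s => c2 * (M * s `^ (- a) + c1))).
- exact: measurable_itvR.
- move=> n; have [phi pfn] := pf n; have [psi pgn] := pg n.
  have [ifg _] := zaehle_smooth a01 t0 pfn pgn.
  by apply/measurable_EFinP; exact: measurable_int ifg.
- move=> s; rewrite /= in_itv/= => /andP[s0 st]; apply: cvgM.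
    exact: zleft_cvg am' Cf0 fC fC' cf s0.
  exact: zker_cvg al' Cg0 gC cg st.
- have i1 := integrable_powRBl a1' t0.
  have E : (fun s : R => ((s - 0) `^ (1 - a - 1))%:E) =
      (fun s : R => (s `^ (- a))%:E).
    by apply/funext => s; rewrite subr0; congr (_ `^ _)%:E; ring.
  rewrite E in i1.
  have i2 : mu.-integrable `]0, t[ (fun=> c1%:E).
    exact: (@integrable_bounded_itv R _ _ `|c1| (cst c1)).
  have i3 := integrableZl (@measurable_itvR R _) M i1.
  exact: (integrableZl (@measurable_itvR R _) c2
    (integrableD (@measurable_itvR R _) i3 i2)).
- move=> n s; rewrite /= in_itv/= => /andP[s0 st]; rewrite normrM mulrC.
  apply: ler_pM => //.
    apply: (le_trans (zker_le al' Cg0 (gC n) st)).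
    rewrite ler_wpM2l ?mulr_ge0//.
    apply: ge0_ler_powR; rewrite ?nnegrE//.
    - by rewrite subr_ge0 ltW.
    - by rewrite gerBl ltW.
  apply: (le_trans (zleft_le am' Cf0 (fC n) s0)); apply: lerD.
    by rewrite ler_wpM2r ?powR_ge0.
  rewrite ler_wpM2l ?mulr_ge0//.
  by apply: ge0_ler_powR; rewrite ?nnegrE// ltW.
Qed.

(** For smooth paths the increment identity reduces the claim to a start at 0. Steklov means of
    width [1 / (n + 1)] share the Hoelder constants of [f] and [g], so the bound survives the
    limit. *)
Lemma zint_young (Cf Cg Mf Mg s t : R) f g : 0 <= Cf -> 0 <= Cg ->
  holder_on_line Cf m f -> holder_on_line Cg l g ->
  (forall x, `|f x| <= Mf) -> (forall x, `|g x| <= Mg) ->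
  0 <= s -> s <= t ->
  `|zint a f g t - zint a f g s - fine (betaK a) * (f s * (g t - g s))|
    <= young_const * Cf * Cg * (t - s) `^ (m + l).
Proof.
move=> Cf0 Cg0 fC gC fM gM s0 st.
have t0 : 0 <= t by exact: le_trans st.
have ts0 : 0 <= t - s by rewrite subr_ge0.
pose fn n := steklov f n.+1%:R^-1; pose gn n := steklov g n.+1%:R^-1.
have h0 n : 0 < n.+1%:R^-1 :> R by [].
have pf n := steklov_primitive (h0 n) fM Cf0 m0 fC.
have pg n := steklov_primitive (h0 n) gM Cg0 l0 gC.
have fnC n := steklov_holder (h0 n) fM Cf0 m0 fC.
have gnC n := steklov_holder (h0 n) gM Cg0 l0 gC.
have cst_cvg (C p : R) (k : R -> R) (kn : (R -> R)^nat) : 0 < p ->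
    (forall n x, `|kn n x - k x| <= C * n.+1%:R^-1 `^ p) ->
    forall x, (kn ^~ x) @ \oo --> k x.
  move=> p0 kC x; apply/subr_cvg0; apply: norm_cvg0.
  have cp : (fun n => C * n.+1%:R^-1 `^ p) @ \oo --> (0 : R).
    by rewrite -(mulr0 C); apply: cvgM; [exact: cvg_cst|exact: powR_harmonic_cvg0].
  apply: (squeeze_cvgr _ (cvg_cst 0) cp).
  by near=> n; rewrite normr_ge0 kC.
have cf x : (fn ^~ x) @ \oo --> f x.
  apply: (cst_cvg Cf m) => // n y; exact: (steklov_dist (h0 n) fM Cf0 m0 fC).
have cg x : (gn ^~ x) @ \oo --> g x.
  apply: (cst_cvg Cg l) => // n y; exact: (steklov_dist (h0 n) gM Cg0 l0 gC).
have zc u : 0 <= u -> (fun n => zint a (fn n) (gn n) u) @ \oo --> zint a f g u.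
  move=> u0; apply: (zint_cvg (M := Mf) Cf0 Cg0 u0) => //.
  - by move=> n; eexists; exact: pf.
  - by move=> n; eexists; exact: pg.
  - by move=> n; exact: steklov_bound (h0 n) fM Cf0 m0 fC 0.
apply: (norm_le_limit (u := fun n => zint a (fn n) (gn n) t -
   zint a (fn n) (gn n) s - fine (betaK a) * (fn n s * (gn n t - gn n s)))).
  apply: cvgB; first by apply: cvgB; exact: zc.
  apply: cvgM; first exact: cvg_cst.
  by apply: cvgM; [exact: cf|apply: cvgB; exact: cg].
move=> n; rewrite (zint_smooth_increment a01 s0 st (pf n) (pg n)).
apply: (zint_smooth_le Cf0 Cg0 ts0 (primitive_shift _ _ (pf n))
  (primitive_shift _ _ (pg n))).
- move=> x y; have := fnC n (s + x) (s + y).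
  have -> : s + x - (s + y) = x - y by ring.
  by have -> : fn n (s + x) - fn n s - (fn n (s + y) - fn n s)
    = fn n (s + x) - fn n (s + y) by ring.
- move=> x y; have := gnC n (s + x) (s + y); rewrite !subr0.
  by have -> : s + x - (s + y) = x - y by ring.
- by rewrite addr0 subrr.
Unshelve. all: end_near. Qed.

(** The Young estimate on each of the [n + 1] cells adds up to an error of order
    [(n + 1) (n + 1)^-(m + l)], which vanishes as [m + l > 1]. This presents the integral as a limit
    of finite sums, hence as a measurable function of the paths. *)
Lemma zint_riemann (Cf Cg Mf Mg t : R) f g : 1 < m + l -> 0 <= Cf -> 0 <= Cg ->
  holder_on_line Cf m f -> holder_on_line Cg l g ->
  (forall x, `|f x| <= Mf) -> (forall x, `|g x| <= Mg) -> 0 <= t ->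
  (fun n => fine (betaK a) * \sum_(i < n.+1) f (t * (i%:R / n.+1%:R)) *
     (g (t * (i.+1%:R / n.+1%:R)) - g (t * (i%:R / n.+1%:R)))) @ \oo -->
  zint a f g t.
Proof.
move=> ml Cf0 Cg0 fC gC fM gM t0.
have ml0 : 0 < m + l - 1 by rewrite subr_gt0.
pose D := young_const * Cf * Cg * t `^ (m + l).
have bound n : `|fine (betaK a) * \sum_(i < n.+1) f (t * (i%:R / n.+1%:R)) *
     (g (t * (i.+1%:R / n.+1%:R)) - g (t * (i%:R / n.+1%:R)))
     - zint a f g t| <= D * n.+1%:R^-1 `^ (m + l - 1).
  pose p (i : nat) : R := t * (i%:R / n.+1%:R).
  have n0 : 0 < n.+1%:R :> R by [].
  have nV0 : 0 < n.+1%:R^-1 :> R by rewrite invr_gt0.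
  have p0 i : 0 <= p i by rewrite mulr_ge0// divr_ge0.
  have dp i : p i.+1 - p i = t * n.+1%:R^-1.
    by rewrite /p -mulrBr -mulrBl -natrB// subSnn mul1r.
  have pS i : p i <= p i.+1 by rewrite -subr_ge0 dp mulr_ge0// ltW.
  have -> : zint a f g t = \sum_(0 <= i < n.+1) (zint a f g (p i.+1) - zint a f g (p i)).
    rewrite telescope_sumr// /p mul0r mulr0 zint0 subr0 divff ?mulr1//.
  rewrite distrC big_mkord mulr_sumr -sumrB.
  apply: (le_trans (ler_norm_sum _ _ _)).
  have -> : D * n.+1%:R^-1 `^ (m + l - 1) =
      \sum_(i < n.+1) (young_const * Cf * Cg * (t * n.+1%:R^-1) `^ (m + l)).
    have Eh : n.+1%:R^-1 `^ (m + l) = n.+1%:R^-1 `^ (m + l - 1) * n.+1%:R^-1.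
      by rewrite powRS//; congr (_ `^ _); ring.
    rewrite sumr_const card_ord -[RHS]mulr_natr powRM ?(ltW nV0)// Eh /D.
    by field; rewrite ?add1n ?pnatr_eq0.
  apply: ler_sum => i _; rewrite -(dp i) -/(p i) -/(p i.+1).
  exact: (zint_young Cf0 Cg0 fC gC fM gM (p0 i) (pS i)).
apply/subr_cvg0; apply: norm_cvg0.
have cp : (fun n => D * n.+1%:R^-1 `^ (m + l - 1)) @ \oo --> (0 : R).
  by rewrite -(mulr0 D); apply: cvgM; [exact: cvg_cst|exact: powR_harmonic_cvg0].
apply: (squeeze_cvgr _ (cvg_cst 0) cp).
by near=> n; rewrite normr_ge0 bound.
Unshelve. all: end_near. Qed.

End Zaehle_Holder.

Section Zaehle_interval.
Context {R : realType}.
Local Notation mu := (@lebesgue_measure R).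
Local Notation mR := (measurableTypeR R).
Implicit Types (f g : R -> R).

(** Projection of the line onto [[a, b]]. Being monotone and 1-Lipschitz, it extends a path from the
    interval to the line with the same Hoelder constant. *)
Definition clamp (a b x : R) : R := Num.max a (Num.min b x).

Lemma clamp_itv (a b x : R) : a <= b -> a <= clamp a b x <= b.
Proof. by move=> ab; rewrite /clamp le_max lexx/= ge_max ab ge_min lexx. Qed.

Lemma clamp_id (a b x : R) : a <= x <= b -> clamp a b x = x.
Proof. by move=> /andP[ax xb]; rewrite /clamp min_r// max_r. Qed.

Lemma clamp_mono (a b x y : R) : x <= y -> clamp a b x <= clamp a b y.
Proof.
move=> xy; rewrite /clamp.
case: (leP b x) => ?; case: (leP b y) => ?; case: (leP a b) => ?;
  case: (leP a x) => ?; case: (leP a y) => ?; lra.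
Qed.

Lemma clamp_lip (a b x y : R) : a <= b -> x <= y ->
  clamp a b y - clamp a b x <= y - x.
Proof.
move=> ab xy; rewrite /clamp.
case: (leP b x) => ?; case: (leP b y) => ?; case: (leP a b) => ?;
  case: (leP a x) => ?; case: (leP a y) => ?; lra.
Qed.

Definition holder_on {V : normedModType R} (a b C l : R) (x : R -> V) : Prop :=
  forall s t, a <= s -> s <= t -> t <= b -> `|x t - x s| <= C * (t - s) `^ l.

Lemma holder_clamp {V : normedModType R} (a b C l : R) (f : R -> V) : a <= b -> 0 <= C -> 0 < l ->
  holder_on a b C l f -> holder_on_line C l (f \o clamp a b).
Proof.
move=> ab C0 l0 fC.
have H x y : x <= y -> `|f (clamp a b y) - f (clamp a b x)| <= C * `|y - x| `^ l.
  move=> xy; have /andP[cx1 cx2] := clamp_itv x ab.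
  have /andP[cy1 cy2] := clamp_itv y ab.
  apply: (le_trans (fC _ _ cx1 (clamp_mono a b xy) cy2)).
  rewrite ler_wpM2l//; apply: ge0_ler_powR; rewrite ?nnegrE ?(ltW l0)//.
    by rewrite subr_ge0 clamp_mono.
  by rewrite ger0_norm ?subr_ge0// clamp_lip.
move=> x y /=; have [xy|/ltW yx] := leP x y; last exact: H.
by rewrite distrC [`|x - y|]distrC; exact: H.
Qed.

Lemma holder_on_bounded {V : normedModType R} (a b C l : R) (x : R -> V) :
  0 <= C -> 0 <= l -> holder_on a b C l x ->
  forall t, a <= t <= b -> `|x t| <= `|x a| + C * (b - a) `^ l.
Proof.
move=> C0 l0 xC t /andP[at_ tb]; rewrite -[x t](subrK (x a)) addrC.
rewrite (le_trans (ler_normD _ _))// lerD2l (le_trans (xC _ _ _ at_ tb))//.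
rewrite ler_wpM2l//; apply: ge0_ler_powR; rewrite ?nnegrE ?subr_ge0//.
  exact: le_trans tb.
by rewrite lerD2r.
Qed.

(** The integrand is consulted only on the open interval []0, t[]. With a delayed argument this is
    why the noise up to time [t] depends on the solution up to [t - r] only. *)
Lemma eq_zaehle_int (al t : R) f f' g g' :
  (forall s, 0 < s < t -> f s = f' s) -> (forall s, 0 < s <= t -> g s = g' s) ->
  zaehle_int al f g t = zaehle_int al f' g' t.
Proof.
move=> ff gg; rewrite /zaehle_int; apply: (congr1 ( *%R _)).
apply: eq_Rintegral => s; rewrite inE/= in_itv/= => /andP[s0 st].
have sle : 0 < s <= t by rewrite s0 ltW.
have tle : 0 < t <= t by rewrite lexx andbT (lt_trans s0).
congr ((_ + _) * (_ + _)).
- by rewrite ff// s0.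
- apply: (congr1 ( *%R _)); apply: eq_Rintegral => u; rewrite inE/= in_itv/= => /andP[u0 us].
  by rewrite !ff ?u0 ?s0// (lt_trans us).
- by rewrite !gg.
- apply: (congr1 ( *%R _)); apply: eq_Rintegral => u; rewrite inE/= in_itv/= => /andP[su ut].
  by rewrite !gg// (lt_trans s0 su) ltW.
Qed.

Lemma zaehle_int_zint (al t : R) f g : zaehle_int al f g t =
  (Gamma al * Gamma (1 - al))^-1 * zint al f g t.
Proof.
rewrite /zaehle_int /zint; apply: (congr1 ( *%R _)); apply: eq_Rintegral => s _.
rewrite /zleft /zker; apply: (congr1 ( *%R _)); apply: (congr1 ( +%R _)).
by apply: (congr1 ( *%R _)); have -> : 1 + (1 - al) = 2 - al by ring.
Qed.

Variables (al m l T : R).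
Hypotheses (al01 : 0 < al < 1) (alm : al < m) (al1l : 1 - al < l) (T0 : 0 <= T).

Let m0 : 0 < m. Proof. by case/andP: al01 => + _ => /lt_trans; apply. Qed.
Let l0 : 0 < l. Proof. by case/andP: al01 => _ h; apply: lt_trans al1l; rewrite subr_gt0. Qed.

(** This is 1 by the identity [B (a, 1 - a) = Gamma a Gamma (1 - a)]; the estimates treat it as an
    arbitrary constant. *)
Definition zaehle_kappa : R := (Gamma al * Gamma (1 - al))^-1 * fine (betaK al).
Definition zaehle_young_const : R :=
  `|(Gamma al * Gamma (1 - al))^-1| * young_const al m l.

Lemma zaehle_young_const_ge0 : 0 <= zaehle_young_const.
Proof. by rewrite mulr_ge0// young_const_ge0. Qed.

Lemma zaehle_int_clamp (t : R) f g : 0 <= t <= T ->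
  zaehle_int al f g t = (Gamma al * Gamma (1 - al))^-1 *
     zint al (f \o clamp 0 T) (g \o clamp 0 T) t.
Proof.
move=> /andP[t0 tT]; rewrite -zaehle_int_zint; apply: eq_zaehle_int => s /andP[s0 st] /=.
  by rewrite clamp_id// (ltW s0) (le_trans (ltW st)).
by rewrite clamp_id// (ltW s0) (le_trans st).
Qed.

Let clampM (C p : R) f : 0 <= C -> 0 < p -> holder_on 0 T C p f ->
  forall x, `|(f \o clamp 0 T) x| <= `|f 0| + C * (T - 0) `^ p.
Proof.
by move=> C0 p0 fC x; apply: (holder_on_bounded C0 (ltW p0) fC); exact: clamp_itv.
Qed.

Lemma zaehle_young (Cf Cg s t : R) f g : 0 <= Cf -> 0 <= Cg ->
  holder_on 0 T Cf m f -> holder_on 0 T Cg l g -> 0 <= s -> s <= t -> t <= T ->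
  `|zaehle_int al f g t - zaehle_int al f g s - zaehle_kappa * (f s * (g t - g s))|
    <= zaehle_young_const * Cf * Cg * (t - s) `^ (m + l).
Proof.
move=> Cf0 Cg0 fC gC s0 st tT.
have sT : 0 <= s <= T by rewrite s0 (le_trans st).
have t0T : 0 <= t <= T by rewrite tT (le_trans s0).
rewrite !zaehle_int_clamp// /zaehle_kappa /zaehle_young_const.
set q := (Gamma al * _)^-1; set A := zint _ _ _ t; set B := zint _ _ _ s.
have -> : q * A - q * B - q * fine (betaK al) * (f s * (g t - g s)) =
  q * (A - B - fine (betaK al) * (f s * (g t - g s))) by ring.
rewrite normrM -!mulrA ler_wpM2l//.
have := zint_young al01 alm al1l Cf0 Cg0 (holder_clamp T0 Cf0 m0 fC)
  (holder_clamp T0 Cg0 l0 gC) (clampM Cf0 m0 fC) (clampM Cg0 l0 gC) s0 st.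
by rewrite /= !clamp_id// !mulrA.
Qed.

Lemma zaehle_riemann (Cf Cg t : R) f g : 1 < m + l -> 0 <= Cf -> 0 <= Cg ->
  holder_on 0 T Cf m f -> holder_on 0 T Cg l g -> 0 <= t <= T ->
  (fun n => zaehle_kappa * \sum_(i < n.+1) f (t * (i%:R / n.+1%:R)) *
     (g (t * (i.+1%:R / n.+1%:R)) - g (t * (i%:R / n.+1%:R)))) @ \oo -->
  zaehle_int al f g t.
Proof.
move=> ml Cf0 Cg0 fC gC t0T; have /andP[t0 tT] := t0T.
rewrite zaehle_int_clamp//.
have := zint_riemann al01 alm al1l ml Cf0 Cg0 (holder_clamp T0 Cf0 m0 fC)
  (holder_clamp T0 Cg0 l0 gC) (clampM Cf0 m0 fC) (clampM Cg0 l0 gC) t0.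
move=> /(cvgM (cvg_cst ((Gamma al * Gamma (1 - al))^-1))).
apply: cvg_trans; apply: near_eq_cvg; near=> n.
rewrite /zaehle_kappa -mulrA; congr (_ * (_ * _)).
have cl (i : nat) : (i <= n.+1)%N -> clamp 0 T (t * (i%:R / n.+1%:R)) = t * (i%:R / n.+1%:R).
  move=> ni; apply: clamp_id; rewrite mulr_ge0 ?divr_ge0//=.
  by rewrite (le_trans _ tT)// ler_piMr// ler_pdivrMr// mul1r ler_nat.
by apply: eq_bigr => i _; rewrite /= !cl// ltnW.
Unshelve. all: end_near. Qed.

End Zaehle_interval.

(** * The delay equation with a given noise path *)

Section row_norm.
Context {R : realType} {d : nat}.
Implicit Types v : 'rV[R]_d.

Lemma rV_norm_le v (c : R) : 0 <= c -> (forall i, `|v ord0 i| <= c) -> `|v| <= c.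
Proof.
move=> c0 vc; rewrite [`|v|]mx_normrE; apply: bigmax_le => // -[i j] _ /=.
by rewrite (ord1 i).
Qed.

Lemma rV_coord_le v i : `|v ord0 i| <= `|v|.
Proof.
rewrite [`|v|]mx_normrE.
exact: (le_bigmax _ (fun ij : 'I_1 * 'I_d => `|v ij.1 ij.2|) (ord0, i)).
Qed.

End row_norm.

Section geometric_limit.
Context {R : realType}.

(** With the geometric tail [2 C / 2^n] added or subtracted, [u] becomes nonincreasing or
    nondecreasing; the two monotone limits coincide and enclose [u], which gives the rate as
    well. *)
Lemma geometric_cvg (u : R^nat) (C : R) : (forall n, `|u n.+1 - u n| <= C / 2 ^+ n) ->
  cvgn u /\ forall n, `|u n - limn u| <= 2 * C / 2 ^+ n.
Proof.
move=> uC.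
have h n : 2 * C / 2 ^+ n = C / 2 ^+ n + 2 * C / 2 ^+ n.+1.
  by rewrite exprS; field; rewrite expf_neq0.
have uC' n : - (C / 2 ^+ n) <= u n.+1 - u n <= C / 2 ^+ n.
  by rewrite -ler_norml.
have C0 : 0 <= C by have := uC 0%N; rewrite expr0 divr1; apply: le_trans.
have C2 n : 0 <= 2 * C / 2 ^+ n by rewrite divr_ge0 ?exprn_ge0// mulr_ge0.
pose v n := u n + 2 * C / 2 ^+ n; pose w n := u n - 2 * C / 2 ^+ n.
have vd : nonincreasing_seq v.
  apply/nonincreasing_seqP => n; rewrite /v (h n).
  by have := uC' n => /andP[_ H]; move: H; set x := C / _; lra.
have wi : nondecreasing_seq w.
  apply/nondecreasing_seqP => n; rewrite /w (h n).
  by have := uC' n => /andP[H _]; move: H; set x := C / _; lra.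
have wv n : w n <= v n by rewrite /w /v; have := C2 n; lra.
have wcvg : cvgn w.
  apply: nondecreasing_is_cvgn => //; exists (v 0%N) => _ [n _ <-].
  by apply: (le_trans (wv n)); exact: vd.
have vcvg : cvgn v.
  apply: nonincreasing_is_cvgn => //; exists (w 0%N) => _ [n _ <-].
  by apply: le_trans (wv n); exact: wi.
have e0 : (fun n => 2 * C / 2 ^+ n) @ \oo --> (0 : R).
  rewrite -(mulr0 (2 * C)); apply: cvgM; first exact: cvg_cst.
  rewrite (_ : (fun n => _) = (fun n => (2^-1) ^+ n)); last first.
    by apply/funext => n; rewrite exprVn.
  by apply: cvg_expr; rewrite ger0_norm ?invr_ge0// invf_lt1// ltr1n.
have uE : u = w \+ (fun n => 2 * C / 2 ^+ n).
  by apply/funext => n; rewrite /w /= subrK.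
have uw : u @ \oo --> limn w.
  by rewrite uE -[X in _ --> X]addr0; apply: cvgD.
have uv : limn v = limn w.
  apply: cvg_lim => //; rewrite (_ : v = u \+ (fun n => 2 * C / 2 ^+ n))//.
  by rewrite -[X in _ --> X]addr0; apply: cvgD.
split; first by apply/cvg_ex; exists (limn w).
move=> n; rewrite (cvg_lim _ uw)// ler_norml.
have h1 := nondecreasing_cvgn_le wi wcvg n.
have h2 := nonincreasing_cvgn_ge vd vcvg n.
by move: h1 h2; rewrite uv /w /v; set x := 2 * C / _; lra.
Qed.

Lemma le_geometric_limit (x a C : R) : (forall n, x <= a + C / 2 ^+ n) -> x <= a.
Proof.
move=> H; have e0 : (fun n => a + C / 2 ^+ n) @ \oo --> a.
  rewrite -[X in _ --> X]addr0; apply: cvgD; first exact: cvg_cst.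
  rewrite -(mulr0 C); apply: cvgM; first exact: cvg_cst.
  rewrite (_ : (fun n => _) = (fun n => (2^-1) ^+ n)); last first.
    by apply/funext => n; rewrite exprVn.
  by apply: cvg_expr; rewrite ger0_norm ?invr_ge0// invf_lt1// ltr1n.
rewrite -(cvg_lim _ e0)//; apply: limr_ge; first by apply/cvg_ex; exists a.
by near=> n; exact: H.
Unshelve. all: end_near. Qed.

End geometric_limit.

Section continuity_on.
Context {R : realType} {d : nat}.
Local Notation V := 'rV[R]_d.

Lemma holder_on_within {V' : normedModType R} (a b C l : R) (x : R -> V') :
  a <= b -> 0 <= C -> 0 < l -> holder_on a b C l x ->
  {within `[a, b], continuous x}.
Proof.
move=> ab C0 l0 xC.
apply: (@subspace_eq_continuous _ _ _ (x \o clamp a b)).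
  by move=> t; rewrite inE/= in_itv/= => tab; rewrite /= clamp_id.
apply: continuous_subspaceT.
exact: (holder_on_line_continuous C0 l0 (holder_clamp ab C0 l0 xC)).
Qed.

Lemma holder_on_Cspace (a b C l : R) (x : R -> V) : a <= b -> 0 <= C -> 0 < l ->
  holder_on a b C l x -> Cspace a b x.
Proof. exact: holder_on_within. Qed.

Lemma Cspace_bounded (a b : R) (x : R -> V) : a <= b -> Cspace a b x ->
  exists2 N : R, 0 <= N & forall t, a <= t <= b -> `|x t| <= N.
Proof.
move=> ab xC; have : compact (x @` `[a, b]).
  by apply: continuous_compact => //; exact: segment_compact.
move=> /compact_bounded [M [_ HM]]; exists (Num.max M 0 + 1).
  by rewrite addr_ge0// le_max lexx orbT.
move=> t tab; apply: (HM (Num.max M 0 + 1)) => /=.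
  by rewrite (le_lt_trans _ (ltr_pwDr _ (lexx _)))// le_max lexx.
by exists t => //=; rewrite in_itv.
Qed.

Lemma Rintegral_expR (k t : R) : 0 < k -> 0 <= t ->
  \int[lebesgue_measure]_(s in `]0, t[) expR (k * s) = (expR (k * t) - 1) / k.
Proof.
move=> k0; rewrite le_eqVlt => /predU1P[<-|t0].
  by rewrite set_itvoo0 Rintegral_set0 mulr0 expR0 subrr mul0r.
pose F (y : R) := k^-1 * expR (k * y).
have dF (y : R) : is_derive y 1 F (expR (k * y)).
  have H1 : is_derive y 1 (fun y => k * y) k.
    apply: (@is_derive_eq _ _ _ _ _ _ _ _ (is_deriveZ _ _)).
    by rewrite /GRing.scale /= mulr1.
  have H2 : is_derive y 1 (expR \o (fun y => k * y)) (k * expR (k * y)).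
    apply: (@is_derive_eq _ _ _ _ _ _ _ _ (is_derive1_comp _ _)).
    by rewrite mulrC.
  apply: (@is_derive_eq _ _ _ _ _ _ _ _ (is_deriveZ _ _)).
  by rewrite /GRing.scale /= mulrA mulVf ?gt_eqF// mul1r.
have cF : continuous F.
  by move=> y; apply: differentiable_continuous; apply/derivable1_diffP; case: (dF y).
have ce : continuous (fun s : R => expR (k * s)).
  move=> y; apply: continuous_comp; last exact: continuous_expR.
  by apply: cvgM; [exact: cvg_cst|exact: cvg_id].
have E : (\int[lebesgue_measure]_(s in `]0%R, t[) (expR (k * s))%:E =
    \int[lebesgue_measure]_(s in `[0%R, t]) (expR (k * s))%:E)%E.
  rewrite [RHS](@integral_itv_bndoo _ 0 t)//.
  apply/measurable_EFinP; apply: measurable_funTS.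
  exact: continuous_measurable_fun.
rewrite /Rintegral E (@continuous_FTC2 _ _ F)//.
- by rewrite -EFinB /= /F mulr0 expR0 -mulrBr mulrC.
- exact: continuous_subspaceT.
- split.
  + by move=> y _; case: (dF y).
  + exact/cvg_at_right_filter/cF.
  + exact/cvg_at_left_filter/cF.
- by move=> y _; rewrite derive1E; have [_ ->] := dF y.
Qed.

Lemma expR_max_ge1 (k u : R) : 0 <= k -> 1 <= expR (k * Num.max u 0).
Proof.
by move=> k0; rewrite -expR0 ler_expR mulr_ge0// le_max lexx orbT.
Qed.

End continuity_on.

Section delay_ode.
Context {R : realType} {d : nat}.
Local Notation V := 'rV[R]_d.
Local Notation mu := (@lebesgue_measure R).
Local Notation mR := (measurableTypeR R).
Local Notation bounded_on a t N x := (forall s, a <= s <= t -> `|x s| <= N).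

(** What Picard iteration uses of [b] and [eta], in the maximum norm of row vectors. Integrability
    of the growth term enters as a Hoelder modulus of its primitive, with the exponent [th] that is
    [1 - al] later. The bound on [b] uses the path up to time [t] only, the local Lipschitz constant
    a ball on the whole interval. *)
Record delay_data (r T th : R) (b : R -> (R -> V) -> V) (eta : R -> V)
    (L0 Kb : R) (beta0 L : R -> R) (Ce E : R) : Prop := DelayData {
  dd_r0 : 0 <= r;
  dd_T0 : 0 <= T;
  dd_th0 : 0 < th;
  dd_th1 : th <= 1;
  dd_L00 : 0 <= L0;
  dd_Kb0 : 0 <= Kb;
  dd_L0 : forall N : R, 0 <= N -> 0 <= L N;
  dd_bM : forall x i, Cspace (- r) T x ->
    measurable_fun `[0, T] (fun s => b s x ord0 i);
  dd_bL : forall (N t : R) x y (c : R), 0 <= N -> 0 <= t <= T ->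
    Cspace (- r) T x -> Cspace (- r) T y ->
    bounded_on (- r) T N x -> bounded_on (- r) T N y -> 0 <= c ->
    (forall s, - r <= s <= t -> `|x s - y s| <= c) ->
    `|b t x - b t y| <= L N * c;
  dd_bG : forall (t : R) x (c : R), 0 <= t <= T -> Cspace (- r) T x ->
    0 <= c -> bounded_on (- r) t c x -> `|b t x| <= L0 * c + beta0 t;
  dd_beta0_int : mu.-integrable `]0, T[ (EFin \o beta0);
  dd_beta0_le : forall s t : R, 0 <= s -> s <= t -> t <= T ->
    \int[mu]_(u in `]s, t[) beta0 u <= Kb * (t - s) `^ th;
  dd_Ce0 : 0 <= Ce;
  dd_E0 : 0 <= E;
  dd_etaC : holder_on (- r) 0 Ce th eta;
  dd_etaE : forall s, - r <= s <= 0 -> `|eta s| <= E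
}.

Variables (r T th : R) (b : R -> (R -> V) -> V) (eta : R -> V).
Variables (L0 Kb : R) (beta0 L : R -> R) (Ce E : R).
Hypothesis D : delay_data r T th b eta L0 Kb beta0 L Ce E.

Local Notation C := (Cspace (- r) T).
Local Notation bounded_by t N x := (bounded_on (- r) t N x).

Let r0 := dd_r0 D.
Let T0 := dd_T0 D.
Let th0 := dd_th0 D.
Let th1 := dd_th1 D.
Let L00 := dd_L00 D.
Let Kb0 := dd_Kb0 D.
Let Lge0 := dd_L0 D.
Let bM := dd_bM D.
Let bL := dd_bL D.
Let bG := dd_bG D.
Let beta0_int := dd_beta0_int D.
Let beta0_le := dd_beta0_le D.
Let Ce0 := dd_Ce0 D.
Let E0 := dd_E0 D.
Let etaC := dd_etaC D.
Let etaE := dd_etaE D.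

Definition drift (x : R -> V) (t : R) : V :=
  \row_i \int[mu]_(s in `]0, t[) b s x ord0 i.

Let rT : - r <= T. Proof. by apply: le_trans T0; rewrite oppr_le0. Qed.

Let subT s t : 0 <= s -> t <= T -> `]s, t[ `<=` (`]0, T[ : set mR).
Proof.
move=> s0 tT x /=; rewrite !in_itv/= => /andP[sx xt].
by rewrite (le_lt_trans s0 sx) (lt_le_trans xt tT).
Qed.

Let subT' s t : 0 <= s -> t <= T -> `]s, t[ `<=` (`[0, T] : set mR).
Proof.
by move=> s0 tT x /(subT s0 tT) /=; rewrite !in_itv/= => /andP[/ltW -> /ltW ->].
Qed.

Lemma measurable_drift s t x i : 0 <= s -> t <= T -> C x ->
  measurable_fun `]s, t[ (fun u => b u x ord0 i).
Proof.
move=> s0 tT Cx; apply: measurable_funS (bM i Cx); last exact: subT'.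
exact: measurable_itvR.
Qed.

Lemma beta0_intS s t : 0 <= s -> t <= T -> mu.-integrable `]s, t[ (EFin \o beta0).
Proof.
move=> s0 tT.
exact: (integrableS (@measurable_itvR _ _) (@measurable_itvR _ _) (subT s0 tT)
  beta0_int).
Qed.

Lemma drift_growth_integrable (s t c : R) : 0 <= s -> t <= T ->
  mu.-integrable `]s, t[ (EFin \o (fun u => L0 * c + beta0 u)).
Proof.
move=> s0 tT.
have i1 : mu.-integrable `]s, t[ (fun=> (L0 * c)%:E).
  exact: (@integrable_bounded_itv R s t `|L0 * c| (cst (L0 * c))).
exact: (integrableD (@measurable_itvR _ _) i1 (beta0_intS s0 tT)).
Qed.

Lemma drift_integrable s t x c i : 0 <= s -> t <= T -> C x -> 0 <= c ->
  bounded_by t c x -> mu.-integrable `]s, t[ (EFin \o (fun u => b u x ord0 i)).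
Proof.
move=> s0 tT Cx c0 xc; apply: le_integrable (drift_growth_integrable c s0 tT).
- exact: measurable_itvR.
- by apply/measurable_EFinP; exact: measurable_drift.
- move=> u; rewrite /= in_itv/= => /andP[su ut]; rewrite lee_fin.
  apply: (le_trans (rV_coord_le _ _)); apply: le_trans (ler_norm _).
  apply: bG => //; first by rewrite (le_trans s0 (ltW su)) (le_trans (ltW ut)).
  by move=> v /andP[rv vu]; apply: xc; rewrite rv (le_trans vu)// ltW.
Qed.

Lemma drift0 x : drift x 0 = 0.
Proof. by apply/rowP => i; rewrite !mxE set_itvoo0 Rintegral_set0. Qed.

Lemma drift_increment s t x c : 0 <= s -> s <= t -> t <= T -> C x -> 0 <= c ->
  bounded_by t c x ->
  `|drift x t - drift x s| <= L0 * c * (t - s) + Kb * (t - s) `^ th.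
Proof.
move=> s0 st tT Cx c0 xc.
have rhs0 : 0 <= L0 * c * (t - s) + Kb * (t - s) `^ th.
  by rewrite addr_ge0// ?mulr_ge0 ?powR_ge0// subr_ge0.
apply: rV_norm_le => // i; rewrite !mxE.
rewrite (Rintegral_split s0 st (drift_integrable i (lexx 0) tT Cx c0 xc)).
rewrite addrC addKr.
have i1 : mu.-integrable `]s, t[ (fun=> (L0 * c)%:E).
  exact: (@integrable_bounded_itv R s t `|L0 * c| (cst (L0 * c))).
apply: (@le_trans _ _ (\int[mu]_(u in `]s, t[) (L0 * c + beta0 u))).
  apply: le_normr_Rintegral_dom.
  - exact: measurable_itvR.
  - exact: measurable_drift.
  - exact: drift_growth_integrable.
  - move=> u; rewrite /= in_itv/= => /andP[su ut].
    apply: (le_trans (rV_coord_le _ _)).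
    apply: bG => //; first by rewrite (le_trans s0 (ltW su)) (le_trans (ltW ut)).
    by move=> v /andP[rv vu]; apply: xc; rewrite rv (le_trans vu)// ltW.
rewrite (RintegralD (@measurable_itvR _ _) i1 (beta0_intS s0 tT)).
by rewrite (Rintegral_cst_itv _ st) lerD2l; exact: beta0_le.
Qed.

Lemma integrable_expR_itv (t k : R) : 0 < k ->
  mu.-integrable `]0, t[ (fun s => (expR (k * s))%:E).
Proof.
move=> k0; have mE : measurable_fun setT (fun s : R => expR (k * s)).
  by apply: (measurableT_comp (@measurable_expR R)); exact: measurable_funM.
have := @integrable_boundedM _ mR R mu `]0, t[ (fun s => expR (k * s)) (cst 1)
  (expR (k * t)) (@measurable_itvR _ _) (measurable_funTS mE).
rewrite /=; under [X in _ -> _ -> mu.-integrable _ X]eq_fun do rewrite mulr1.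
apply; last exact: (@integrable_bounded_itv R _ _ `|1| (cst 1)).
move=> s; rewrite /= in_itv/= => /andP[s0 st].
by rewrite ger0_norm ?expR_ge0// ler_expR ler_wpM2l// ltW.
Qed.

(** The weight [exp (k max (s, 0))] is constant on the initial segment and nondecreasing, so it also
    bounds the supremum over the past. Integrating it yields the factor [1 / k] that makes the drift
    small for large [k]. *)
Lemma drift_le_exp t x (A k : R) : 0 <= A -> 0 < k -> 0 <= t <= T -> C x ->
  (forall s, - r <= s <= t -> `|x s| <= A * expR (k * Num.max s 0)) ->
  `|drift x t| <= L0 * A / k * expR (k * t) + Kb * T `^ th.
Proof.
move=> A0 k0 /andP[t0 tT] Cx xA.
pose c := A * expR (k * t).
have ek s : - r <= s <= t -> expR (k * Num.max s 0) <= expR (k * t).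
  by move=> /andP[_ st]; rewrite ler_expR ler_wpM2l ?(ltW k0)// ge_max st.
have iE := integrable_expR_itv t k0.
have iLE : mu.-integrable `]0, t[ (fun s => (L0 * A * expR (k * s))%:E).
  exact: (integrableZl (@measurable_itvR R _) (L0 * A) iE).
have ib := beta0_intS (lexx 0) tT.
have iH : mu.-integrable `]0, t[ (EFin \o (fun s => L0 * A * expR (k * s) + beta0 s)).
  exact: (integrableD (@measurable_itvR _ _) iLE ib).
have HI : \int[mu]_(s in `]0, t[) (L0 * A * expR (k * s) + beta0 s) <=
    L0 * A / k * expR (k * t) + Kb * T `^ th.
  rewrite (RintegralD (@measurable_itvR _ _) iLE ib).
  rewrite (RintegralZl _ (@measurable_itvR _ _) iE) (Rintegral_expR k0 t0).
  apply: lerD.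
    rewrite mulrA mulrAC ler_wpM2l//; last by rewrite gerBl.
    by rewrite divr_ge0 ?mulr_ge0// ltW.
  apply: (le_trans (beta0_le (lexx 0) t0 tT)); rewrite subr0 ler_wpM2l//.
  by apply: ge0_ler_powR; rewrite ?nnegrE// ltW.
have HI0 : 0 <= L0 * A / k * expR (k * t) + Kb * T `^ th.
  by rewrite addr_ge0 ?mulr_ge0 ?powR_ge0 ?expR_ge0 ?invr_ge0// ltW.
apply: rV_norm_le => // i; rewrite !mxE; apply: le_trans HI.
apply: le_normr_Rintegral_dom.
- exact: measurable_itvR.
- exact: measurable_drift.
- exact: iH.
- move=> s; rewrite /= in_itv/= => /andP[s0 st].
  apply: (le_trans (rV_coord_le _ _)); rewrite -mulrA; apply: bG => //.
  + by rewrite (ltW s0) (le_trans (ltW st)).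
  + by rewrite mulr_ge0// expR_ge0.
  + move=> u /andP[ru us].
    apply: (le_trans (xA _ _)); first by rewrite ru (le_trans us)// ltW.
    by rewrite ler_wpM2l// ler_expR ler_wpM2l ?(ltW k0)// ge_max us ltW.
Qed.

Lemma drift_sub_le_exp t x y (N A k : R) : 0 <= N -> 0 <= A -> 0 < k ->
  0 <= t <= T -> C x -> C y -> bounded_by T N x -> bounded_by T N y ->
  (forall s, - r <= s <= t -> `|x s - y s| <= A * expR (k * Num.max s 0)) ->
  `|drift x t - drift y t| <= L N * A / k * expR (k * t).
Proof.
move=> N0 A0 k0 /andP[t0 tT] Cx Cy xN yN xA.
have iE := integrable_expR_itv t k0.
have iLE : mu.-integrable `]0, t[ (fun s => (L N * A * expR (k * s))%:E).
  exact: (integrableZl (@measurable_itvR R _) (L N * A) iE).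
have LA0 : 0 <= L N * A / k by rewrite divr_ge0 ?mulr_ge0 ?Lge0// ltW.
have HI : \int[mu]_(s in `]0, t[) (L N * A * expR (k * s)) <=
    L N * A / k * expR (k * t).
  rewrite (RintegralZl _ (@measurable_itvR _ _) iE) (Rintegral_expR k0 t0).
  by rewrite mulrA mulrAC ler_wpM2l// gerBl.
have HI0 : 0 <= L N * A / k * expR (k * t) by rewrite mulr_ge0 ?expR_ge0.
have xNt : bounded_by t N x by move=> s /andP[rs st]; apply: xN; rewrite rs (le_trans st).
have yNt : bounded_by t N y by move=> s /andP[rs st]; apply: yN; rewrite rs (le_trans st).
apply: rV_norm_le => // i; rewrite !mxE; apply: le_trans HI.
rewrite -(RintegralB (@measurable_itvR _ _)
  (drift_integrable i (lexx 0) tT Cx N0 xNt)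
  (drift_integrable i (lexx 0) tT Cy N0 yNt)).
apply: le_normr_Rintegral_dom.
- exact: measurable_itvR.
- apply: measurable_funB; exact: measurable_drift.
- exact: iLE.
- move=> s; rewrite /= in_itv/= => /andP[s0 st].
  have -> : b s x ord0 i - b s y ord0 i = (b s x - b s y) ord0 i by rewrite !mxE.
  apply: (le_trans (rV_coord_le _ _)); rewrite -mulrA; apply: bL => //.
  + by rewrite (ltW s0) (le_trans (ltW st)).
  + by rewrite mulr_ge0// expR_ge0.
  + move=> u /andP[ru us].
    apply: (le_trans (xA _ _)); first by rewrite ru (le_trans us)// ltW.
    by rewrite ler_wpM2l// ler_expR ler_wpM2l ?(ltW k0)// ge_max us ltW.
Qed.

Definition ode_step (z x : R -> V) (t : R) : V :=
  if t <= 0 then eta t else eta 0 + z t + drift x t.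

Definition solves_ode (tau : R) (z x : R -> V) : Prop :=
  forall t, - r <= t <= tau -> x t = ode_step z x t.

Lemma ode_step0 z x : z 0 = 0 -> forall t, 0 <= t ->
  ode_step z x t = eta 0 + z t + drift x t.
Proof.
move=> z0 t; rewrite le_eqVlt => /predU1P[<-|t0].
  by rewrite /ode_step lexx z0 drift0 !addr0.
by rewrite /ode_step leNgt t0.
Qed.

(** In the weighted norm the drift contracts by 1/2 as soon as [k >= 2 L N]. Admitting two noises at
    distance [eps] lets one lemma serve the convergence of the iteration, uniqueness and continuous
    dependence. *)
Lemma ode_step_sub z z' x y t (N A k eps : R) : 0 <= N -> 0 <= A -> 0 < k ->
  2 * L N <= k -> 0 <= eps -> - r <= t <= T -> z 0 = 0 -> z' 0 = 0 ->
  C x -> C y -> bounded_by T N x -> bounded_by T N y ->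
  (forall s, - r <= s <= t -> `|x s - y s| <= A * expR (k * Num.max s 0)) ->
  (forall s, 0 <= s <= t -> `|z s - z' s| <= eps) ->
  `|ode_step z x t - ode_step z' y t| <= (eps + A / 2) * expR (k * Num.max t 0).
Proof.
move=> N0 A0 k0 Lk eps0 /andP[rt tT] z0 z'0 Cx Cy xN yN xA zz.
have e1 u : 1 <= expR (k * Num.max u 0) by exact: expR_max_ge1 (ltW k0).
have [t0|t0] := boolP (t <= 0).
  rewrite /ode_step t0 subrr normr0 mulr_ge0 ?expR_ge0//.
  by rewrite addr_ge0// divr_ge0.
rewrite -ltNge in t0; have t0' := ltW t0; have t0T : 0 <= t <= T by rewrite t0'.
rewrite !ode_step0//.
have -> : eta 0 + z t + drift x t - (eta 0 + z' t + drift y t) =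
  (z t - z' t) + (drift x t - drift y t).
  by rewrite opprD addrACA; congr (_ + _); rewrite opprD addrACA subrr add0r.
rewrite (le_trans (ler_normD _ _))// mulrDl; apply: lerD.
  apply: (le_trans (zz t _)); first by rewrite t0' lexx.
  exact: ler_peMr eps0 (e1 t).
rewrite (max_l t0'); apply: (le_trans (drift_sub_le_exp N0 A0 k0 t0T Cx Cy xN yN xA)).
rewrite ler_wpM2r ?expR_ge0// ler_pdivrMr//.
have -> : L N * A = A / 2 * (2 * L N) by field.
by rewrite ler_wpM2l// divr_ge0.
Qed.

(** Gronwall's inequality by iteration: a bound [A] on the weighted distance of two solutions
    improves to [eps + A / 2], whose fixed point is [2 eps]. *)
Lemma ode_stability tau z z' x y (N k eps : R) : 0 <= N -> 0 < k ->
  2 * L N <= k -> 0 <= eps -> tau <= T -> z 0 = 0 -> z' 0 = 0 ->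
  C x -> C y -> bounded_by T N x -> bounded_by T N y ->
  (forall s, 0 <= s <= tau -> `|z s - z' s| <= eps) ->
  solves_ode tau z x -> solves_ode tau z' y ->
  forall t, - r <= t <= tau -> `|x t - y t| <= 2 * eps * expR (k * Num.max t 0).
Proof.
move=> N0 k0 Lk eps0 tauT z0 z'0 Cx Cy xN yN zz sx sy.
have e1 u : 1 <= expR (k * Num.max u 0) by exact: expR_max_ge1 (ltW k0).
(* It starts from the crude bound [2 N]; each application of the contraction halves the excess over
   [2 eps]. *)
have H n t : - r <= t <= tau ->
    `|x t - y t| <= (2 * eps + 2 * N / 2 ^+ n) * expR (k * Num.max t 0).
  elim: n t => [|n IHn] t /andP[rt ttau].
    rewrite expr0 divr1 (le_trans (ler_normB _ _))//.
    have rtT : - r <= t <= T by rewrite rt (le_trans ttau).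
    apply: (@le_trans _ _ (2 * N)); first by have := xN _ rtT; have := yN _ rtT; lra.
    apply: (@le_trans _ _ ((2 * eps + 2 * N) * 1)).
      by rewrite mulr1 lerDr mulr_ge0.
    by rewrite ler_wpM2l// addr_ge0// mulr_ge0.
  rewrite sx ?sy ?rt//.
  have A0 : 0 <= 2 * eps + 2 * N / 2 ^+ n.
    by rewrite addr_ge0 ?mulr_ge0 ?invr_ge0 ?exprn_ge0.
  have rtT : - r <= t <= T by rewrite rt (le_trans ttau).
  have IH' s : - r <= s <= t ->
      `|x s - y s| <= (2 * eps + 2 * N / 2 ^+ n) * expR (k * Num.max s 0).
    by move=> /andP[rs st]; apply: IHn; rewrite rs (le_trans st).
  have zz' s : 0 <= s <= t -> `|z s - z' s| <= eps.
    by move=> /andP[s0 st]; apply: zz; rewrite s0 (le_trans st).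
  apply: (le_trans (ode_step_sub N0 A0 k0 Lk eps0 rtT z0 z'0 Cx Cy xN yN IH' zz')).
  rewrite ler_wpM2r ?expR_ge0// exprS; set q := 2 ^+ n.
  have q0 : q != 0 by rewrite expf_neq0.
  by rewrite le_eqVlt; apply/orP; left; apply/eqP; field.
move=> t tt; apply: (@le_geometric_limit _ _ _ (2 * N * expR (k * Num.max t 0))) => n.
apply: (le_trans (H n t tt)); rewrite mulrDl lerD2l.
by rewrite mulrAC.
Qed.

(** The linear part of the drift increment costs [T^(1 - th)] to be brought to the exponent [th]. An
    increment across 0 is split there, which is why the constants of the past and of the future are
    added. *)
Lemma ode_step_holder z x (Cz c : R) : 0 <= Cz -> 0 <= c -> z 0 = 0 ->
  holder_on 0 T Cz th z -> C x -> bounded_by T c x ->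
  holder_on (- r) T (Ce + (Cz + (L0 * c * T `^ (1 - th) + Kb))) th (ode_step z x).
Proof.
move=> Cz0 c0 z0 zC Cx xc.
have K0 : 0 <= Cz + (L0 * c * T `^ (1 - th) + Kb).
  by rewrite !addr_ge0 ?mulr_ge0 ?powR_ge0.
have pos s t : 0 <= s -> s <= t -> t <= T ->
    `|ode_step z x t - ode_step z x s| <=
    (Cz + (L0 * c * T `^ (1 - th) + Kb)) * (t - s) `^ th.
  move=> s0 st tT; have t0 := le_trans s0 st.
  rewrite !ode_step0//.
  have -> : eta 0 + z t + drift x t - (eta 0 + z s + drift x s) =
    (z t - z s) + (drift x t - drift x s).
    by rewrite opprD addrACA; congr (_ + _); rewrite opprD addrACA subrr add0r.
  rewrite (le_trans (ler_normD _ _))// mulrDl; apply: lerD; first exact: zC.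
  have xct : bounded_by t c x.
    by move=> u /andP[ru ut]; apply: xc; rewrite ru (le_trans ut).
  apply: (le_trans (drift_increment s0 st tT Cx c0 xct)).
  rewrite mulrDl lerD2r.
  have ts0 : 0 <= t - s by rewrite subr_ge0.
  rewrite -[X in _ <= X]mulrA ler_wpM2l ?mulr_ge0//.
  apply: (@le_trans _ _ ((t - s) `^ (1 - th) * (t - s) `^ th)).
    move: ts0; rewrite le_eqVlt => /predU1P[<-|ts0].
      by rewrite mulr_ge0 ?powR_ge0.
    by rewrite -powRDgt0// subrK powRr1// ltW.
  rewrite ler_wpM2r ?powR_ge0//.
  apply: ge0_ler_powR; rewrite ?nnegrE ?subr_ge0//.
  by rewrite lerBlDr (le_trans tT)// lerDl.
have neg s t : - r <= s -> s <= t -> t <= 0 ->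
    `|ode_step z x t - ode_step z x s| <= Ce * (t - s) `^ th.
  by move=> rs st t0; rewrite /ode_step t0 (le_trans st t0); exact: etaC.
move=> s t rs st tT; have [t0|t0] := leP t 0.
  apply: (le_trans (neg _ _ rs st t0)).
  by rewrite ler_wpM2r ?powR_ge0// lerDl.
have [s0|s0] := leP 0 s.
  apply: (le_trans (pos _ _ s0 st tT)).
  by rewrite ler_wpM2r ?powR_ge0// lerDr.
rewrite -[X in `|X|](subrKA (ode_step z x 0)).
rewrite (le_trans (ler_normD _ _))// mulrDl addrC; apply: lerD.
  apply: (le_trans (neg _ _ rs (ltW s0) (lexx 0))); rewrite ler_wpM2l//.
  apply: ge0_ler_powR; rewrite ?nnegrE ?subr_ge0 ?(ltW th0) ?(ltW s0)//.
  by rewrite lerD2r ltW.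
apply: (le_trans (pos _ _ (lexx 0) (ltW t0) tT)); rewrite ler_wpM2l//.
apply: ge0_ler_powR; rewrite ?nnegrE ?subr_ge0 ?(ltW th0)//.
  by rewrite ltW.
by rewrite lerD2l lerN2 ltW.
Qed.

(** The initial guess follows [eta] on the past and stays at [eta 0] afterwards. *)
Fixpoint picard (z : R -> V) (n : nat) : R -> V :=
  if n is m.+1 then ode_step z (picard z m) else fun t => eta (Num.min t 0).

Definition ode_sol (z : R -> V) : R -> V :=
  fun t => \row_i limn (fun n => picard z n t ord0 i).

Let k0 : 0 < 2 * L0 + 1. Proof. by rewrite ltr_wpDl// mulr_ge0. Qed.

(** With rate [2 L0 + 1] the linear growth costs at most half of the weighted bound [A]; the choice
    [A = 2 (E + Z + Kb T^th)] makes the other half equal to the data, and the exponential is the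
    largest weight on the interval. The bound is affine in [Z]. *)
Definition ode_bound (Z : R) : R :=
  2 * (E + Z + Kb * T `^ th) * expR ((2 * L0 + 1) * T).

Section picard.
Variables (z : R -> V) (Cz Z : R).
Hypotheses (Cz0 : 0 <= Cz) (Z0 : 0 <= Z) (z0 : z 0 = 0).
Hypothesis zC : holder_on 0 T Cz th z.
Hypothesis zZ : forall t, 0 <= t <= T -> `|z t| <= Z.

Let A := 2 * (E + Z + Kb * T `^ th).

Let A0 : 0 <= A.
Proof. by rewrite mulr_ge0// !addr_ge0// mulr_ge0 ?powR_ge0. Qed.

Let N := ode_bound Z.

Let N0 : 0 <= N. Proof. by rewrite /N /ode_bound mulr_ge0 ?expR_ge0. Qed.

Let AN t : t <= T -> A * expR ((2 * L0 + 1) * Num.max t 0) <= N.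
Proof.
move=> tT; rewrite ler_wpM2l// ler_expR ler_wpM2l ?(ltW k0)//.
by rewrite ge_max tT T0.
Qed.

Definition ode_holder_const : R := Ce + (Cz + (L0 * N * T `^ (1 - th) + Kb)).

Lemma ode_holder_const_ge0 : 0 <= ode_holder_const.
Proof.
rewrite /ode_holder_const addr_ge0// addr_ge0// addr_ge0//.
by rewrite mulr_ge0 ?powR_ge0// mulr_ge0.
Qed.

(** Both bounds are invariant under [ode_step]: [A / 2] of the weighted bound pays for the data and
    [L0 / (2 L0 + 1) <= 1/2] for the drift. Only the growth constant is involved, so the radius [N]
    is fixed before any local Lipschitz constant. *)
Lemma picard_spec n :
  holder_on (- r) T ode_holder_const th (picard z n) /\
  (forall t, - r <= t <= T ->
     `|picard z n t| <= A * expR ((2 * L0 + 1) * Num.max t 0)).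
Proof.
have e1 u : 1 <= expR ((2 * L0 + 1) * Num.max u 0) by exact: expR_max_ge1 (ltW k0).
have EA : E <= A.
  rewrite /A mulrDl mul1r; have H : 0 <= Z + Kb * T `^ th.
    by rewrite addr_ge0// mulr_ge0 ?powR_ge0.
  by move: H E0; lra.
elim: n => [|n [IHC IHA]] /=.
  split.
    move=> s t rs st tT.
    have m1 : - r <= Num.min s 0 by rewrite le_min rs oppr_le0.
    have m2 : Num.min s 0 <= Num.min t 0.
      by rewrite le_min !ge_min st lexx orbT.
    have m3 : Num.min t 0 <= 0 by rewrite ge_min lexx orbT.
    apply: (le_trans (etaC m1 m2 m3)).
    apply: ler_pM => //; first exact: powR_ge0.
      rewrite /ode_holder_const lerDl addr_ge0// addr_ge0//.
        by rewrite mulr_ge0 ?powR_ge0// mulr_ge0.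
    apply: ge0_ler_powR; rewrite ?nnegrE ?subr_ge0 ?(ltW th0)//.
    by case: (leP s 0) => ?; case: (leP t 0) => ?; lra.
  move=> t /andP[rt tT]; apply: (@le_trans _ _ E).
    by apply: etaE; rewrite le_min rt oppr_le0 r0 ge_min lexx orbT.
  apply: (le_trans EA); exact: ler_peMr A0 (e1 t).
have Cn : C (picard z n).
  by apply: holder_on_Cspace IHC => //; exact: ode_holder_const_ge0.
have xN : bounded_by T N (picard z n).
  by move=> t tT; apply: (le_trans (IHA t tT)); apply: AN; case/andP: tT.
split; first exact: ode_step_holder.
move=> t /andP[rt tT]; have [t0|t0] := boolP (t <= 0).
  rewrite /ode_step t0; apply: (@le_trans _ _ E); first by apply: etaE; rewrite rt.
  apply: (le_trans EA); exact: ler_peMr A0 (e1 t).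
rewrite -ltNge in t0.
have t0T : 0 <= t <= T by rewrite ltW.
rewrite ode_step0 ?(ltW t0)//.
have IHA' s : - r <= s <= t ->
    `|picard z n s| <= A * expR ((2 * L0 + 1) * Num.max s 0).
  by move=> /andP[rs st]; apply: IHA; rewrite rs (le_trans st).
have Dr := drift_le_exp A0 k0 t0T Cn IHA'.
have e0 : - r <= (0 : R) <= 0 by rewrite oppr_le0 r0 lexx.
have := etaE e0; have := zZ t0T => h1 h2.
rewrite (le_trans (ler_normD _ _))//.
rewrite (le_trans (lerD (ler_normD _ _) Dr))//.
rewrite max_l ?(ltW t0)//.
have et1 : 1 <= expR ((2 * L0 + 1) * t) by have := e1 t; rewrite max_l// ltW.
have LA : L0 * A / (2 * L0 + 1) * expR ((2 * L0 + 1) * t)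
    <= A / 2 * expR ((2 * L0 + 1) * t).
  rewrite ler_wpM2r ?expR_ge0// ler_pdivrMr//; move: A0 L00.
  by move: (A) => a a0 l0; nra.
have A2 : A / 2 <= A / 2 * expR ((2 * L0 + 1) * t).
  by rewrite ler_peMr// divr_ge0.
have -> : A * expR ((2 * L0 + 1) * t) = A / 2 * expR ((2 * L0 + 1) * t) +
  A / 2 * expR ((2 * L0 + 1) * t) by field.
have A2E : A / 2 = E + Z + Kb * T `^ th by rewrite /A; field.
move: h1 h2 LA A2; rewrite A2E.
set u1 := `|eta 0|; set u2 := `|z t|; set u3 := L0 * A / _ * _.
set u4 := (_ + _ + _) * _; set u5 := Kb * _; lra.
Qed.

Lemma picard_Cspace n : C (picard z n).
Proof.
have [h _] := picard_spec n.
by apply: holder_on_Cspace h => //; exact: ode_holder_const_ge0.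
Qed.

Lemma picard_bounded n : bounded_by T N (picard z n).
Proof.
move=> t tT; have [_ h] := picard_spec n.
by apply: (le_trans (h t tT)); apply: AN; case/andP: tT.
Qed.

(** All iterates stay in the ball of radius [N], so its Lipschitz constant determines a second
    weight, in which the iteration contracts; the summand 1 keeps the rate positive. *)
Let k := 2 * L N + 1.
Let k0' : 0 < k. Proof. by rewrite ltr_wpDl// mulr_ge0// Lge0. Qed.
Let Lk : 2 * L N <= k. Proof. by rewrite lerDl. Qed.

Let cN0 : 0 <= 2 * N * expR (k * T).
Proof. by apply: mulr_ge0; [apply: mulr_ge0|exact: expR_ge0]. Qed.

Lemma picard_dist n t : - r <= t <= T ->
  `|picard z n.+1 t - picard z n t| <= 2 * N * expR (k * T) / 2 ^+ n.
Proof.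
move=> tT.
have H m s : - r <= s <= T -> `|picard z m.+1 s - picard z m s| <=
    (2 * N / 2 ^+ m) * expR (k * Num.max s 0).
  elim: m s => [|m IHm] s sT.
    have e1 : 1 <= expR (k * Num.max s 0) by exact: expR_max_ge1 (ltW k0').
    rewrite (le_trans (ler_normB _ _))// expr0 divr1.
    apply: (@le_trans _ _ (2 * N)).
      by have := @picard_bounded 1 _ sT; have := @picard_bounded 0 _ sT; lra.
    by apply: ler_peMr e1; rewrite mulr_ge0.
  have c0 : 0 <= 2 * N / 2 ^+ m by rewrite divr_ge0 ?exprn_ge0// mulr_ge0.
  have IH' u : - r <= u <= s -> `|picard z m.+1 u - picard z m u| <=
      (2 * N / 2 ^+ m) * expR (k * Num.max u 0).
    move=> /andP[ru us]; apply: IHm; rewrite ru (le_trans us)//.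
    by case/andP: sT.
  have zz u : 0 <= u <= s -> `|z u - z u| <= 0 by rewrite subrr normr0.
  have := ode_step_sub N0 c0 k0' Lk (lexx 0) sT z0 z0 (@picard_Cspace m.+1)
    (@picard_Cspace m) (@picard_bounded m.+1) (@picard_bounded m) IH' zz.
  rewrite add0r => h; apply: (le_trans h).
  suff -> : 2 * N / 2 ^+ m / 2 = 2 * N / 2 ^+ m.+1 by [].
  have p0 : 2 ^+ m != 0 :> R by rewrite expf_neq0.
  by rewrite exprS; move: p0; set p := 2 ^+ m => p0; field.
apply: (le_trans (H n t tT)).
rewrite mulrAC ler_wpM2r ?invr_ge0 ?exprn_ge0//.
apply: ler_wpM2l; first exact: mulr_ge0.
by rewrite ler_expR ler_wpM2l ?(ltW k0')// ge_max T0 andbT; case/andP: tT.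
Qed.

Lemma ode_sol_dist n t : - r <= t <= T ->
  `|picard z n t - ode_sol z t| <= 2 * (2 * N * expR (k * T)) / 2 ^+ n.
Proof.
move=> tT; apply: rV_norm_le.
  by rewrite divr_ge0 ?exprn_ge0// mulr_ge0.
move=> i; rewrite !mxE.
have H m : `|picard z m.+1 t ord0 i - picard z m t ord0 i| <=
    2 * N * expR (k * T) / 2 ^+ m.
  apply: le_trans (picard_dist m tT).
  by have := rV_coord_le (picard z m.+1 t - picard z m t) i; rewrite !mxE.
by have [_] := geometric_cvg H; apply.
Qed.

Lemma ode_sol_holder : holder_on (- r) T ode_holder_const th (ode_sol z).
Proof.
move=> s t rs st tT.
have sT : - r <= s <= T by rewrite rs (le_trans st).
have tT' : - r <= t <= T by rewrite tT (le_trans rs).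
apply: (@le_geometric_limit _ _ _ (4 * (2 * N * expR (k * T)))) => n.
have [h _] := picard_spec n.
have := h s t rs st tT; have := ode_sol_dist n sT; have := ode_sol_dist n tT'.
have -> : ode_sol z t - ode_sol z s = (picard z n t - picard z n s) -
  (picard z n t - ode_sol z t) + (picard z n s - ode_sol z s).
  by apply/rowP => i; rewrite !mxE -/(ode_sol z t) -/(ode_sol z s); ring.
set u := _ - ode_sol z t; set v := _ - ode_sol z s; set w := _ - picard z n s.
move=> h1 h2 h3.
rewrite (le_trans (ler_normD _ _))// (le_trans (lerD (ler_normB _ _) h2))//.
move: h1 h3; set q := _ `^ th; set p := 2 ^+ n; set c := 2 * N * _.
have -> : 2 * c / p = 2 * (c / p) by rewrite mulrA.
have -> : 4 * c / p = 4 * (c / p) by rewrite mulrA.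
lra.
Qed.

Lemma ode_sol_Cspace : C (ode_sol z).
Proof.
by apply: holder_on_Cspace ode_sol_holder => //; exact: ode_holder_const_ge0.
Qed.

Lemma ode_sol_bounded : bounded_by T N (ode_sol z).
Proof.
move=> t tT; apply: (@le_geometric_limit _ _ _ (2 * (2 * N * expR (k * T)))) => n.
have := @picard_bounded n _ tT; have := ode_sol_dist n tT.
rewrite -[in X in _ -> _ -> X <= _](subKr (picard z n t) (ode_sol z t)).
by move=> h1 h2; rewrite (le_trans (ler_normB _ _))// lerD.
Qed.

(** The distance of the limit to its own image is compared with that of [picard z n.+1] to both; the
    two are of order [2^-n], the first one by the contraction. *)
Lemma ode_sol_solves : solves_ode T z (ode_sol z).
Proof.
move=> t tT; apply/eqP; rewrite -subr_eq0 -normr_le0.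
set c := 2 * (2 * N * expR (k * T)).
have c0 : 0 <= c by apply: mulr_ge0.
have e1 u : 1 <= expR (k * Num.max u 0) by exact: expR_max_ge1 (ltW k0').
apply: (@le_geometric_limit _ _ _ (c * expR (k * Num.max t 0))) => n.
rewrite add0r.
have cn0 : 0 <= c / 2 ^+ n by rewrite divr_ge0 ?exprn_ge0.
have IH' s : - r <= s <= t ->
    `|picard z n s - ode_sol z s| <= c / 2 ^+ n * expR (k * Num.max s 0).
  move=> /andP[rs st]; apply: (@le_trans _ _ (c / 2 ^+ n)).
    by apply: ode_sol_dist; rewrite rs (le_trans st)//; case/andP: tT.
  exact: ler_peMr cn0 (e1 s).
have zz u : 0 <= u <= t -> `|z u - z u| <= 0 by rewrite subrr normr0.
have := ode_step_sub N0 cn0 k0' Lk (lexx 0) tT z0 z0 (@picard_Cspace n)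
  ode_sol_Cspace (@picard_bounded n) ode_sol_bounded IH' zz.
rewrite -/(picard z n.+1 t) add0r => h1.
have h2 : `|picard z n.+1 t - ode_sol z t| <= c / 2 ^+ n.+1 := ode_sol_dist n.+1 tT.
have -> : ode_sol z t - ode_step z (ode_sol z) t =
  (picard z n.+1 t - ode_step z (ode_sol z) t) - (picard z n.+1 t - ode_sol z t).
  by rewrite opprB [RHS]addrC addrA subrK.
rewrite (le_trans (ler_normB _ _))// (le_trans (lerD h1 h2))//.
have -> : c / 2 ^+ n.+1 = c / 2 ^+ n / 2 by rewrite exprS invfM mulrA mulrAC.
have -> : c * expR (k * Num.max t 0) / 2 ^+ n = c / 2 ^+ n * expR (k * Num.max t 0).
  by rewrite mulrAC.
have := e1 t; move: cn0; set p := c / _; set e := expR _; nra.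
Qed.

End picard.

End delay_ode.

(** * The delay equation driven by Hoelder paths *)

Section delay_noise.
Context {R : realType} {d m : nat}.
Local Notation V := 'rV[R]_d.

(** The three orders of regularity: [mm] for the integrand, [be] for [sigma] in time, [lam] for the
    driving path. The inequalities say that [mm] is attained by [sigma] along paths of order
    [1 - al] and that Young's condition [mm + lam > 1] holds. *)
Record noise_data (T al mm be lam : R) (sigma : R -> V -> 'M[R]_(d, m))
    (Ms S0 : R) : Prop := NoiseData {
  nd_al : 0 < al < 1;
  nd_alm : al < mm;
  nd_mb : mm <= be;
  nd_mth : mm <= 1 - al;
  nd_lam : 1 - al < lam;
  nd_Ms : 0 <= Ms;
  nd_lip : forall t x y i j, 0 <= t <= T ->
    `|sigma t x i j - sigma t y i j| <= Ms * `|x - y|;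
  nd_time : forall (s t : R) x i j, 0 <= s -> s <= t -> t <= T ->
    `|sigma t x i j - sigma s x i j| <= Ms * (t - s) `^ be;
  nd_S00 : 0 <= S0;
  nd_S0 : forall i j, `|sigma 0 0 i j| <= S0
}.

Definition coef (r : R) (sigma : R -> V -> 'M[R]_(d, m)) (x : R -> V) i j (s : R) : R :=
  sigma s (x (s - r)) i j.

Definition noise (al r : R) sigma (g : 'I_m -> R -> R) (x : R -> V) (t : R) : V :=
  \row_i \sum_j zaehle_int al (coef r sigma x i j) (g j) t.

Lemma noiseE al r sigma g x t i : noise al r sigma g x t ord0 i =
  \sum_j zaehle_int al (coef r sigma x i j) (g j) t.
Proof. by rewrite /noise mxE. Qed.

Lemma noise0 al r sigma g x : noise al r sigma g x 0 = 0.
Proof.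
apply/rowP => i; rewrite !mxE big1// => j _.
by rewrite /zaehle_int set_itvoo0 Rintegral_set0 mulr0.
Qed.

(** The only place where the delay acts: two paths that agree up to [t - r] have the same noise term
    at time [t]. *)
Lemma eq_noise al r sigma g x y t : 0 <= t ->
  (forall s, - r <= s <= t - r -> x s = y s) ->
  noise al r sigma g x t = noise al r sigma g y t.
Proof.
move=> t0 xy; have H i j : zaehle_int al (coef r sigma x i j) (g j) t =
    zaehle_int al (coef r sigma y i j) (g j) t.
  apply: eq_zaehle_int => // s /andP[s0 st]; rewrite /coef xy//.
  by rewrite lerBrDr addNr (ltW s0) lerD2r ltW.
apply/rowP => i; transitivity (\sum_j zaehle_int al (coef r sigma x i j) (g j) t).
  exact: noiseE.
transitivity (\sum_j zaehle_int al (coef r sigma y i j) (g j) t).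
  exact: (eq_bigr _ (fun j _ => H i j)).
exact: esym (noiseE _ _ _ _ _ _ _).
Qed.

Lemma holder_on_le {V' : normedModType R} (a c C C' l : R) (x : R -> V') : C <= C' ->
  holder_on a c C l x -> holder_on a c C' l x.
Proof.
move=> CC xC s t as_ st tc; apply: (le_trans (xC s t as_ st tc)).
by rewrite ler_wpM2r// powR_ge0.
Qed.

Lemma powR_le_mulr (h T p q : R) : 0 < q -> q <= p -> 0 <= h <= T ->
  h `^ p <= T `^ (p - q) * h `^ q.
Proof.
move=> q0 qp /andP[h0 hT].
have T0 := le_trans h0 hT.
move: h0; rewrite le_eqVlt => /predU1P[<-|h0].
  by rewrite powR0 ?mulr_ge0 ?powR_ge0// gt_eqF// (lt_le_trans q0).
have -> : p = (p - q) + q by rewrite subrK.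
rewrite powRDgt0// addrK ler_wpM2r ?powR_ge0//.
by apply: ge0_ler_powR; rewrite ?nnegrE ?subr_ge0// ltW.
Qed.

Section noise_holder.
Variables (r T al mm be lam : R) (sigma : R -> V -> 'M[R]_(d, m)) (Ms S0 : R).
Hypotheses (r0 : 0 <= r) (T0 : 0 <= T).
Hypothesis D : noise_data T al mm be lam sigma Ms S0.

Let mm0 : 0 < mm.
Proof. by have /andP[+ _] := nd_al D => /lt_trans; apply; exact: nd_alm D. Qed.

Definition coef_slope : R := Ms * (T `^ (be - mm) + T `^ (1 - al - mm)).

Lemma coef_slope_ge0 : 0 <= coef_slope.
Proof. by rewrite mulr_ge0 ?addr_ge0 ?powR_ge0// (nd_Ms D). Qed.

(** The constant is linear in [1 + Cx]. All Hoelder constants are stated in this form, so that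
    composing steps only multiplies factors. *)
Lemma coef_holder (Cx : R) x i j : 0 <= Cx -> holder_on (- r) T Cx (1 - al) x ->
  holder_on 0 T (coef_slope * (1 + Cx)) mm (coef r sigma x i j).
Proof.
move=> Cx0 xC s t s0 st tT; rewrite /coef.
have Ms0 := nd_Ms D; have h0 : 0 <= t - s <= T.
  by rewrite subr_ge0 st lerBlDr (le_trans tT)// lerDl.
rewrite -[X in `|X|](subrKA (sigma t (x (s - r)) i j)).
have h1 : `|sigma t (x (t - r)) i j - sigma t (x (s - r)) i j| <=
    Ms * (Cx * (T `^ (1 - al - mm) * (t - s) `^ mm)).
  apply: (le_trans (nd_lip D _ _ _ _ _)); first by rewrite tT (le_trans s0).
  rewrite ler_wpM2l//.
  have -> : t - s = (t - r) - (s - r) by ring.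
  apply: (le_trans (xC _ _ _ _ _)).
  - by rewrite lerBrDr addNr.
  - by rewrite lerD2r.
  - by rewrite lerBlDr (le_trans tT)// lerDl.
  - rewrite ler_wpM2l// powR_le_mulr//; first exact: nd_mth D.
    by have -> : t - r - (s - r) = t - s by ring.
have h2 : `|sigma t (x (s - r)) i j - sigma s (x (s - r)) i j| <=
    Ms * (T `^ (be - mm) * (t - s) `^ mm).
  apply: (le_trans (nd_time D _ _ _ s0 st tT)); rewrite ler_wpM2l//.
  by rewrite powR_le_mulr//; exact: nd_mb D.
rewrite (le_trans (ler_normD _ _))// (le_trans (lerD h1 h2))// /coef_slope.
have := powR_ge0 T (be - mm); have := powR_ge0 T (1 - al - mm).
have := powR_ge0 (t - s) mm.
set h := (t - s) `^ mm; set a := T `^ (be - mm); set c := T `^ (1 - al - mm).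
move=> h_0 c0 a0; have -> : Ms * (a + c) * (1 + Cx) * h =
  Ms * (Cx * (c * h)) + Ms * (a * h) + Ms * h * (a * Cx + c) by ring.
by rewrite lerDl !mulr_ge0// addr_ge0// mulr_ge0.
Qed.

(** The factor [m] sums the driving components, the first summand bounds the leading term
    [kappa f s (g t - g s)], the second the Young remainder. [E] bounds the path at time [- r], the
    argument of [sigma] at time 0. *)
Definition noise_slope (E : R) : R := m%:R *
  (`|zaehle_kappa al| * (S0 + Ms * E + coef_slope * T `^ mm) * T `^ (lam - (1 - al)) +
   zaehle_young_const al mm lam * coef_slope * T `^ (mm + lam - (1 - al))).

Let S0ge0 := nd_S00 D.

Let young0 : 0 <= zaehle_young_const al mm lam.
Proof.
apply: zaehle_young_const_ge0; [exact: nd_al D|exact: nd_alm D|exact: nd_lam D].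
Qed.

Lemma noise_holder (E Cg Cx : R) g x : 0 <= E -> 0 <= Cg -> 0 <= Cx ->
  holder_on (- r) T Cx (1 - al) x -> `|x (- r)| <= E ->
  (forall j, holder_on 0 T Cg lam (g j)) ->
  holder_on 0 T (noise_slope E * Cg * (1 + Cx)) (1 - al) (noise al r sigma g x).
Proof.
move=> E0 Cg0 Cx0 xC xE gC s t s0 st tT.
have al1 : 0 < 1 - al by rewrite subr_gt0; case/andP: (nd_al D).
have Ms0 := nd_Ms D; have h0 : 0 <= t - s <= T.
  by rewrite subr_ge0 st lerBlDr (le_trans tT)// lerDl.
have sl0 := coef_slope_ge0.
pose c1 := `|zaehle_kappa al| * (S0 + Ms * E + coef_slope * T `^ mm) * T `^ (lam - (1 - al)).
pose c2 := zaehle_young_const al mm lam * coef_slope * T `^ (mm + lam - (1 - al)).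
have key i j : `|zaehle_int al (coef r sigma x i j) (g j) t -
    zaehle_int al (coef r sigma x i j) (g j) s| <=
    (c1 + c2) * Cg * (1 + Cx) * (t - s) `^ (1 - al).
  have CC0 : 0 <= coef_slope * (1 + Cx) by rewrite mulr_ge0// addr_ge0.
  have fC := @coef_holder _ _ i j Cx0 xC.
  have Y := zaehle_young (nd_al D) (nd_alm D) (nd_lam D) T0 CC0 Cg0 fC (gC j) s0 st tT.
  have fB : `|coef r sigma x i j s| <=
      (S0 + Ms * E + coef_slope * T `^ mm) * (1 + Cx).
    apply: (le_trans (holder_on_bounded CC0 (ltW mm0) fC _)).
      by rewrite s0 (le_trans st).
    rewrite subr0; have f0 : `|coef r sigma x i j 0| <= S0 + Ms * E.
      rewrite /coef sub0r -[X in `|X|](subrK (sigma 0 0 i j)) addrC.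
      apply: (le_trans (ler_normD _ _)); apply: lerD; first exact: nd_S0 D _ _.
      apply: (le_trans (nd_lip D _ _ _ _ _)); first by rewrite lexx.
      by rewrite subr0 ler_wpM2l.
    rewrite [X in _ <= X]mulrDl; apply: lerD; last by rewrite mulrAC.
    by apply: (le_trans f0); rewrite ler_peMr ?addr_ge0 ?mulr_ge0 ?S0ge0// lerDl.
  have q1 : (t - s) `^ lam <= T `^ (lam - (1 - al)) * (t - s) `^ (1 - al).
    by apply: powR_le_mulr => //; exact: ltW (nd_lam D).
  have q2 : (t - s) `^ (mm + lam) <=
      T `^ (mm + lam - (1 - al)) * (t - s) `^ (1 - al).
    apply: powR_le_mulr => //; apply: (le_trans (ltW (nd_lam D))).
    by rewrite lerDr ltW.
  (* The increment is split into the Young remainder, of order [mm + lam], and the leading term, of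
     order [lam]; both exceed [1 - al], and powers of [T] absorb the excess. *)
  rewrite -[X in `|X|](subrK (zaehle_kappa al * (coef r sigma x i j s * (g j t - g j s)))).
  apply: (le_trans (ler_normD _ _)); rewrite addrC.
  rewrite !mulrDl; apply: lerD.
    rewrite normrM /c1 -!mulrA; apply: ler_wpM2l; first exact: normr_ge0.
    rewrite normrM.
    have G : `|g j t - g j s| <= Cg * (T `^ (lam - (1 - al)) * (t - s) `^ (1 - al)).
      by apply: (le_trans (gC j _ _ s0 st tT)); rewrite ler_wpM2l.
    apply: (le_trans (ler_pM _ _ fB G)) => //.
    by rewrite le_eqVlt; apply/orP; left; apply/eqP; rewrite /coef_slope; ring.
  apply: (le_trans Y).
  apply: (le_trans (ler_wpM2l _ q2)); first by rewrite mulr_ge0// mulr_ge0.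
  by rewrite /c2 le_eqVlt; apply/orP; left; apply/eqP; rewrite /coef_slope; ring.
have rhs0 : 0 <= (c1 + c2) * Cg * (1 + Cx) * (t - s) `^ (1 - al).
    have h2 : 0 <= coef_slope * T `^ mm by rewrite mulr_ge0 ?powR_ge0.
  have h3 : 0 <= Ms * E by rewrite mulr_ge0.
  have h4 : 0 <= zaehle_young_const al mm lam * coef_slope by rewrite mulr_ge0.
  have h5 : 0 <= c1 + c2.
    by apply: addr_ge0; rewrite mulr_ge0 ?powR_ge0// mulr_ge0// !addr_ge0.
  by rewrite mulr_ge0 ?powR_ge0// mulr_ge0 ?addr_ge0// mulr_ge0.
have -> : noise_slope E * Cg * (1 + Cx) * (t - s) `^ (1 - al) =
    m%:R * ((c1 + c2) * Cg * (1 + Cx) * (t - s) `^ (1 - al)).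
  by rewrite /noise_slope -/c1 -/c2 !mulrA.
apply: rV_norm_le => [|i]; first by rewrite mulr_ge0.
have -> : (noise al r sigma g x t - noise al r sigma g x s) ord0 i =
    \sum_j (zaehle_int al (coef r sigma x i j) (g j) t -
            zaehle_int al (coef r sigma x i j) (g j) s).
  transitivity (noise al r sigma g x t ord0 i - noise al r sigma g x s ord0 i).
    by rewrite mxE [X in _ + X]mxE.
  by rewrite sumrB; apply: (congr2 (fun u v => u - v)); exact: noiseE.
apply: (le_trans (ler_norm_sum _ _ _)).
apply: (le_trans (ler_sum _ (fun j _ => key i j))).
by rewrite sumr_const card_ord mulr_natl.
Qed.

Lemma noise_slope_ge0 (E : R) : 0 <= E -> 0 <= noise_slope E.
Proof.
have Ms0 := nd_Ms D; have sl0 := coef_slope_ge0 => E0.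
rewrite /noise_slope; apply: mulr_ge0; first exact: ler0n.
have c2 : 0 <= coef_slope * T `^ mm by rewrite mulr_ge0 ?powR_ge0.
have c3 : 0 <= Ms * E by rewrite mulr_ge0.
have c4 : 0 <= zaehle_young_const al mm lam * coef_slope by rewrite mulr_ge0.
by apply: addr_ge0; rewrite mulr_ge0 ?powR_ge0// mulr_ge0// !addr_ge0.
Qed.

End noise_holder.

Section delay_iteration.
Variables (r T al mm be lam : R) (sigma : R -> V -> 'M[R]_(d, m)) (Ms S0 : R).
Variables (b : R -> (R -> V) -> V) (eta : R -> V).
Variables (L0 Kb : R) (beta0 L : R -> R) (Ce E : R).
Hypothesis D : delay_data r T (1 - al) b eta L0 Kb beta0 L Ce E.
Hypothesis DN : noise_data T al mm be lam sigma Ms S0.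
Hypothesis r_gt0 : 0 < r.

Local Notation C := (Cspace (- r) T).
Let th := 1 - al.

Let T0 : 0 <= T := dd_T0 D.
Let rT : - r <= T. Proof. by apply: le_trans T0; rewrite oppr_le0 ltW. Qed.

(** Built so that a noise with Hoelder constant [Cz] yields a solution whose constant [C] satisfies
    [1 + C <= delay_slope (1 + Cz)]: the first line collects what does not depend on [Cz], the last
    what multiplies it, with [Z = Cz T^th] inserted into [ode_bound]. *)
Definition delay_slope : R :=
  let e := 2 * expR ((2 * L0 + 1) * T) in
  1 + Ce + Kb + L0 * (e * (E + Kb * T `^ th)) * T `^ (1 - th) +
  (1 + L0 * (e * T `^ th) * T `^ (1 - th)).

Lemma delay_slope_ge1 : 1 <= delay_slope.
Proof.
have L00 := dd_L00 D; have Kb0 := dd_Kb0 D; have Ce0 := dd_Ce0 D.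
have E0 := dd_E0 D.
have e0 : 0 <= 2 * expR ((2 * L0 + 1) * T) by rewrite mulr_ge0 ?expR_ge0.
rewrite /delay_slope /= -!addrA lerDl; apply: addr_ge0 => //.
apply: addr_ge0 => //; apply: addr_ge0.
  by rewrite mulr_ge0 ?powR_ge0// mulr_ge0// mulr_ge0// addr_ge0// mulr_ge0 ?powR_ge0.
apply: addr_ge0 => //.
by rewrite mulr_ge0 ?powR_ge0// mulr_ge0// mulr_ge0 ?powR_ge0.
Qed.

Lemma ode_sol_slope (Cz : R) z : 0 <= Cz -> z 0 = 0 -> holder_on 0 T Cz th z ->
  [/\ holder_on (- r) T (delay_slope * (1 + Cz) - 1) th (ode_sol b eta z),
      C (ode_sol b eta z),
      solves_ode r b eta T z (ode_sol b eta z) &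
      exists2 N, 0 <= N & forall t, - r <= t <= T -> `|ode_sol b eta z t| <= N].
Proof.
move=> Cz0 z0 zC.
have th_0 : 0 < th := dd_th0 D.
have Z0 : 0 <= Cz * T `^ th by rewrite mulr_ge0 ?powR_ge0.
have zZ t : 0 <= t <= T -> `|z t| <= Cz * T `^ th.
  move=> tT; have := holder_on_bounded Cz0 (ltW th_0) zC tT.
  by rewrite z0 normr0 add0r subr0.
split.
- have := ode_sol_holder D Cz0 Z0 z0 zC zZ; apply: holder_on_le.
  rewrite /ode_holder_const /ode_bound /delay_slope -/th.
  have Kb0 := dd_Kb0 D; have Ce0 := dd_Ce0 D; have L00 := dd_L00 D.
  have E0 := dd_E0 D; have e0 := expR_ge0 ((2 * L0 + 1) * T).
  have := powR_ge0 T th; have := powR_ge0 T (1 - th).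
  move: e0; set e := expR _; set p := T `^ (1 - th); set q := T `^ th => e0 p0 q0.
  rewrite -subr_ge0.
  have -> : (1 + Ce + Kb + L0 * (2 * e * (E + Kb * q)) * p +
    (1 + L0 * (2 * e * q) * p)) * (1 + Cz) - 1 -
    (Ce + (Cz + (L0 * (2 * (E + Cz * q + Kb * q) * e) * p + Kb))) =
    Cz * (1 + Ce + Kb + L0 * (2 * e * (E + Kb * q)) * p) + (1 + L0 * (2 * e * q) * p).
    by ring.
  have h1 : 0 <= L0 * (2 * e * (E + Kb * q)) * p.
    by rewrite mulr_ge0// mulr_ge0// mulr_ge0 ?mulr_ge0// addr_ge0// mulr_ge0.
  have h2 : 0 <= L0 * (2 * e * q) * p by rewrite mulr_ge0// mulr_ge0// mulr_ge0// mulr_ge0.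
  by apply: addr_ge0; rewrite ?mulr_ge0// !addr_ge0.
- by have h := ode_sol_Cspace D Cz0 Z0 z0 zC zZ; exact h.
- by have h := ode_sol_solves D Cz0 Z0 z0 zC zZ; exact h.
- exists (ode_bound T th L0 Kb E (Cz * T `^ th)).
    rewrite /ode_bound mulr_ge0 ?expR_ge0// mulr_ge0// !addr_ge0 ?(dd_E0 D)//.
    by rewrite mulr_ge0 ?powR_ge0// (dd_Kb0 D).
  by have h := ode_sol_bounded D Cz0 Z0 z0 zC zZ; exact h.
Qed.

Lemma solves_ode_le tau tau' z x : tau' <= tau -> solves_ode r b eta tau z x ->
  solves_ode r b eta tau' z x.
Proof. by move=> tt xS t /andP[rt tt']; apply: xS; rewrite rt (le_trans tt'). Qed.

Lemma solves_ode_neg tau z x t : 0 <= tau -> solves_ode r b eta tau z x ->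
  - r <= t <= 0 -> x t = eta t.
Proof.
move=> tau0 xS /andP[rt t0]; rewrite xS ?rt ?(le_trans t0)//.
by rewrite /ode_step t0.
Qed.

(** Agreement up to [tau] makes the noise terms equal up to [tau + r], and stability with [eps = 0]
    makes the solutions equal there. Uniqueness and the consistency of the iterates both rest on
    it. *)
Lemma delay_step_unique tau tau' g x y x' y' : tau' <= tau + r -> tau' <= T ->
  C x' -> C y' -> (forall t, - r <= t <= tau -> x t = y t) ->
  solves_ode r b eta tau' (noise al r sigma g x) x' ->
  solves_ode r b eta tau' (noise al r sigma g y) y' ->
  forall t, - r <= t <= tau' -> x' t = y' t.
Proof.
move=> tt tT Cx Cy xy xS yS t tt'.
have [N N0 xN] := Cspace_bounded rT Cx; have [N' N'0 yN] := Cspace_bounded rT Cy.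
have NN0 : 0 <= N + N' by rewrite addr_ge0.
have k0 : 0 < 2 * L (N + N') + 1 by rewrite ltr_wpDl// mulr_ge0// (dd_L0 D).
have k1 : 2 * L (N + N') <= 2 * L (N + N') + 1 by rewrite lerDl.
have xNN s : - r <= s <= T -> `|x' s| <= N + N'.
  by move=> /xN h; apply: (le_trans h); rewrite lerDl.
have yNN s : - r <= s <= T -> `|y' s| <= N + N'.
  by move=> /yN h; apply: (le_trans h); rewrite lerDr.
have zz s : 0 <= s <= tau' ->
    `|noise al r sigma g x s - noise al r sigma g y s| <= 0.
  move=> /andP[s0 st]; rewrite (@eq_noise _ _ _ _ x y) ?subrr ?normr0// => u /andP[ru us].
  by apply: xy; rewrite ru (le_trans us)// lerBlDr (le_trans st).
have := ode_stability D NN0 k0 k1 (lexx 0) tT (noise0 _ _ _ _ _) (noise0 _ _ _ _ _)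
  Cx Cy xNN yNN zz xS yS tt'.
by rewrite mulr0 mul0r normr_le0 subr_eq0 => /eqP.
Qed.

(** Agreement on the initial segment spreads by one delay at a time until [n r] exceeds [T]. *)
Lemma delay_unique g x y : C x -> C y ->
  solves_ode r b eta T (noise al r sigma g x) x ->
  solves_ode r b eta T (noise al r sigma g y) y ->
  forall t, - r <= t <= T -> x t = y t.
Proof.
move=> Cx Cy xS yS.
have H n t : - r <= t <= Num.min (n%:R * r) T -> x t = y t.
  elim: n t => [|n IHn] t.
    rewrite mul0r le_min => /andP[rt /andP[t0 tT]].
    by rewrite (solves_ode_neg T0 xS) ?rt// (solves_ode_neg T0 yS) ?rt.
  move=> tn; apply: (@delay_step_unique (Num.min (n%:R * r) T)
    (Num.min (n.+1%:R * r) T) g x y) => //.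
  - by rewrite ge_min; have [h|h] := leP (n%:R * r) T;
      [rewrite -[n.+1]addn1 natrD mulrDl mul1r lexx|apply/orP; right; rewrite lerDl ltW].
  - by rewrite ge_min lexx orbT.
  - by apply: solves_ode_le xS; rewrite ge_min lexx orbT.
  - by apply: solves_ode_le yS; rewrite ge_min lexx orbT.
have [n nT] : exists n : nat, T <= n%:R * r.
  exists (Num.trunc (T / r)).+1; rewrite -ler_pdivrMr//.
  by rewrite ltW// Num.Theory.truncnS_gt.
move=> t /andP[rt tT]; apply: (H n); rewrite rt le_min tT andbT.
exact: le_trans nT.
Qed.

(** Each iterate solves an equation on the whole interval, driven by the noise of its predecessor;
    beyond the time where the predecessor is right its values are merely provisional. *)
Fixpoint delay_iter (g : 'I_m -> R -> R) (k : nat) : R -> V :=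
  ode_sol b eta (if k is k'.+1 then noise al r sigma g (delay_iter g k')
                 else fun=> 0).

(** Solves the recursion for [1 + C]: one factor [delay_slope] for each equation solved and one
    factor [1 + noise_slope Cg] for each noise term formed. *)
Definition delay_const (Cg : R) (k : nat) : R :=
  delay_slope ^+ k.+1 * (1 + noise_slope T al mm be lam Ms S0 E * Cg) ^+ k - 1.

Section iterates.
Variables (g : 'I_m -> R -> R) (Cg : R).
Hypotheses (Cg0 : 0 <= Cg) (gC : forall j, holder_on 0 T Cg lam (g j)).

Let ns0 : 0 <= noise_slope T al mm be lam Ms S0 E * Cg.
Proof. by rewrite mulr_ge0// (noise_slope_ge0 DN) ?(dd_E0 D). Qed.

Lemma delay_const_ge0 k : 0 <= delay_const Cg k.
Proof.
rewrite subr_ge0 mulr_ege1 ?exprn_ege1 ?delay_slope_ge1//.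
by rewrite lerDl.
Qed.

Lemma delay_iter_spec k :
  holder_on (- r) T (delay_const Cg k) th (delay_iter g k) /\
  exists z, [/\ z 0 = 0, C (delay_iter g k),
    z = (if k is k'.+1 then noise al r sigma g (delay_iter g k') else fun=> 0) &
    solves_ode r b eta T z (delay_iter g k)].
Proof.
elim: k => [|k [IHh [z [z0 IHC _ IHs]]]].
  have z0 : holder_on 0 T 0 th (fun=> 0 : V).
    by move=> s t _ _ _; rewrite subrr normr0 mul0r.
  have [h1 h2 h3 _] := ode_sol_slope (lexx 0) (erefl ((fun=> 0 : V) 0)) z0.
  split; last by exists (fun=> 0); split.
  by move: h1; rewrite /delay_const expr1 expr0 addr0.
have xE : `|delay_iter g k (- r)| <= E.
  rewrite (solves_ode_neg T0 IHs) ?lexx ?oppr_le0 ?(ltW r_gt0)//.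
  by apply: (dd_etaE D); rewrite lexx oppr_le0 ltW.
have zC := noise_holder (ltW r_gt0) T0 DN (dd_E0 D) Cg0 (delay_const_ge0 k) IHh xE gC.
have Cz0 : 0 <= noise_slope T al mm be lam Ms S0 E * Cg * (1 + delay_const Cg k).
  by rewrite mulr_ge0// addr_ge0// delay_const_ge0.
have [h1 h2 h3 _] := ode_sol_slope Cz0 (noise0 _ _ _ _ _) zC.
split; last by exists (noise al r sigma g (delay_iter g k)); split => //; exact: noise0.
(* With [a] the slope times [Cg] and [P = 1 + C] for the previous iterate, the claim is
   [1 + a P <= (1 + a) P], true because [P >= 1]. *)
apply: holder_on_le h1; rewrite lerD2r /delay_const.
move: ns0; set a := noise_slope _ _ _ _ _ _ _ _ * Cg => a0.
rewrite [1 + (_ - 1)]addrC subrK.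
have -> : delay_slope ^+ k.+2 * (1 + a) ^+ k.+1 =
  delay_slope * ((1 + a) * (delay_slope ^+ k.+1 * (1 + a) ^+ k)).
  by rewrite [in LHS]exprS [(1 + a) ^+ k.+1]exprS; ring.
rewrite ler_wpM2l ?(le_trans ler01 delay_slope_ge1)//.
rewrite mulrDl mul1r lerD2r mulr_ege1 ?exprn_ege1 ?delay_slope_ge1//.
by rewrite lerDl.
Qed.

Lemma delay_iter_agree k t : - r <= t <= Num.min (k%:R * r) T ->
  delay_iter g k.+1 t = delay_iter g k t.
Proof.
elim: k t => [|k IHk] t.
  rewrite mul0r le_min => /andP[rt /andP[t0 tT]].
  have [_ [z [_ _ _ zS]]] := delay_iter_spec 0.
  have [_ [z' [_ _ _ zS']]] := delay_iter_spec 1.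
  by rewrite (solves_ode_neg T0 zS) ?rt// (solves_ode_neg T0 zS') ?rt.
have [_ [z [_ C1 zE zS]]] := delay_iter_spec k.+1.
have [_ [z' [_ C2 zE' zS']]] := delay_iter_spec k.+2.
rewrite zE in zS; rewrite zE' in zS'.
have h1 : Num.min (k.+1%:R * r) T <= Num.min (k%:R * r) T + r.
  rewrite ge_min; have [h|h] := leP (k%:R * r) T; last first.
    by apply/orP; right; rewrite lerDl ltW.
  by rewrite -[k.+1]addn1 natrD mulrDl mul1r lexx.
have h2 : Num.min (k.+1%:R * r) T <= T by rewrite ge_min lexx orbT.
exact: (delay_step_unique h1 h2 C2 C1 IHk (solves_ode_le h2 zS') (solves_ode_le h2 zS)).
Qed.

(** Up to time [T] the noise reads the path on [[-r, T - r]] only, where the iterates [k] and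
    [k + 1] agree since [T <= k r]. Iterate [k + 1] is therefore driven by its own noise. *)
Lemma delay_iter_solves k : T <= k%:R * r ->
  solves_ode r b eta T (noise al r sigma g (delay_iter g k.+1)) (delay_iter g k.+1).
Proof.
move=> kT t tT; have [_ [z [_ C1 zE zS]]] := delay_iter_spec k.+1.
rewrite zE in zS; apply: (etrans (zS t tT)).
have [t0|t0] := boolP (t <= 0); first by rewrite /ode_step t0.
rewrite -ltNge in t0.
suff H : noise al r sigma g (delay_iter g k) t = noise al r sigma g (delay_iter g k.+1) t.
  by rewrite /ode_step H.
have := @eq_noise al r sigma g (delay_iter g k) (delay_iter g k.+1) t (ltW t0).
apply=> s /andP[rs st]; apply: esym.
apply: delay_iter_agree; rewrite rs le_min.
have /andP[_ tT'] := tT.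
have sT : s <= T by rewrite (le_trans st)// lerBlDr (le_trans tT')// lerDl ltW.
by rewrite sT (le_trans sT).
Qed.

End iterates.
End delay_iteration.
End delay_noise.

(** * Function spaces and assumptions *)

Section ge0_integral_monotone.
Local Open Scope ereal_scope.
Context {d : measure_display} {T : measurableType d} {R : realType}.
Variable mu : {measure set T -> \bar R}.

(* No measurability is required: the integral of a nonnegative function is a
   supremum over the simple functions below it. *)
Lemma ge0_le_integral_nonmeas (D : set T) (f g : T -> \bar R) :
  (forall x, D x -> 0 <= f x) -> (forall x, D x -> f x <= g x) ->
  \int[mu]_(x in D) f x <= \int[mu]_(x in D) g x.
Proof.
move=> f0 fg; have g0 x : D x -> 0 <= g x.
  by move=> Dx; exact: le_trans (f0 _ Dx) (fg _ Dx).
rewrite !ge0_integralE//; apply: ereal_sup_le => _ [h hf <-].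
exists h => // x; apply: (le_trans (hf x)).
rewrite !patchE; case: ifPn => // /set_mem; exact: fg.
Qed.

End ge0_integral_monotone.

Section euclidean_norm.
Context {R : realType}.

Lemma enorm_ge0 {p q} (A : 'M[R]_(p, q)) : 0 <= enorm A.
Proof. exact: sqrtr_ge0. Qed.

Lemma entry_le_enorm {p q} (A : 'M[R]_(p, q)) i j : `|A i j| <= enorm A.
Proof.
rewrite /enorm -sqrtr_sqr ler_wsqrtr// (bigD1 i)//= (bigD1 j)//= -addrA lerDl.
rewrite addr_ge0 ?sumr_ge0// => *; first exact: sqr_ge0.
by rewrite sumr_ge0// => *; exact: sqr_ge0.
Qed.

Lemma norm_le_enorm {d} (v : 'rV[R]_d) : `|v| <= enorm v.
Proof. by apply: rV_norm_le => [|i]; [exact: enorm_ge0|exact: entry_le_enorm]. Qed.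

Lemma enorm_le_norm {d} (v : 'rV[R]_d) : enorm v <= d%:R * `|v|.
Proof.
have h0 : 0 <= d%:R * `|v| by rewrite mulr_ge0.
rewrite -[X in _ <= X](ger0_norm h0) -sqrtr_sqr ler_wsqrtr// big_ord1.
apply: (@le_trans _ _ (\sum_(i < d) `|v| ^+ 2)).
  apply: ler_sum => i _; rewrite -[v _ _ ^+ 2]real_normK ?num_real//.
  by rewrite ler_sqr ?nnegrE//; exact: rV_coord_le.
rewrite sumr_const card_ord exprMn -[X in X <= _]mulr_natl ler_wpM2r ?sqr_ge0//.
case: d {v h0} => [|d]; first by rewrite expr0n.
by rewrite -natrX ler_nat -mulnn leq_pmulr.
Qed.

End euclidean_norm.

(** * Hoelder bounds and the norms of the function spaces *)

Section hoelder_norms.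
Context {R : realType} {d : nat}.
Local Notation V := 'rV[R]_d.
Local Notation mu := (@lebesgue_measure R).
Local Notation mR := (measurableTypeR R).

Lemma integral_le_powRBr (C p s t : R) (h : R -> R) : 0 <= C -> 0 < p -> s <= t ->
  (forall u, s <= u -> u < t -> 0 <= h u <= C * (t - u) `^ (p - 1)) ->
  (\int[mu]_(u in `[s, t[) (h u)%:E <= (C * ((t - s) `^ p / p))%:E)%E.
Proof.
move=> C0 p0 st hC.
have m1 : measurable_fun `[s, t[ (fun u : mR => ((t - u) `^ (p - 1))%:E).
  exact: measurable_EFin_powRBr.
apply: (@le_trans _ _ (\int[mu]_(u in `[s, t[) (C%:E * ((t - u) `^ (p - 1))%:E))%E).
  apply: ge0_le_integral_nonmeas => u; rewrite /= in_itv/= => /andP[su ut].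
    by rewrite lee_fin; have /andP[] := hC _ su ut.
  by rewrite -EFinM lee_fin; have /andP[] := hC _ su ut.
rewrite ge0_integralZl//; last by move=> u _; rewrite lee_fin powR_ge0.
rewrite -(@integral_itv_obnd_cbnd _ s (BLeft t)); last exact: measurable_EFin_powRBr.
by rewrite integral_powRBr.
Qed.

Lemma integral_le_powRBl (C p s t : R) (h : R -> R) : 0 <= C -> 0 < p -> s <= t ->
  (forall u, s < u -> u < t -> 0 <= h u <= C * (u - s) `^ (p - 1)) ->
  (\int[mu]_(u in `]s, t[) (h u)%:E <= (C * ((t - s) `^ p / p))%:E)%E.
Proof.
move=> C0 p0 st hC.
apply: (@le_trans _ _ (\int[mu]_(u in `]s, t[) (C%:E * ((u - s) `^ (p - 1))%:E))%E).
  apply: ge0_le_integral_nonmeas => u; rewrite /= in_itv/= => /andP[su ut].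
    by rewrite lee_fin; have /andP[] := hC _ su ut.
  by rewrite -EFinM lee_fin; have /andP[] := hC _ su ut.
rewrite ge0_integralZl//; last 2 first.
  exact: measurable_EFin_powRBl.
  by move=> u _; rewrite lee_fin powR_ge0.
by rewrite integral_powRBl.
Qed.

Lemma le_divr_powR (A C h p q : R) : 0 < h -> 0 <= A -> A <= C * h `^ p ->
  0 <= A / h `^ q <= C * h `^ (p - q).
Proof.
move=> h0 A0 AC; have hq : 0 < h `^ q by exact: powR_gt0.
rewrite divr_ge0 ?(ltW hq)//= ler_pdivrMr// -mulrA -powRDgt0// subrK.
exact: AC.
Qed.

(** The Hoelder bound reduces the kernel to [(t - s)^(th - al - 1)], integrable exactly when
    [al < th]. For [th = 1 - al] this is the condition [al < 1/2]. *)
Lemma W0norm_holder (al th a c C N : R) (x : R -> V) : 0 < al -> al < th ->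
  0 <= C -> holder_on a c C th x -> (forall t, a <= t <= c -> `|x t| <= N) ->
  (W0norm al a c x <=
   (d%:R * (N + C * ((c - a) `^ (th - al) / (th - al))))%:E)%E.
Proof.
move=> al0 alth C0 xC xN; rewrite /W0norm; apply: ge_ereal_sup => /= _ [t tac <-].
have /andP[at_ tc] : a <= t <= c by move: tac; rewrite /= in_itv.
have q0 : 0 < th - al by rewrite subr_gt0.
rewrite mulrDr EFinD; apply: leeD.
  rewrite lee_fin (le_trans (enorm_le_norm _))// ler_wpM2l// xN// at_.
have dC0 : 0 <= d%:R * C by rewrite mulr_ge0.
apply: (le_trans (@integral_le_powRBr (d%:R * C) (th - al) a t _ dC0 q0 at_ _)).
  move=> u au ut; have -> : th - al - 1 = th - (al + 1) by ring.
  apply: le_divr_powR; [by rewrite subr_gt0|exact: enorm_ge0|].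
  rewrite (le_trans (enorm_le_norm _))// -mulrA ler_wpM2l//.
  by apply: xC => //; exact: ltW.
rewrite lee_fin -mulrA ler_wpM2l// ler_wpM2l// ler_wpM2r ?invr_ge0 ?(ltW q0)//.
apply: ge0_ler_powR; rewrite ?nnegrE ?subr_ge0 ?(ltW q0) ?(ltW alth)//.
  exact: le_trans tc.
by rewrite lerD2r.
Qed.

Lemma supnorm_le (a c N : R) (x : R -> V) : (forall t, a <= t <= c -> `|x t| <= N) ->
  (supnorm a c x <= (d%:R * N)%:E)%E.
Proof.
move=> xN; rewrite /supnorm; apply: ge_ereal_sup => /= _ [t tac <-]; have {}tac : a <= t <= c by move: tac; rewrite /= in_itv.
by rewrite lee_fin (le_trans (enorm_le_norm _))// ler_wpM2l// xN.
Qed.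

Lemma holder_on_Holder (th a c C N : R) (x : R -> V) :
  holder_on a c C th x -> (forall t, a <= t <= c -> `|x t| <= N) ->
  Holder th a c x.
Proof.
move=> xC xN; rewrite /Holder /= /holder_norm.
apply: (@le_lt_trans _ _ ((d%:R * N)%:E + (d%:R * C)%:E)%E); last by rewrite -EFinD ltry.
apply: leeD; first exact: supnorm_le.
apply: ge_ereal_sup => /= _ [[s t] /= [as_ st tc] <-]; rewrite lee_fin.
rewrite ler_pdivrMr ?powR_gt0 ?subr_gt0//.
by rewrite (le_trans (enorm_le_norm _))// -mulrA ler_wpM2l// xC// ltW.
Qed.

Lemma Holder_holder_on (th a c : R) (x : R -> V) : a < c ->
  Holder th a c x -> exists C N, [/\ 0 <= C, 0 <= N, holder_on a c C th x &
    forall t, a <= t <= c -> `|x t| <= N].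
Proof.
move=> ac; rewrite /Holder /= /holder_norm.
set S := supnorm _ _ _; set Q := ereal_sup _ => h.
have SQ t : a <= t <= c -> ((enorm (x t))%:E <= S)%E.
  by move=> tac; apply: ereal_sup_ubound => /=; exists t => //; rewrite in_itv.
have Qb s t : a <= s -> s < t -> t <= c ->
    ((enorm (x t - x s) / (t - s) `^ th)%:E <= Q)%E.
  by move=> as_ st tc; apply: ereal_sup_ubound => /=; exists (s, t).
have S0 : (0 <= S)%E.
  by apply: le_trans (SQ a _); rewrite ?lexx ?(ltW ac)// lee_fin enorm_ge0.
(* The pair [(a, c)] is admissible because [a < c]; without any pair the supremum would be minus
   infinity. *)
have Q0 : (0 <= Q)%E.
  apply: le_trans (Qb a c (lexx a) ac (lexx c)).
  by rewrite lee_fin divr_ge0 ?enorm_ge0 ?powR_ge0.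
have Sfin : S \is a fin_num by rewrite ge0_fin_numE//; apply: le_lt_trans h; exact: leeDl.
have Qfin : Q \is a fin_num by rewrite ge0_fin_numE//; apply: le_lt_trans h; exact: leeDr.
exists (fine Q), (fine S); split; [exact: fine_ge0|exact: fine_ge0| |].
- move=> s t as_; rewrite le_eqVlt => /predU1P[<-|st] tc.
    by rewrite !subrr normr0 mulr_ge0 ?fine_ge0 ?powR_ge0.
  have := Qb _ _ as_ st tc; rewrite -(fineK Qfin) lee_fin.
  rewrite ler_pdivrMr ?powR_gt0 ?subr_gt0//; apply: le_trans.
  exact: norm_le_enorm.
- move=> t /SQ; rewrite -(fineK Sfin) lee_fin; apply: le_trans.
  exact: norm_le_enorm.
Qed.

Lemma holder_on_W0cont (al th a c C : R) (x : R -> V) : 0 < al -> al < th ->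
  a <= c -> 0 <= C -> holder_on a c C th x -> W0cont al a c x.
Proof.
move=> al0 alth ac C0 xC; have th0 := lt_trans al0 alth.
split; last exact: holder_on_Cspace xC.
split=> [i|].
  apply: subspace_continuous_measurable_fun; first exact: measurable_itvR.
  apply: (@holder_on_within _ _ a c C th) => // s t as_ st tc.
  apply: le_trans (xC s t as_ st tc).
  by have := rV_coord_le (x t - x s) i; rewrite !mxE.
apply: le_lt_trans (W0norm_holder al0 alth C0 xC
  (holder_on_bounded C0 (ltW th0) xC)) (ltry _).
Qed.

(** Write an increment as the product of its powers [1 - k] and [k], and bound the first by the
    uniform norm, the second by the Hoelder bound. *)
Lemma holder_on_interpolate (a c C th k eps : R) (x : R -> V) : 0 <= C ->
  0 <= k <= 1 -> 0 <= eps -> holder_on a c C th x ->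
  (forall t, a <= t <= c -> `|x t| <= eps) ->
  holder_on a c ((2 * eps) `^ (1 - k) * C `^ k) (th * k) x.
Proof.
move=> C0 /andP[k0 k1] eps0 xC xe s t as_ st tc.
have h1 : `|x t - x s| <= 2 * eps.
  rewrite (le_trans (ler_normB _ _))//.
  have := xe t; have := xe s; rewrite as_ tc (le_trans st tc) (le_trans as_ st).
  by move=> /(_ isT) + /(_ isT); lra.
have h2 := xC s t as_ st tc.
rewrite -mulrA powRrM -powRM ?powR_ge0//.
have [D0|D0] := eqVneq (`|x t - x s|) 0.
  by rewrite D0 mulr_ge0 ?powR_ge0.
have Dpos : 0 < `|x t - x s| by rewrite lt_neqAle eq_sym D0 normr_ge0.
have -> : `|x t - x s| = `|x t - x s| `^ (1 - k) * `|x t - x s| `^ k.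
  by rewrite -powRDgt0// subrK powRr1.
apply: ler_pM; rewrite ?powR_ge0//; apply: ge0_ler_powR; rewrite ?nnegrE ?subr_ge0//.
  by rewrite mulr_ge0.
by rewrite mulr_ge0 ?powR_ge0.
Qed.

End hoelder_norms.

Section zaehle_conditions.
Context {R : realType}.
Local Notation mu := (@lebesgue_measure R).
Local Notation mR := (measurableTypeR R).

Lemma holder_zaehle_integrand (al m C T : R) (f : R -> R) : 0 < al < 1 ->
  al < m -> 0 <= T -> 0 <= C -> holder_on 0 T C m f -> zaehle_integrand al T f.
Proof.
move=> /andP[al0 al1] alm T0 C0 fC; have m0 := lt_trans al0 alm.
have fN := holder_on_bounded C0 (ltW m0) fC.
set N := `|f 0| + _ in fN.
have N0 : 0 <= N by rewrite addr_ge0// mulr_ge0 ?powR_ge0.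
split.
  apply: subspace_continuous_measurable_fun; first exact: measurable_itvR.
  exact: holder_on_within fC.
have q0 : 0 < m - al by rewrite subr_gt0.
have q1 : 0 < 1 - al by rewrite subr_gt0.
set A := (\int[mu]_(s in `[0%R, T]) _)%E; set B := (\int[mu]_(s in `[0%R, T]) _)%E.
have hA : (A <= (N * ((T - 0) `^ (1 - al) / (1 - al)))%:E)%E.
  apply: (@le_trans _ _
    (\int[mu]_(s in `[0%R, T]) (N%:E * ((s - 0) `^ (1 - al - 1))%:E))%E).
    apply: ge0_le_integral_nonmeas => s; rewrite /= in_itv/= => sT.
      by rewrite lee_fin divr_ge0 ?powR_ge0.
    rewrite -EFinM lee_fin; have -> : 1 - al - 1 = - al by ring.
    by rewrite powRN subr0 ler_wpM2r ?invr_ge0 ?powR_ge0// fN.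
  rewrite ge0_integralZl//; last 2 first.
    exact: measurable_EFin_powRBl.
    by move=> u _; rewrite lee_fin powR_ge0.
  rewrite -(@integral_itv_obnd_cbnd _ 0 (BRight T)); last exact: measurable_EFin_powRBl.
  rewrite -(@integral_itv_bndo_bndc _ (BRight 0) T); last exact: measurable_EFin_powRBl.
  by rewrite integral_powRBl.
have hB : (B <= \int[mu]_(s in `[0%R, T]) (C * (T `^ (m - al) / (m - al)))%:E)%E.
  apply: ge0_le_integral_nonmeas => s; rewrite /= in_itv/= => /andP[s0 sT].
    by apply: integral_ge0 => u _; rewrite lee_fin divr_ge0 ?powR_ge0.
  apply: (le_trans (@integral_le_powRBr _ C (m - al) 0 s _ C0 q0 s0 _)).
    move=> u u0 us; have -> : m - al - 1 = m - (al + 1) by ring.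
    apply: le_divr_powR; rewrite ?subr_gt0// fC// ?(ltW us)//.
  rewrite lee_fin ler_wpM2l// ler_wpM2r ?invr_ge0 ?(ltW q0)//.
  apply: ge0_ler_powR; rewrite ?nnegrE ?subr_ge0 ?subr0//; exact: ltW.
rewrite (le_lt_trans (leeD hA hB))//.
rewrite integral_cst; last exact: measurable_itvR.
rewrite /= lebesgue_measure_itv/= lte_fin.
by case: ifP => _; rewrite ?mule0 ?adde0 -?EFinB -?EFinM -?EFinD ltry.
Qed.

Lemma holder_zaehle_integrator (al l C T : R) (g : R -> R) : al < 1 -> 1 - al < l ->
  0 <= T -> 0 <= C -> holder_on 0 T C l g -> zaehle_integrator al T g.
Proof.
move=> al1 al1l T0 C0 gC; have q1 : 0 < 1 - al by rewrite subr_gt0.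
have l0 := lt_trans q1 al1l; have q0 : 0 < l - (1 - al) by rewrite subr_gt0.
split.
  apply: subspace_continuous_measurable_fun; first exact: measurable_itvR.
  exact: holder_on_within gC.
apply: (@le_lt_trans _ _ ((C * T `^ (l - (1 - al)))%:E +
    (C * (T `^ (l - (1 - al)) / (l - (1 - al))))%:E)%E); last by rewrite -EFinD ltry.
apply: ge_ereal_sup => /= _ [[s t] /= [s0 st tT] <-].
have st0 : 0 < t - s by rewrite subr_gt0.
have stT : t - s <= T by rewrite lerBlDr (le_trans (ltW tT))// lerDl ltW.
have pT : (t - s) `^ (l - (1 - al)) <= T `^ (l - (1 - al)).
  by apply: ge0_ler_powR; rewrite ?nnegrE// ltW.
apply: leeD.
  have G := gC s t (ltW s0) (ltW st) (ltW tT).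
  have /andP[_ h] := le_divr_powR (1 - al) st0 (normr_ge0 _) G.
  by rewrite lee_fin (le_trans h)// ler_wpM2l.
apply: (le_trans (@integral_le_powRBl _ C (l - (1 - al)) s t _ C0 q0 (ltW st) _)).
  move=> u su ut; have -> : l - (1 - al) - 1 = l - (2 - al) by ring.
  apply: le_divr_powR; rewrite ?subr_gt0// gC// ltW//.
  exact: lt_trans tT.
by rewrite lee_fin ler_wpM2l// ler_wpM2r ?invr_ge0// ltW.
Qed.

End zaehle_conditions.

Section drift_assumption.
Context {R : realType} {d : nat}.
Local Notation V := 'rV[R]_d.
Local Notation mu := (@lebesgue_measure R).
Local Notation mR := (measurableTypeR R).

(* If [a h^al > 1] then [a h^al <= (a h^al)^(1/al)]. *)
Lemma powR_young (al rho a h : R) : 0 < al <= 1 -> al^-1 <= rho -> 0 <= a -> 0 < h ->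
  a <= h `^ (- al) + h `^ (1 - al) * (1 + a `^ rho).
Proof.
move=> /andP[al0 al1] alrho a0 h0; have p0 := powR_gt0 (- al) h0.
have q0 := powR_gt0 (1 - al) h0; have hal := powR_gt0 al h0.
have g0 : 0 <= 1 + a `^ rho by rewrite addr_ge0 ?powR_ge0.
have [ah|ah] := leP a (h `^ (- al)).
  by rewrite (le_trans ah)// lerDl mulr_ge0// ltW.
have i1 : 1 <= al^-1 by rewrite invf_ge1.
have a_gt0 : 0 < a := lt_trans p0 ah.
have ha : 1 <= a * h `^ al.
  by rewrite -ler_pdivrMr// div1r -powRN ltW.
have key : a <= h `^ (1 - al) * a `^ al^-1.
  have := ler_powR ha i1; rewrite powRr1 ?mulr_ge0 ?(ltW hal)//.
  rewrite powRM ?(ltW hal)// -powRrM divff ?gt_eqF// powRr1 ?(ltW h0)// => k1.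
  rewrite -(@ler_pM2r _ (h `^ al))//; apply: (le_trans k1).
  by rewrite mulrAC -powRDgt0// subrK powRr1 ?(ltW h0)// mulrC.
apply: (le_trans key); rewrite ler_wpDl ?(ltW p0)//.
rewrite ler_wpM2l ?(ltW q0)//.
have [a1|/ltW a1] := leP 1 a.
  by rewrite (le_trans (ler_powR a1 alrho))// lerDr.
apply: (@le_trans _ _ (1 `^ al^-1)).
  by apply: ge0_ler_powR; rewrite ?nnegrE// invr_ge0 ltW.
by rewrite powR1 lerDl powR_ge0.
Qed.

(** Replaces Hoelder's inequality for the integral of [b0] over []s, t[]. The pointwise inequality
    above, with [h = t - s], integrates to [h^(1 - al)] from its first term and to [h^(1 - al)]
    times the total integral of [1 + |b0|^rho] from the second. *)
Lemma integral_young (T al rho : R) (b0 : R -> R) : 0 < al <= 1 -> al^-1 <= rho ->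
  measurable_fun `]0, T[ b0 ->
  (\int[mu]_(t in `]0%R, T[) (`|b0 t| `^ rho)%:E < +oo)%E ->
  mu.-integrable `]0, T[ (EFin \o (fun t => `|b0 t|)) /\
  exists2 K : R, 0 <= K & forall s t, 0 <= s -> s <= t -> t <= T ->
    \int[mu]_(u in `]s, t[) `|b0 u| <= K * (t - s) `^ (1 - al).
Proof.
move=> al01 alrho mb ib; have /andP[al0 al1] := al01.
have rho1 : 1 <= rho by apply: le_trans alrho; rewrite invf_ge1.
have mp : measurable_fun `]0, T[ (fun t : mR => `|b0 t| `^ rho).
  apply: (measurableT_comp (measurable_powR rho)).
  exact: (measurableT_comp (@normr_measurable R setT)).
have iP : mu.-integrable `]0, T[ (EFin \o (fun t => `|b0 t| `^ rho)).
  apply/integrableP; split; first exact/measurable_EFinP.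
  apply: le_lt_trans ib; apply: ge0_le_integral_nonmeas => t _ //=.
  by rewrite ger0_norm ?powR_ge0.
pose G t := 1 + `|b0 t| `^ rho.
have i1 (u v : R) : mu.-integrable `]u, v[ (EFin \o cst (1 : R)).
  exact: (@integrable_bounded_itv R u v `|1| (cst 1)).
have iG : mu.-integrable `]0, T[ (EFin \o G).
  exact: (integrableD (@measurable_itvR _ _) (i1 0 T) iP).
have G0 t : 0 <= G t by rewrite addr_ge0 ?powR_ge0.
have mab : measurable_fun `]0, T[ (fun t : mR => `|b0 t|).
  exact: (measurableT_comp (@normr_measurable R setT)).
have ia : mu.-integrable `]0, T[ (EFin \o (fun t => `|b0 t|)).
  apply: le_integrable iG; [exact: measurable_itvR|exact/measurable_EFinP|].
  move=> t _ /=; rewrite lee_fin normr_id (ger0_norm (G0 t)) /G.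
  have [b1|b1] := leP 1 `|b0 t|.
    by rewrite (le_trans _ (_ : `|b0 t| `^ rho <= _)) ?le1r_powR// lerDr.
  by rewrite (le_trans (ltW b1))// lerDl powR_ge0.
split=> //; exists (1 + \int[mu]_(u in `]0, T[) G u).
  by rewrite addr_ge0// Rintegral_ge0.
move=> s t s0; rewrite le_eqVlt => /predU1P[<-|st] tT.
  rewrite set_itvoo0 Rintegral_set0 mulr_ge0 ?powR_ge0//.
  by rewrite addr_ge0// Rintegral_ge0.
have h0 : 0 < t - s by rewrite subr_gt0.
have sub : `]s, t[ `<=` (`]0, T[ : set mR).
  move=> u /=; rewrite !in_itv/= => /andP[su ut].
  by rewrite (le_lt_trans s0 su) (lt_le_trans ut tT).
have iGs := integrableS (@measurable_itvR _ _) (@measurable_itvR _ _) sub iG.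
have ias := integrableS (@measurable_itvR _ _) (@measurable_itvR _ _) sub ia.
have ic : mu.-integrable `]s, t[ (EFin \o cst ((t - s) `^ (- al))).
  exact: (@integrable_bounded_itv R s t `|(t - s) `^ (- al)| (cst _)).
have iz : mu.-integrable `]s, t[ (EFin \o (fun u => (t - s) `^ (1 - al) * G u)).
  exact: (integrableZl (@measurable_itvR R _) ((t - s) `^ (1 - al)) iGs).
have iD : mu.-integrable `]s, t[
    (EFin \o (fun u => (t - s) `^ (- al) + (t - s) `^ (1 - al) * G u)).
  exact: (integrableD (@measurable_itvR _ _) ic iz).
apply: (@le_trans _ _ (\int[mu]_(u in `]s, t[)
    ((t - s) `^ (- al) + (t - s) `^ (1 - al) * G u))).
  apply: (le_Rintegral (@measurable_itvR _ _) ias iD) => u _.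
  exact: powR_young.
rewrite (RintegralD (@measurable_itvR _ _) ic iz) (Rintegral_cst_itv _ (ltW st)).
rewrite (RintegralZl _ (@measurable_itvR _ _) iGs).
rewrite mulrDl mul1r; apply: lerD.
  by rewrite powRS// [- al + 1]addrC.
rewrite mulrC ler_wpM2r ?powR_ge0// fine_le//.
- exact: integrable_fin_num iGs.
- exact: integrable_fin_num iG.
- apply: ge0_subset_integral => //; try exact: measurable_itvR.
    by case/integrableP: iG.
  by move=> u _; rewrite lee_fin.
Qed.

Lemma measurable_drift_section (r T : R) (b : R -> (R -> V) -> V) (x : R -> V) i :
  @measurable_fun _ _
    (measurableTypeR R *
       borelType (@Cspace R d (- r) T) (supnorm (- r) T))%type
    (measurableTypeR R)
    (`[0, T] `*` Cspace (- r) T) (fun p => b p.1 p.2 ord0 i) ->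
  Cspace (- r) T x -> measurable_fun `[0, T] (fun s : mR => b s x ord0 i).
Proof.
move=> mb Cx.
(* The whole space is open for its norm, any radius being admissible, hence belongs to the
   generating family. *)
have mC : measurable (Cspace (- r) T :
    set (borelType (@Cspace R d (- r) T) (supnorm (- r) T))).
  apply: sub_sigma_algebra; split => // f Cf; exists 1 => //.
have mp := @pair2_measurable _ _ mR
  (borelType (@Cspace R d (- r) T) (supnorm (- r) T)) x.
apply: (measurable_comp _ _ mb (measurable_funTS mp)).
  by apply: measurableX => //; exact: measurable_itvR.
by move=> _ [s sT <-] /=.
Qed.

Lemma delay_dataP (r T al rho : R) (b : R -> (R -> V) -> V) (eta : R -> V) :
  0 < T -> 0 < r -> 0 < al < 1 -> al^-1 <= rho -> b_assumption r T rho b ->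
  Holder (1 - al) (- r) 0 eta ->
  exists L0 Kb beta0 L Ce E, delay_data r T (1 - al) b eta L0 Kb beta0 L Ce E.
Proof.
move=> T0 r0 /andP[al0 al1] alrho [mb bN [b0 [L [[mb0 ib0] Lp bL bG]]]] etaH.
have mr0 : - r < 0 by rewrite oppr_lt0.
have [Ce [E [Ce0 E0 etaC etaE]]] := Holder_holder_on mr0 etaH.
have al1' : 0 < al <= 1 by rewrite al0 ltW.
have [ib [K K0 KP]] := integral_young al1' alrho mb0 ib0.
have Lge0 N : 0 <= N -> 0 <= L N by move=> /Lp/ltW.
(* The factors [d] compare the Euclidean norm with the maximum norm: a ball of radius [N] for the
   latter lies in one of radius [d N] for the former, and distances grow by at most [d]. *)
exists (L 0 * d%:R), K, (fun t => `|b0 t|), (fun N => L (d%:R * N) * d%:R), Ce, E.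
split=> //; rewrite ?subr_gt0 ?(ltW r0) ?(ltW T0)//.
- by rewrite gerBl ltW.
- by rewrite mulr_ge0// Lge0.
- by move=> N N0; rewrite mulr_ge0// Lge0// mulr_ge0.
- by move=> x i Cx; exact: measurable_drift_section (mb i) Cx.
- move=> N t x y c N0 tT Cx Cy xN yN c0 xyc.
  have dN0 : 0 <= d%:R * N by rewrite mulr_ge0.
  have := bL _ _ _ _ dN0 tT Cx Cy (supnorm_le xN) (supnorm_le yN) => h.
  have h2 : (supnorm (- r) t (x \- y)%R <= (d%:R * c)%:E)%E by exact: supnorm_le.
  have := le_trans h (lee_wpmul2l _ h2); rewrite lee_fin => /(_ (Lge0 _ dN0)).
  by rewrite -EFinM lee_fin mulrA; apply: le_trans; exact: norm_le_enorm.
- move=> t x c tT Cx c0 xc.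
  have h2 : (supnorm (- r) t x <= (d%:R * c)%:E)%E by exact: supnorm_le.
  have := le_trans (bG _ _ tT Cx) (leeD2r _ (lee_wpmul2l _ h2)).
  rewrite lee_fin => /(_ (Lge0 _ (lexx 0))); rewrite -EFinM -EFinD lee_fin mulrA => h.
  apply: (le_trans (norm_le_enorm _)); apply: (le_trans h); rewrite lerD2l.
  exact: ler_norm.
Qed.

End drift_assumption.

Section coefficient_assumption.
Context {R : realType} {d m : nat}.
Local Notation V := 'rV[R]_d.

Lemma noise_dataP (T al be delta H : R) (sigma : R -> V -> 'M[R]_(d, m)) :
  0 < T -> 0 < al < 2^-1 -> al < be -> 1 - H < al -> sigma_assumption T be delta sigma ->
  exists Ms S0, noise_data T al (Num.min be (1 - al)) be ((1 - al + H) / 2) sigma Ms S0.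
Proof.
move=> T0 /andP[al0 al1] albe Hal [_ [_ [M [M0 lip _ tim]]]].
have Mp := M0 0 (lexx 0); have al2 : al < 1 by lra.
(* One constant for both conditions: the bound in space costs a factor [d], the one in time needs a
   factor at least 1, and [d + 1] covers both. The order [(1 - al + H) / 2] in the statement lies
   strictly between [1 - al] and [H], since [1 - H < al]. *)
exists (M 0 * d.+1%:R), (enorm (sigma 0 0)); split.
- by rewrite al0.
- by rewrite lt_min albe; lra.
- by rewrite ge_min lexx.
- by rewrite ge_min lexx orbT.
- by lra.
- by rewrite mulr_ge0// ltW.
- move=> t x y i j tT.
  have -> : sigma t x i j - sigma t y i j = (sigma t x - sigma t y) i j by rewrite !mxE.
  apply: (le_trans (entry_le_enorm _ _ _)); apply: (le_trans (lip _ _ _ tT)).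
  rewrite -mulrA ler_wpM2l ?(ltW Mp)//; apply: (le_trans (enorm_le_norm _)).
  by rewrite ler_wpM2r// ler_nat.
- move=> s t x i j s0 st tT.
  have -> : sigma t x i j - sigma s x i j = (sigma t x - sigma s x) i j by rewrite !mxE.
  apply: (le_trans (entry_le_enorm _ _ _)).
  have sT : 0 <= s <= T by rewrite s0 (le_trans st).
  have tT' : 0 <= t <= T by rewrite tT (le_trans s0).
  have /(le_trans _) h := tim s t x i sT tT'.
  apply: (le_trans (h _ _)); first by rewrite lerDl enorm_ge0.
  rewrite ger0_norm ?subr_ge0// ler_wpM2r ?powR_ge0// ler_peMr ?(ltW Mp)//.
  by rewrite ler1n.
- exact: enorm_ge0.
- by move=> i j; exact: entry_le_enorm.
Qed.

End coefficient_assumption.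

Section solves_path_ode.
Context {R : realType} {d m : nat}.
Local Notation V := 'rV[R]_d.
Local Notation mu := (@lebesgue_measure R).
Local Notation mR := (measurableTypeR R).
Variables (r T al mm be lam : R) (sigma : R -> V -> 'M[R]_(d, m)) (Ms S0 : R).
Variables (b : R -> (R -> V) -> V) (eta : R -> V).
Variables (L0 Kb : R) (beta0 L : R -> R) (Ce E : R).
Hypothesis D : delay_data r T (1 - al) b eta L0 Kb beta0 L Ce E.
Hypothesis DN : noise_data T al mm be lam sigma Ms S0.

Lemma ode_stepE g x t i : 0 < t -> mu.-integrable `]0, t[ (EFin \o (fun s => b s x ord0 i)) ->
  ode_step b eta (noise al r sigma g x) x t ord0 i =
  eta 0 ord0 i + \int[mu]_(s in `[0, t]) b s x ord0 i
  + \sum_j zaehle_int al (fun s => sigma s (x (s - r)) i j) (g j) t.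
Proof.
move=> t0 ib; rewrite /ode_step leNgt t0 /=.
have -> : \int[mu]_(s in `[0, t]) b s x ord0 i = \int[mu]_(s in `]0, t[) b s x ord0 i.
  rewrite (Rintegral_itv_bndo_bndc ib) -Rintegral_itv_obnd_cbnd//.
  apply/integrableP; have /integrableP[mb fb] := ib.
  have mb' : measurable_fun `]0, t] (EFin \o (fun s => b s x ord0 i)).
    exact/emeasurable_fun_itv_bndo_bndcP.
  split=> //; rewrite -integral_itv_bndo_bndc//.
  by apply/measurable_EFinP; apply: measurableT_comp => //; apply/measurable_EFinP.
rewrite [RHS]addrAC.
transitivity (eta 0 ord0 i + noise al r sigma g x t ord0 i + drift b x t ord0 i).
  by rewrite mxE [X in X + _]mxE.
by rewrite noiseE /drift [X in _ + X]mxE.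
Qed.

Lemma solves_path_solves_ode g x : solves_path al r T b sigma eta g x ->
  solves_ode r b eta T (noise al r sigma g x) x.
Proof.
move=> [xeta ib _ _ xE] t /andP[rt tT].
have [t0|t0] := boolP (t <= 0); first by rewrite /ode_step t0 xeta ?rt.
rewrite -ltNge in t0; apply/rowP => i; rewrite ode_stepE//.
  by rewrite xE ?t0.
apply: integrableS (ib i); [exact: measurable_itvR|exact: measurable_itvR|].
by move=> s /=; rewrite !in_itv/= => /andP[/ltW -> /ltW/le_trans->].
Qed.

Lemma solves_ode_solves_path g x (C Cg : R) : 0 <= C -> 0 <= Cg ->
  holder_on (- r) T C (1 - al) x -> (forall j, holder_on 0 T Cg lam (g j)) ->
  solves_ode r b eta T (noise al r sigma g x) x ->
  solves_path al r T b sigma eta g x.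
Proof.
move=> C0 Cg0 xC gC xS; have r0 := dd_r0 D; have T0 := dd_T0 D.
have rT : - r <= T by apply: le_trans T0; rewrite oppr_le0.
have al01 := nd_al DN; have th0 := dd_th0 D.
have Cx := holder_on_Cspace rT C0 th0 xC.
have [N N0 xN] := Cspace_bounded rT Cx.
have ib i : mu.-integrable `]0, T[ (EFin \o (fun s => b s x ord0 i)).
  exact: (drift_integrable D i (lexx 0) (lexx T) Cx N0 xN).
split.
- by move=> t tT; exact: (solves_ode_neg T0 xS).
- move=> i; have mb := dd_bM D i Cx.
  apply/integrableP; split; first exact/measurable_EFinP.
  have /integrableP[mb' fb] := ib i; move: fb; apply: le_lt_trans.
  rewrite [X in (X <= _)%E](@integral_itv_bndoo _ 0 T _ true false)//.
  by apply/measurable_EFinP; apply: measurableT_comp => //; apply/measurable_EFinP.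
- move=> i j; apply: holder_zaehle_integrand (nd_al DN) (nd_alm DN) T0 _
    (coef_holder r0 DN i j C0 xC).
  by rewrite mulr_ge0 ?addr_ge0// (coef_slope_ge0 DN).
- by move=> j; apply: holder_zaehle_integrator (gC j) => //;
    [case/andP: (nd_al DN)|exact: nd_lam DN].
- move=> t i /andP[t0 tT].
  have rtT : - r <= t <= T by rewrite tT andbT (le_trans _ (ltW t0))// oppr_le0.
  rewrite {1}xS// ode_stepE//.
  apply: integrableS (ib i); [exact: measurable_itvR|exact: measurable_itvR|].
  by move=> s /=; rewrite !in_itv/= => /andP[-> /lt_le_trans->].
Qed.

End solves_path_ode.

(** * Sample paths of fractional Brownian motions *)

Section gaussian_moments.
Context {R : realType}.
Local Notation mu := (@lebesgue_measure R).
Local Notation mR := (measurableTypeR R).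

(** [normal_pdf] is almost everywhere the Radon-Nikodym derivative of [normal_prob], as both have
    the same integrals over measurable sets. *)
Lemma ge0_integral_normal_prob (m s : R) (f : mR -> \bar R) :
  measurable_fun setT f -> (forall x, (0 <= f x)%E) ->
  (\int[normal_prob m s]_x f x = \int[mu]_x (f x * (normal_pdf m s x)%:E))%E.
Proof.
move=> mf f0; have dom := normal_prob_dominates m s.
rewrite -(Radon_Nikodym_SigmaFinite.change_of_variables dom)//.
apply: ae_eq_integral => //.
- apply: emeasurable_funM => //.
  exact: measurable_int (Radon_Nikodym_SigmaFinite.f_integrable dom).
- apply: emeasurable_funM => //; apply/measurable_EFinP.
  exact: measurable_normal_pdf.
- apply: ae_eqe_mul2l; apply: integral_ae_eq => //.
  + exact: (Radon_Nikodym_SigmaFinite.f_integrable dom).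
  + by apply/measurable_EFinP; exact: measurable_normal_pdf.
  + by move=> E _ mE; rewrite -(Radon_Nikodym_SigmaFinite.f_integral dom).
Qed.

Local Notation gauss := (@normal_prob R 0 1).

Definition gauss_moment (q : nat) : \bar R :=
  (\int[gauss]_y ((1 + y ^+ 2) ^+ q)%:E)%E.

Lemma measurable_gauss_poly (q : nat) :
  measurable_fun setT (fun y : mR => ((1 + y ^+ 2) ^+ q)%:E : \bar R).
Proof.
apply/measurable_EFinP; apply: measurable_funX; exact: measurable_funD.
Qed.

Lemma expRn_le (n : nat) (u : R) : 0 <= u -> u ^+ n <= n`!%:R * expR u.
Proof.
move=> u0; rewrite mulrC -ler_pdivrMr ?ltr0n ?fact_gt0//.
case: n => [|n]; first by rewrite expr0 fact0 divr1 -expR0 ler_expR.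
by apply: le_trans (expR_ge1Dxn n u0); rewrite lerDr.
Qed.

Lemma gauss_moment_fin q : (gauss_moment q < +oo)%E.
Proof.
rewrite /gauss_moment ge0_integral_normal_prob; first last.
- by move=> y; rewrite lee_fin exprn_ge0// addr_ge0// sqr_ge0.
- exact: measurable_gauss_poly.
(* From [u^q <= q! exp u] at [u = (1 + y^2) / 4]: the product with [exp (- y^2 / 2)] is at most a
   constant times [exp (- y^2 / 4)], which is the Gaussian of variance 2. The peaks account for the
   normalisations. *)
pose c : R := q`!%:R * 4 ^+ q * expR (4^-1) * (normal_peak 1 / normal_peak (Num.sqrt 2)).
have s2 : Num.sqrt 2 != 0 :> R by rewrite gt_eqF// sqrtr_gt0.
have le y : (1 + y ^+ 2) ^+ q * normal_pdf 0 1 y <= c * normal_pdf 0 (Num.sqrt 2) y.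
  rewrite !normal_pdfE ?oner_eq0// /normal_fun.
  have y1 : 0 <= (1 + y ^+ 2) / 4 by rewrite divr_ge0// addr_ge0// sqr_ge0.
  have := expRn_le q y1; rewrite exprMn exprVn ler_pdivrMr ?exprn_gt0// => h.
  have p1 := @normal_peak_gt0 R 1 (oner_neq0 _).
  have p2 := @normal_peak_gt0 R _ s2.
  rewrite subr0 sqr_sqrtr//.
  have -> : c * (normal_peak (Num.sqrt 2) * expR (- y ^+ 2 / (2 *+ 2))) =
      q`!%:R * (expR (4^-1) * expR (- y ^+ 2 / (2 *+ 2))) * 4 ^+ q * normal_peak 1.
    by rewrite /c; field; rewrite gt_eqF.
  rewrite [X in X <= _]mulrCA [X in _ <= X]mulrC ler_wpM2l ?(ltW p1)//.
  apply: (le_trans (ler_wpM2r (expR_ge0 _) h)).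
  rewrite [X in X <= _]mulrAC ler_wpM2r ?exprn_ge0// -mulrA ler_wpM2l//.
  rewrite -!expRD ler_expR le_eqVlt; apply/orP; left; apply/eqP; by field.
apply: (@le_lt_trans _ _ (\int[mu]_y (c%:E * (normal_pdf 0 (Num.sqrt 2) y)%:E)))%E.
  apply: ge0_le_integral_nonmeas => y _.
    by rewrite -EFinM lee_fin mulr_ge0 ?normal_pdf_ge0// exprn_ge0// addr_ge0// sqr_ge0.
  by rewrite -!EFinM lee_fin.
rewrite ge0_integralZl//; first last.
- rewrite lee_fin /c !mulr_ge0 ?expR_ge0 ?exprn_ge0 ?normal_peak_ge0//.
  by rewrite invr_ge0 normal_peak_ge0.
- by move=> y _; rewrite lee_fin normal_pdf_ge0.
- by apply/measurable_EFinP; exact: measurable_normal_pdf.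
by rewrite integral_normal_pdf mule1 ltry.
Qed.

(** On [[u, v]] the density is at least its value at [|u| + |v|]. *)
Lemma gauss_itv_gt0 (u v : R) : u < v -> (0 < gauss `[u, v])%E.
Proof.
move=> uv; rewrite /normal_prob.
pose c := normal_pdf 0 1 (`|u| + `|v|).
have c0 : 0 < c.
  by rewrite /c normal_pdfE ?oner_eq0// mulr_gt0 ?normal_peak_gt0 ?oner_eq0// expR_gt0.
apply: (@lt_le_trans _ _ (\int[mu]_(y in `[u, v]) (cst c%:E y))%E).
  rewrite integral_cst /=; last exact: measurable_itvR.
  by rewrite lebesgue_measure_itv/= lte_fin uv -EFinB -EFinM lte_fin mulr_gt0// subr_gt0.
apply: ge0_le_integral_nonmeas => y; rewrite /= in_itv/= => /andP[uy yv].
  by rewrite lee_fin ltW.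
rewrite lee_fin /c !normal_pdfE ?oner_eq0// ler_wpM2l ?normal_peak_ge0//.
rewrite ler_expR !subr0 ler_wpM2r ?invr_ge0// lerN2.
rewrite -[y ^+ 2]real_normK ?num_real// ler_sqr ?nnegrE ?addr_ge0//.
rewrite ler_norml; have := ler_norm (- u); have := ler_norm v; have := normr_ge0 u.
have := normr_ge0 v; rewrite normrN; move: uy yv.
by move=> h1 h2 h3 h4 h5 h6; apply/andP; split; lra.
Qed.

End gaussian_moments.

Section gaussian_law_moments.
Context {R : realType} {dO : measure_display} {Omega : measurableType dO}.
Variable P : probability Omega R.
Local Notation mR := (measurableTypeR R).
Local Notation gauss := (@normal_prob R 0 1).
Local Notation mu := (@lebesgue_measure R).

(* Both the degenerate and the nondegenerate Gaussian laws are images of the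
   standard one under an affine map. *)
Lemma gaussian_law_affine (X : Omega -> R) : gaussian_law P X ->
  exists m s, forall f : R -> \bar R, measurable_fun setT f ->
    (forall x, (0 <= f x)%E) ->
    (\int[P]_w f (X w) = \int[gauss]_y f (m + s * y)%R)%E.
Proof.
move=> [mX [m [s [s0 law]]]]; exists m, s => f mf f0.
have mphi : measurable_fun [set: mR] (fun y : mR => m + s * y : mR).
  by apply: measurable_funD => //; exact: measurable_funM.
have E B : measurable B -> P (X @^-1` B) = gauss ((fun y : mR => m + s * y : mR) @^-1` B).
  move=> mB; rewrite law//; have [->|sn0] := eqVneq s 0.
    rewrite diracE; have [mB'|mB'] := boolP (m \in B).
      rewrite (_ : _ @^-1` B = setT) ?probability_setT//.
      by apply/seteqP; split => // y _ /=; rewrite mul0r addr0; exact: set_mem.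
    rewrite (_ : _ @^-1` B = set0) ?measure0//.
    apply/seteqP; split => // y /=; rewrite mul0r addr0 => /mem_set.
    by rewrite (negbTE mB').
  have s_gt0 : 0 < s by rewrite lt_neqAle eq_sym sn0.
  rewrite /normal_prob.
  have mp (a c : R) : measurable_fun setT (fun x : mR => (normal_pdf a c x)%:E).
    by apply/measurable_EFinP; exact: measurable_normal_pdf.
  rewrite (ge0_integral_scale m s_gt0 mB (mp m s)); last first.
    by move=> x; rewrite lee_fin normal_pdf_ge0.
  have mphiB : measurable ((fun x : mR => m + s * x : mR) @^-1` B).
    by rewrite -[X in measurable X]setTI; exact: mphi.
  have mpphi : measurable_fun ((fun x : mR => m + s * x : mR) @^-1` B)
      (fun x : mR => (normal_pdf m s (m + s * x))%:E).
    by apply: measurable_funTS; exact: measurableT_comp (mp m s) mphi.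
  have pphi0 (x : mR) : ((fun x : mR => m + s * x : mR) @^-1` B) x ->
      (0 <= (normal_pdf m s (m + s * x))%:E)%E.
    by rewrite lee_fin normal_pdf_ge0.
  rewrite -(ge0_integralZl mu mphiB mpphi pphi0); last by rewrite lee_fin ltW.
  apply: eq_integral => y _; rewrite -EFinM; congr EFin.
  rewrite !normal_pdfE ?oner_eq0// /normal_fun mulrA; congr (_ * _).
    rewrite /normal_peak expr1n mul1r -mulrnAr sqrtrM ?sqr_ge0// sqrtr_sqr.
    by rewrite (ger0_norm s0) invfM mulrA divff// mul1r.
  apply: (congr1 expR); have -> : m + s * y - m = s * y by ring.
  by rewrite subr0; field.
have f0' : {in setT, forall y, (0 <= f y)%E} by move=> y _.
have e1 := @ge0_integral_pushforward _ _ Omega mR R _ mX P _ _ measurableT mf f0'.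
have e2 := @ge0_integral_pushforward _ _ mR mR R _ mphi gauss _ _ measurableT mf f0'.
transitivity (\int[P]_(w in X @^-1` setT) (f \o X) w)%E; first by rewrite preimage_setT.
rewrite -e1; move: e2; rewrite preimage_setT => e2; apply: etrans e2.
apply: eq_measure_integral => B mB _; exact: E.
Qed.

(** With [X] distributed as [m + s Y], [Y] standard, the second moment dominates [c (m^2 + s^2)],
    while [X^(2 q)] is at most [2^q (m^2 + s^2)^q (1 + Y^2)^q]. This avoids computing the mean and
    variance, and the constant is the same for all Gaussian laws. *)
Lemma gaussian_law_moment (q : nat) : exists2 C : R, 0 <= C &
  forall X : Omega -> R, gaussian_law P X -> forall v : R,
    (\int[P]_w (X w ^+ 2)%:E = v%:E)%E ->
    (\int[P]_w (X w ^+ (2 * q))%:E <= (C * v ^+ q)%:E)%E.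
Proof.
pose c := Num.min (fine (gauss `[1%R, 2%R])) (fine (gauss `[(- 2)%R, (- 1)%R])).
have g12 : (0 < gauss `[1%R, 2%R])%E by apply: gauss_itv_gt0; rewrite ltr1n.
have g21 : (0 < gauss `[(- 2)%R, (- 1)%R])%E.
  by apply: gauss_itv_gt0; rewrite ltrN2 ltr1n.
have gfin A : measurable A -> gauss A \is a fin_num by move=> mA; exact: fin_num_measure.
have c0 : 0 < c.
  by rewrite lt_min !fine_gt0// ?g12 ?g21/= ltey_eq gfin//; exact: measurable_itvR.
have M0 : (0 <= @gauss_moment R q)%E.
  by apply: integral_ge0 => y _; rewrite lee_fin exprn_ge0// addr_ge0// sqr_ge0.
have Mfin : @gauss_moment R q \is a fin_num.
  by rewrite ge0_fin_numE// gauss_moment_fin.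
exists (2 ^+ q * fine (@gauss_moment R q) / c ^+ q).
  by rewrite divr_ge0 ?exprn_ge0 ?(ltW c0)// mulr_ge0 ?exprn_ge0// fine_ge0.
move=> X /gaussian_law_affine [m [s law]] v v2.
have mp k : measurable_fun setT (fun y : mR => (y ^+ k)%:E : \bar R).
  by apply/measurable_EFinP; exact: measurable_funX.
have low : c * (m ^+ 2 + s ^+ 2) <= v.
  have E2 : (\int[gauss]_y ((m + s * y) ^+ 2)%:E = v%:E)%E.
    have p2 (y : R) : (0 <= (y ^+ 2)%:E)%E by rewrite lee_fin sqr_ge0.
    by rewrite -v2 (law _ (mp 2%N) p2).
  (* On a set where [y^2 >= 1] and [m s y >= 0], the square [(m + s y)^2] is at least [m^2 + s^2].
     One of [[1, 2]] and [[-2, -1]] has this property, according to the sign of [m s]; [c] is the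
     smaller of their masses. *)
  have K (a b : R) : (forall y, a <= y <= b -> 0 <= m * s * y /\ 1 <= y ^+ 2) ->
      fine (gauss `[a, b]) * (m ^+ 2 + s ^+ 2) <= v.
    move=> ab; have mab : measurable (`[a, b] : set mR) by exact: measurable_itvR.
    rewrite -lee_fin EFinM fineK ?gfin// -E2.
    have mm : measurable_fun setT (fun y : mR => ((m + s * y) ^+ 2)%:E : \bar R).
      apply/measurable_EFinP; apply: measurable_funX; exact: measurable_funD.
    apply: (@le_trans _ _ (\int[gauss]_(y in `[a, b]) ((m + s * y) ^+ 2)%:E)%E); last first.
      apply: ge0_subset_integral => // y _; rewrite lee_fin sqr_ge0//.
    apply: (@le_trans _ _ (\int[gauss]_(y in `[a, b]) (cst (m ^+ 2 + s ^+ 2)%:E y))%E).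
      by rewrite integral_cst//= muleC.
    apply: ge0_le_integral_nonmeas => y; rewrite /= in_itv/=.
      by rewrite lee_fin addr_ge0// sqr_ge0.
    move=> /ab [h1 h2]; rewrite lee_fin.
    have -> : (m + s * y) ^+ 2 = m ^+ 2 + 2 * (m * s * y) + s ^+ 2 * y ^+ 2 by ring.
    apply: lerD; first by rewrite lerDl mulr_ge0.
    by rewrite ler_peMr// sqr_ge0.
  have [ms|ms] := leP 0 (m * s).
    apply: (le_trans _ (K 1 2 _)).
      by rewrite ler_wpM2r ?addr_ge0 ?sqr_ge0// ge_min lexx.
    move=> y /andP[y1 y2]; rewrite mulr_ge0 ?exprn_ege1//.
    by rewrite (le_trans _ y1).
  apply: (le_trans _ (K (- 2) (- 1) _)).
    by rewrite ler_wpM2r ?addr_ge0 ?sqr_ge0// ge_min lexx orbT.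
  move=> y /andP[y1 y2]; rewrite mulr_le0 ?(ltW ms)//; last first.
    by rewrite (le_trans y2)// oppr_le0.
  by rewrite -sqrrN exprn_ege1// lerNr.
have v0 : 0 <= v by apply: le_trans low; rewrite mulr_ge0 ?(ltW c0)// addr_ge0// sqr_ge0.
have p2q (y : R) : (0 <= (y ^+ (2 * q))%:E)%E.
  by rewrite lee_fin exprM exprn_ge0// sqr_ge0.
rewrite (law _ (mp (2 * q)%N) p2q).
set w := m ^+ 2 + s ^+ 2 in low.
have w0 : 0 <= w by rewrite addr_ge0// sqr_ge0.
apply: (@le_trans _ _ (\int[gauss]_y ((2 ^+ q * w ^+ q)%:E * ((1 + y ^+ 2) ^+ q)%:E))%E).
  apply: ge0_le_integral_nonmeas => y _.
    by rewrite lee_fin exprM exprn_ge0// sqr_ge0.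
  rewrite -EFinM lee_fin exprM -!exprMn; apply: lerXn2r; rewrite ?nnegrE ?sqr_ge0//; last first.
    rewrite /w; have := sqr_ge0 (m - s * y); have := sqr_ge0 (m * y).
    have := sqr_ge0 s; nra.
  by rewrite !mulr_ge0 ?addr_ge0 ?sqr_ge0.
have wq0 : 0 <= 2 ^+ q * w ^+ q by rewrite mulr_ge0 ?exprn_ge0.
have poly0 (y : R) : setT y -> (0 <= ((1 + y ^+ 2) ^+ q)%:E)%E.
  by move=> _; rewrite lee_fin exprn_ge0// addr_ge0// sqr_ge0.
rewrite (ge0_integralZl _ measurableT (measurable_gauss_poly q) poly0); last by rewrite lee_fin.
rewrite -/(gauss_moment q) -(fineK Mfin) -EFinM lee_fin.
have -> : 2 ^+ q * fine (gauss_moment q) / c ^+ q * v ^+ q =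
  2 ^+ q * (v / c) ^+ q * fine (@gauss_moment R q).
  by rewrite expr_div_n; field; rewrite expf_neq0// gt_eqF.
rewrite ler_wpM2r ?fine_ge0// ler_wpM2l ?exprn_ge0//.
by apply: lerXn2r; rewrite ?nnegrE// ?divr_ge0 ?(ltW c0)// ler_pdivlMr// mulrC.
Qed.

End gaussian_law_moments.

Section fBm_increments.
Context {R : realType} {dO : measure_display} {Omega : measurableType dO}.
Variable P : probability Omega R.
Local Notation mR := (measurableTypeR R).

Lemma gaussian_law_sqr_integrable (X : Omega -> R) : gaussian_law P X ->
  P.-integrable setT (fun w => (X w ^+ 2)%:E).
Proof.
move=> gX; have [mX _] := gX; have [m [s law]] := gaussian_law_affine gX.
have mX2 : measurable_fun setT (fun w => X w ^+ 2) by exact: measurable_funX.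
apply/integrableP; split; first exact/measurable_EFinP.
under eq_integral do rewrite gee0_abs ?lee_fin ?sqr_ge0//.
have p2 (y : R) : (0 <= (y ^+ 2)%:E)%E by rewrite lee_fin sqr_ge0.
have mp : measurable_fun setT (fun y : mR => (y ^+ 2)%:E : \bar R).
  by apply/measurable_EFinP; exact: measurable_funX.
rewrite (law _ mp p2).
have w0 : 0 <= 2 * (m ^+ 2 + s ^+ 2) by rewrite mulr_ge0// addr_ge0// sqr_ge0.
have poly0 (y : R) : setT y -> (0 <= ((1 + y ^+ 2) ^+ 1)%:E)%E.
  by move=> _; rewrite lee_fin expr1 addr_ge0// sqr_ge0.
apply: (@le_lt_trans _ _ (\int[normal_prob 0 1]_y
    ((2 * (m ^+ 2 + s ^+ 2))%:E * ((1 + y ^+ 2) ^+ 1)%:E))%E).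
  apply: ge0_le_integral_nonmeas => y _; first exact: p2.
  rewrite -EFinM lee_fin expr1.
  have := sqr_ge0 (m - s * y); have := sqr_ge0 (m * y).
  have := sqr_ge0 s; nra.
rewrite (ge0_integralZl _ measurableT (measurable_gauss_poly 1) poly0); last by rewrite lee_fin.
have M0 : (0 <= @gauss_moment R 1)%E by apply: integral_ge0 => y _; exact: poly0.
have Mfin : @gauss_moment R 1 \is a fin_num by rewrite ge0_fin_numE// gauss_moment_fin.
by rewrite -/(gauss_moment 1) -(fineK Mfin) -EFinM ltry.
Qed.

Lemma gaussian_process_law T (B : R -> Omega -> R) t : gaussian_process P T B ->
  0 <= t <= T -> gaussian_law P (B t).
Proof.
move=> /(_ 1%N (fun=> t) (fun=> 1)) h tT; have := h (fun=> tT).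
by congr gaussian_law; apply/funext => w; rewrite big_ord1 mul1r.
Qed.

Lemma gaussian_process_increment T (B : R -> Omega -> R) s t : gaussian_process P T B ->
  0 <= s <= T -> 0 <= t <= T -> gaussian_law P (fun w => B t w - B s w).
Proof.
move=> /(_ 2%N (fun i => if i == ord0 then t else s)
  (fun i => if i == ord0 then 1 else - 1)) h sT tT.
have {}h := h (fun i => if i == ord0 as b return 0 <= (if b then t else s) <= T then tT else sT).
have -> // : (fun w => B t w - B s w) = (fun w => \sum_(k < 2)
    (if k == ord0 then 1 else - 1) * B (if k == ord0 then t else s) w).
by apply/funext => w; rewrite big_ord_recl big_ord1/= mul1r mulN1r.
Qed.

Lemma integral_mul_centered (X Y : Omega -> R) : ('E_P[X] = 0)%E -> ('E_P[Y] = 0)%E ->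
  covariance P X Y = (\int[P]_w (X w * Y w)%:E)%E.
Proof.
move=> X0 Y0; rewrite unlock X0 Y0 /= unlock; apply: eq_integral => w _.
by transitivity ((X w - 0) * (Y w - 0))%:E => //; rewrite !subr0.
Qed.

Lemma fBm_increment_sqr H T (B : R -> Omega -> R) s t : 0 < H -> is_fBm P H T B ->
  0 <= s <= T -> 0 <= t <= T ->
  (\int[P]_w ((B t w - B s w) ^+ 2)%:E = (`|t - s| `^ (2 * H))%:E)%E.
Proof.
move=> H0 [gB EB cB _] sT tT.
have iX u : 0 <= u <= T -> P.-integrable setT (fun w => (B u w ^+ 2)%:E).
  by move=> uT; apply: gaussian_law_sqr_integrable; exact: gaussian_process_law gB uT.
have mB u : 0 <= u <= T -> measurable_fun setT (B u).
  by move=> uT; have [] := gaussian_process_law gB uT.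
have cv u v : 0 <= u <= T -> 0 <= v <= T -> (\int[P]_w (B u w * B v w)%:E =
    ((u `^ (2 * H) + v `^ (2 * H) - `|v - u| `^ (2 * H)) / 2)%:E)%E.
  by move=> uT vT; rewrite -cB// integral_mul_centered ?EB.
have vr u : 0 <= u <= T -> (\int[P]_w (B u w ^+ 2)%:E = (u `^ (2 * H))%:E)%E.
  move=> uT; under eq_integral do rewrite expr2.
  rewrite cv// subrr normr0 powR0 ?mulf_neq0 ?gt_eqF// subr0.
  by congr EFin; field.
have iXY : P.-integrable setT (fun w => (B s w * B t w)%:E).
  have iS := integrableD measurableT (iX s sT) (iX t tT).
  apply: (le_integrable measurableT) iS.
    by apply/measurable_EFinP; apply: measurable_funM; exact: mB.
  move=> w _; rewrite -EFinD /= lee_fin normrM.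
  rewrite [X in _ <= X]ger0_norm ?addr_ge0 ?sqr_ge0//.
  rewrite -[B s w ^+ 2]real_normK ?num_real// -[B t w ^+ 2]real_normK ?num_real//.
  have := normr_ge0 (B s w); have := normr_ge0 (B t w).
  move: `|B s w| `|B t w| => a c; have := sqr_ge0 (a - c); nra.
have iM2 : P.-integrable setT (fun w => (- 2 * (B s w * B t w))%:E).
  exact: (integrableZl measurableT (- 2) iXY).
transitivity (\int[P]_w ((B s w ^+ 2)%:E + (B t w ^+ 2)%:E + (- 2 * (B s w * B t w))%:E))%E.
  by apply: eq_integral => w _; rewrite -!EFinD; congr EFin; ring.
have iS := integrableD measurableT (iX s sT) (iX t tT).
rewrite (integralD measurableT iS iM2) (integralD measurableT (iX s sT) (iX t tT)).
have -> : (\int[P]_w (- 2 * (B s w * B t w))%:E)%E =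
    ((- 2)%:E * \int[P]_w (B s w * B t w)%:E)%E.
  exact: (integralZl measurableT iXY).
by rewrite !vr// cv// -EFinM -!EFinD; congr EFin; field.
Qed.

Lemma fBm_increment_moment H T (B : R -> Omega -> R) (q : nat) : 0 < H ->
  is_fBm P H T B -> exists2 C : R, 0 <= C & forall s t, 0 <= s <= T -> 0 <= t <= T ->
    (\int[P]_w ((B t w - B s w) ^+ (2 * q))%:E <= (C * (`|t - s| `^ (2 * H)) ^+ q)%:E)%E.
Proof.
move=> H0 fB; have [C C0 h] := gaussian_law_moment P q; exists C => // s t sT tT.
have [gB _ _ _] := fB.
exact: (h _ (gaussian_process_increment gB sT tT) _ (fBm_increment_sqr H0 fB sT tT)).
Qed.

End fBm_increments.

(** * Dyadic chaining *)

Section dyadic_chaining.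
Context {R : realType}.

Lemma powR2_lt1 (p : R) : p < 0 -> 2 `^ p < 1.
Proof.
by move=> p0; rewrite /powR pnatr_eq0/= expR_lt1 nmulr_rlt0// ln_gt0// ltr1n.
Qed.

Let dy (t : R) (n : nat) : nat := Num.trunc (2 ^+ n * t).

Let dyP t n : 0 <= t -> (dy t n)%:R <= 2 ^+ n * t < (dy t n).+1%:R.
Proof. by move=> t0; apply: Num.Theory.truncn_itv; rewrite mulr_ge0// exprn_ge0. Qed.

(** The next dyadic approximation from below is either the same point or its right neighbour on the
    finer grid, so a refinement costs at most one dyadic increment. *)
Lemma truncn_double t n : 0 <= t -> dy t n.+1 = (dy t n).*2 \/ dy t n.+1 = (dy t n).*2.+1.
Proof.
move=> t0; have /andP[h1 h2] := dyP n t0; have /andP[h3 h4] := dyP n.+1 t0.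
have a1 : ((dy t n).*2 < (dy t n.+1).+1)%N.
  rewrite -(@ltr_nat R) (le_lt_trans _ h4)// exprS -mulrA -mul2n natrM.
  by rewrite ler_wpM2l.
have a2 : (dy t n.+1 < (dy t n).+1.*2)%N.
  rewrite -(@ltr_nat R) (le_lt_trans h3)// exprS -mulrA -mul2n natrM.
  by rewrite ltr_pM2l.
by lia.
Qed.

Lemma truncn_scale_cvg t : 0 <= t -> (fun n => (dy t n)%:R / 2 ^+ n : R) @ \oo --> t.
Proof.
move=> t0; have h n : `|t - (dy t n)%:R / 2 ^+ n| <= 1 / 2 ^+ n.
  have /andP[h1 h2] := dyP n t0; have p0 : 0 < 2 ^+ n :> R by rewrite exprn_gt0.
  rewrite ger0_norm; last by rewrite subr_ge0 ler_pdivrMr// mulrC.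
  rewrite lerBlDr -mulrDl ler_pdivlMr// mulrC ltW// (lt_le_trans h2)//.
  by rewrite -[(dy t n).+1]addn1 natrD addrC.
apply/cvgrPdist_le => e e0.
have /cvgrPdist_le /(_ _ e0) : (fun n => (2^-1 : R) ^+ n) @ \oo --> (0 : R).
  by apply: cvg_expr; rewrite ger0_norm ?invr_ge0// invf_lt1// ltr1n.
apply: filterS => n; rewrite sub0r normrN ger0_norm ?exprn_ge0 ?invr_ge0// => hn.
by apply: (le_trans (h n)); rewrite div1r -exprVn.
Qed.

(** With [r = 2^-lam]: 1 for the increment between the approximations of the two times at a common
    level, [r / (1 - r)] for each of the two geometric tails, and [2^lam] from
    [2^-n < 2 (t - s)]. *)
Definition chaining_const (lam : R) : R :=
  (1 + 2 * (2 `^ (- lam) / (1 - 2 `^ (- lam)))) * 2 `^ lam.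

Lemma chaining_const_ge0 lam : 0 < lam -> 0 <= chaining_const lam.
Proof.
move=> l0; rewrite mulr_ge0 ?powR_ge0// addr_ge0// mulr_ge0// divr_ge0 ?powR_ge0//.
rewrite subr_ge0 -[X in _ <= X](powRr0 2); apply: ler_powR; first by rewrite ler1n.
by rewrite oppr_le0 ltW.
Qed.

Lemma dyadic_holder (lam A : R) (y : R -> R) : 0 < lam -> 0 <= A ->
  {within `[0, 1], continuous y} ->
  (forall n k : nat, (k < 2 ^ n)%N ->
     `|y (k.+1%:R / 2 ^+ n) - y (k%:R / 2 ^+ n)| <= A * (2 `^ (- lam)) ^+ n) ->
  holder_on 0 1 (chaining_const lam * A) lam y.
Proof.
move=> l0 A0 yc yA; set r := 2 `^ (- lam).
have r0 : 0 < r by rewrite powR_gt0.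
have r1 : r < 1.
  by apply: powR2_lt1; rewrite oppr_lt0.
have r1' : 0 < 1 - r by rewrite subr_gt0.
pose c := r / (1 - r); have c0 : 0 <= c by rewrite divr_ge0 ?ltW.
have p_gt0 n : 0 < 2 ^+ n :> R by rewrite exprn_gt0.
have p_neq0 n : 2 ^+ n != 0 :> R by rewrite gt_eqF.
have dle t n : 0 <= t <= 1 -> (dy t n <= 2 ^ n)%N.
  move=> /andP[t0 t1]; have /andP[h _] := dyP n t0.
  by rewrite -(ler_nat R) (le_trans h)// natrX ler_piMr// exprn_ge0.
have step t n : 0 <= t <= 1 ->
    `|y ((dy t n.+1)%:R / 2 ^+ n.+1) - y ((dy t n)%:R / 2 ^+ n)| <= A * r ^+ n.+1.
  move=> t01; have /andP[t0 t1] := t01.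
  have e : (dy t n)%:R / 2 ^+ n = ((dy t n).*2)%:R / 2 ^+ n.+1 :> R.
    by rewrite -mul2n natrM exprS; field.
  rewrite e; case: (truncn_double n t0) => h; rewrite h.
    by rewrite subrr normr0 mulr_ge0// exprn_ge0// ltW.
  by apply: yA; have := dle t n.+1 t01; rewrite h.
(* The partial geometric sum is kept in closed form, so the induction step is an identity. *)
have tail t n m : 0 <= t <= 1 ->
    `|y ((dy t (n + m))%:R / 2 ^+ (n + m)) - y ((dy t n)%:R / 2 ^+ n)| <=
    A * r ^+ n * (c * (1 - r ^+ m)).
  move=> t01; elim: m => [|m IHm].
    by rewrite addn0 subrr normr0 expr0 subrr !mulr0.
  rewrite addnS -(subrKA (y ((dy t (n + m))%:R / 2 ^+ (n + m)))).
  rewrite (le_trans (ler_normD _ _))// (le_trans (lerD (step t (n + m)%N t01) IHm))//.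
  rewrite le_eqVlt; apply/orP; left; apply/eqP.
  by rewrite /c !exprS exprD; field; rewrite gt_eqF.
have approx t n : 0 <= t <= 1 -> `|y t - y ((dy t n)%:R / 2 ^+ n)| <= A * r ^+ n * c.
  move=> t01; have /andP[t0 t1] := t01.
  have yt : (fun m => y ((dy t (n + m))%:R / 2 ^+ (n + m)) - y ((dy t n)%:R / 2 ^+ n))
      @ \oo --> y t - y ((dy t n)%:R / 2 ^+ n).
    apply: cvgB; last exact: cvg_cst.
    have /subspace_continuousP yc' := yc.
    have tin : `[0, 1]%classic t by rewrite /= in_itv/= t0.
    apply: cvg_comp (yc' t tin).
    pose f k : R := (dy t k)%:R / 2 ^+ k.
    have ut : (fun m => f (m + n)%N) @ \oo --> t.
      by rewrite (cvg_shiftn n f); exact: truncn_scale_cvg.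
    move=> B hB; change (\forall m \near \oo, B (f (n + m)%N)).
    have h0 : \forall m \near \oo, `[0, 1]%classic (f (m + n)%N) -> B (f (m + n)%N).
      exact: ut hB.
    apply: filterS h0 => m; rewrite addnC; apply; rewrite /f /=.
    rewrite in_itv/= divr_ge0 ?exprn_ge0// ler_pdivrMr// mul1r -natrX ler_nat.
    exact: dle.
  apply: (norm_le_limit yt) => m; apply: (le_trans (tail t n m t01)).
  rewrite ler_wpM2l ?mulr_ge0 ?exprn_ge0 ?(ltW r0)// ler_piMr// gerBl.
  by rewrite exprn_ge0// ltW.
move=> s t s0 st t1; move: st; rewrite le_eqVlt => /predU1P[<-|st].
  by rewrite !subrr normr0 mulr_ge0 ?powR_ge0// mulr_ge0// chaining_const_ge0.
have s01 : 0 <= s <= 1 by rewrite s0 (le_trans (ltW st)).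
have t01 : 0 <= t <= 1 by rewrite t1 (le_trans s0 (ltW st)).
(* The last level with mesh at least [t - s]: there the dyadic floors of [s] and [t] coincide or are
   neighbours, while [2^-n] is still comparable to [t - s]. The minimal level beyond it is not 0
   because [t - s <= 1]. *)
have [n [n1 n2]] : exists n : nat, 2 ^+ n * (t - s) <= 1 /\ 1 < 2 ^+ n.+1 * (t - s).
  have h0 : 0 < t - s by rewrite subr_gt0.
  have ex : exists N : nat, 1 < 2 ^+ N * (t - s).
    exists (Num.trunc (t - s)^-1).+1; rewrite -ltr_pdivrMr// div1r.
    apply: lt_trans (Num.Theory.truncnS_gt _) _.
    by rewrite -natrX ltr_nat ltn_expl.
  case: (ex_minnP ex) => -[|n] hn hmin.
    by move: hn; rewrite expr0 mul1r => hn; exfalso; move: hn; rewrite ltNge lerBlDr (le_trans t1)// lerDl.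
  exists n; split=> //; rewrite leNgt; apply/negP => /hmin.
  by rewrite ltnn.
have dst : dy t n = dy s n \/ dy t n = (dy s n).+1.
  have /andP[h1 h2] := @dyP s n s0; have /andP[h3 h4] : (dy t n)%:R <= 2 ^+ n * t < (dy t n).+1%:R.
    by apply: dyP; case/andP: t01.
  have a1 : (dy s n < (dy t n).+1)%N.
    by rewrite -(@ltr_nat R) (le_lt_trans h1)// (lt_trans _ h4)// ltr_pM2l.
  have a2 : (dy t n < (dy s n).+2)%N.
    rewrite -(@ltr_nat R) (le_lt_trans h3)// -[(dy s n).+2]addn1 natrD.
    by move: n1 h2; rewrite mulrBr; lra.
  by move: (dy t n) (dy s n) a1 a2 => k l; clear; lia.
have mid : `|y ((dy t n)%:R / 2 ^+ n) - y ((dy s n)%:R / 2 ^+ n)| <= A * r ^+ n.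
  case: dst => h; rewrite h; first by rewrite subrr normr0 mulr_ge0// exprn_ge0// ltW.
  by apply: yA; have := dle t n t01; rewrite h.
have ht := approx t n t01; have hs := approx s n s01.
apply: (@le_trans _ _ (A * r ^+ n * (1 + 2 * c))).
  move: ht hs mid; set yt := y t; set ys := y s; set u := y (_ / _); set v := y (_ / _).
  move=> h1 h2 h3; have -> : yt - ys = (yt - u) + (u - v) - (ys - v) by ring.
  rewrite (le_trans (ler_normB _ _))// (le_trans (lerD (ler_normD _ _) (lexx _)))//.
  by move: h1 h2 h3; lra.
have rn : r ^+ n <= 2 `^ lam * (t - s) `^ lam.
  have -> : r ^+ n = ((2 ^+ n)^-1) `^ lam.
    rewrite -[in RHS]powR_mulrn// -powRN -powRrM -powR_mulrn ?powR_ge0// -powRrM.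
    by rewrite mulNr mulrC mulNr.
  rewrite -powRM ?subr_ge0 ?(ltW st)//; apply: ge0_ler_powR; rewrite ?nnegrE ?(ltW l0)//.
  - by rewrite mulr_ge0// subr_ge0 ltW.
  - by rewrite -[X in X <= _]div1r ler_pdivrMr// mulrAC -exprS ltW.
rewrite /chaining_const -/r -/c.
have -> : (1 + 2 * c) * 2 `^ lam * A * (t - s) `^ lam =
  A * (2 `^ lam * (t - s) `^ lam) * (1 + 2 * c) by ring.
apply: ler_wpM2r; first by rewrite addr_ge0// mulr_ge0.
exact: ler_wpM2l.
Qed.

End dyadic_chaining.

Section kolmogorov.
Context {R : realType} {dO : measure_display} {Omega : measurableType dO}.
Variable P : probability Omega R.

Lemma nneseries_le_bound (u : nat -> \bar R) (M : \bar R) : (forall n, (0 <= u n)%E) ->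
  (forall N, (\sum_(0 <= n < N) u n <= M)%E) -> (\sum_(0 <= n <oo) u n <= M)%E.
Proof.
move=> u0 uM; apply: lime_le; first by apply: is_cvg_nneseries => n _ _; exact: u0.
by apply: nearW => N; exact: uM.
Qed.

Lemma geometric_sum_le (c a : R) N : 0 <= c -> 0 <= a < 1 ->
  \sum_(0 <= n < N) c * a ^+ n <= c / (1 - a).
Proof.
move=> c0 /andP[a0 a1]; have a1' : 0 < 1 - a by rewrite subr_gt0.
rewrite -mulr_sumr ler_wpM2l// -div1r ler_pdivlMr// mulrC big_mkord.
by rewrite -[1 - a]opprB mulNr -subrX1 opprB gerBl exprn_ge0.
Qed.

(** The weight [2^(lam n)] is the inverse of the increment allowed at level [n], so a bound on the
    energy is a chaining hypothesis for every increment of that level. *)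
Definition dyadic_energy (T lam : R) (q : nat) (B : R -> Omega -> R) (n : nat) (w : Omega) : R :=
  \sum_(k < 2 ^ n) ((2 `^ lam) ^+ n *
    (B (T * (k.+1%:R / 2 ^+ n)) w - B (T * (k%:R / 2 ^+ n)) w)) ^+ (2 * q).

Lemma dyadic_energy_ge0 T lam q B n w : 0 <= dyadic_energy T lam q B n w.
Proof.
by apply: sumr_ge0 => k _; rewrite exprM exprn_ge0// sqr_ge0.
Qed.

Lemma dyadic_energy_le T lam q B n w (k : nat) : (0 < q)%N -> (k < 2 ^ n)%N -> forall A : R,
  0 <= A -> dyadic_energy T lam q B n w <= A ->
  `|B (T * (k.+1%:R / 2 ^+ n)) w - B (T * (k%:R / 2 ^+ n)) w| <=
    A `^ ((2 * q)%:R^-1) * (2 `^ (- lam)) ^+ n.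
Proof.
move=> q0 kn A A0 EA; set D := _ - _.
have p0 : 0 < (2 `^ lam) ^+ n :> R by rewrite exprn_gt0// powR_gt0.
have q2 : (0 < 2 * q)%N by rewrite muln_gt0.
have h : (2 `^ lam ^+ n * `|D|) ^+ (2 * q) <= A.
  apply: le_trans EA; rewrite -[X in X * `|D|](ger0_norm (ltW p0)) -normrM.
  have -> : `|2 `^ lam ^+ n * D| ^+ (2 * q) = (2 `^ lam ^+ n * D) ^+ (2 * q).
    by rewrite !exprM real_normK ?num_real.
  rewrite /dyadic_energy (bigD1 (Ordinal kn))//= lerDl.
  by apply: sumr_ge0 => j _; rewrite exprM exprn_ge0// sqr_ge0.
have -> : (2 `^ (- lam)) ^+ n = (2 `^ lam ^+ n)^-1 by rewrite powRN exprVn.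
rewrite ler_pdivlMr// mulrC.
have h0 : 0 <= 2 `^ lam ^+ n * `|D| by rewrite mulr_ge0// ltW.
rewrite -[X in X <= _](powRr1 h0) -[X in _ `^ X <= _](@divff _ (2 * q)%:R); last first.
  by rewrite pnatr_eq0 -lt0n.
rewrite powRrM powR_mulrn//; apply: ge0_ler_powR; rewrite ?nnegrE ?exprn_ge0// ltW//.
Qed.

Lemma dyadic_continuous (T : R) (x : R -> R) : 0 <= T ->
  {within `[0, T], continuous x} -> {within `[0, 1], continuous (fun u => x (T * u))}.
Proof.
move=> T0 /subspace_continuousP xc; apply/subspace_continuousP => u u01.
have u01' : 0 <= u <= 1 by move: u01; rewrite /= in_itv.
have Tu v : 0 <= v <= 1 -> `[0, T]%classic (T * v).
  by move=> /andP[v0 v1]; rewrite /= in_itv/= mulr_ge0//= ler_piMr.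
apply: cvg_comp (xc _ (Tu _ u01')) => A /= hA.
change (\forall v \near u, `[0, 1]%classic v -> A (T * v)).
have h0 : \forall v \near u, `[0, T]%classic (T * v) -> A (T * v).
  exact: (@mulrl_continuous R T u _ hA).
apply: filterS h0 => v /= h v01.
by apply: h; apply: Tu; move: v01; rewrite /= in_itv.
Qed.

Lemma fBm_holder (H T lam : R) (q : nat) (B : R -> Omega -> R) :
  0 < T -> 0 < lam -> is_fBm P H T B -> 1 < 2 * q%:R * (H - lam) -> lam < H ->
  exists K : Omega -> R, [/\ measurable_fun setT K, forall w, 0 <= K w,
    (\int[P]_w (K w ^+ (2 * q))%:E < +oo)%E &
    {ae P, forall w, holder_on 0 T (K w) lam (fun t => B t w)}].
Proof.
move=> T0 l0 fB qH lH; have H0 : 0 < H := lt_trans l0 lH.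
have q0 : (0 < q)%N.
  by case: q qH => // ; rewrite mulr0 mul0r ltNge ler01.
have [C C0 Cm] := fBm_increment_moment q H0 fB.
have [gB _ _ contB] := fB.
have tk n (k : nat) : (k <= 2 ^ n)%N -> 0 <= T * (k%:R / 2 ^+ n) <= T.
  move=> kn; rewrite mulr_ge0 ?divr_ge0 ?exprn_ge0 ?(ltW T0)//= ler_piMr ?(ltW T0)//.
  by rewrite ler_pdivrMr ?exprn_gt0// mul1r -natrX ler_nat.
have mB t : 0 <= t <= T -> measurable_fun setT (B t).
  by move=> tT; have [] := gaussian_process_law gB tT.
pose e n w := (dyadic_energy T lam q B n w)%:E.
have me n : measurable_fun setT (e n).
  apply/measurable_EFinP; apply: measurable_sum => k.
  apply: measurable_funX; apply: measurable_funM => //; apply: measurable_funB; apply: mB.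
    exact: tk.
  by apply: tk; exact: ltnW.
have e0 n w : (0 <= e n w)%E by rewrite lee_fin dyadic_energy_ge0.
pose Q w := (\sum_(0 <= n <oo) e n w)%E.
have mQ : measurable_fun setT Q by apply: ge0_emeasurable_sum => // n w _ _; exact: e0.
have Q0 w : (0 <= Q w)%E by apply: nneseries_ge0 => n _ _; exact: e0.
(* Ratio of the expected energies of successive levels: twice as many increments, the weight to the
   power [2 q], and the moment scaling [2^(- 2 H q)]. Altogether [a = 2^(1 - 2 q (H - lam))], which
   is below 1 by hypothesis. *)
pose a : R := 2 * (2 `^ lam) ^+ (2 * q) * ((2^-1) `^ (2 * H)) ^+ q.
have a0 : 0 <= a by rewrite !mulr_ge0 ?exprn_ge0 ?powR_ge0.
have pow2 (x p : R) (n : nat) : (x `^ p) ^+ n = x `^ (p * n%:R).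
  by rewrite -powR_mulrn ?powR_ge0// -powRrM.
have a1 : a < 1.
  have -> : a = 2 `^ (1 + lam * (2 * q)%:R - 2 * H * q%:R).
    rewrite !powRDgt0// powRr1// /a !pow2; congr (_ * _ * _).
    by rewrite -powR_inv1// -powRrM mulN1r.
  by apply: powR2_lt1; rewrite natrM; move: qH; lra.
pose c := C * (T `^ (2 * H)) ^+ q.
have c0 : 0 <= c by rewrite mulr_ge0 ?exprn_ge0 ?powR_ge0.
have ie n : (\int[P]_w e n w <= (c * a ^+ n)%:E)%E.
  pose D (k : 'I_(2 ^ n)) w := B (T * (k.+1%:R / 2 ^+ n)) w - B (T * (k%:R / 2 ^+ n)) w.
  have mD k : measurable_fun setT (fun w => (D k w ^+ (2 * q))%:E).
    apply/measurable_EFinP; apply: measurable_funX; apply: measurable_funB; apply: mB.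
      exact: tk.
    by apply: tk; exact: ltnW.
  have D0 k w : (0 <= (D k w ^+ (2 * q))%:E)%E.
    by rewrite lee_fin exprM exprn_ge0// sqr_ge0.
  pose rh : R := 2 `^ lam ^+ n ^+ (2 * q).
  have rh0 : 0 <= rh by rewrite !exprn_ge0 ?powR_ge0.
  have -> : (\int[P]_w e n w = \sum_(k < 2 ^ n) (rh%:E * \int[P]_w (D k w ^+ (2 * q))%:E))%E.
    transitivity (\int[P]_w (\sum_(k < 2 ^ n) (rh%:E * (D k w ^+ (2 * q))%:E)))%E.
      apply: eq_integral => w _; rewrite /e /dyadic_energy -sumEFin.
      by apply: eq_bigr => k _; rewrite -EFinM -exprMn.
    rewrite ge0_integral_sum//; last 2 first.
    - by move=> k; apply: emeasurable_funM.
    - by move=> k w _; rewrite mule_ge0.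
    by apply: eq_bigr => k _; rewrite ge0_integralZl.
  have Dk (k : 'I_(2 ^ n)) : (rh%:E * \int[P]_w (D k w ^+ (2 * q))%:E <=
      (rh * (C * ((T / 2 ^+ n) `^ (2 * H)) ^+ q))%:E)%E.
    rewrite EFinM lee_wpmul2l ?lee_fin//.
    have := Cm _ _ (tk n k (ltnW (ltn_ord k))) (tk n k.+1 (ltn_ord k)).
    have -> : T * (k.+1%:R / 2 ^+ n) - T * (k%:R / 2 ^+ n) = T / 2 ^+ n.
      by rewrite -mulrBr -mulrBl -natrB// subSnn div1r.
    by rewrite [`|T / _|]ger0_norm// divr_ge0 ?exprn_ge0// ltW.
  apply: (le_trans (lee_sum _ (fun k _ => Dk k))).
  rewrite sumEFin lee_fin sumr_const card_ord -[X in X <= _]mulr_natl le_eqVlt.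
  apply/orP; left; apply/eqP; rewrite /rh /c /a.
  rewrite powRM ?(ltW T0) ?invr_ge0 ?exprn_ge0// -exprVn.
  have -> : ((2^-1 : R) ^+ n) `^ (2 * H) = ((2^-1) `^ (2 * H)) ^+ n.
    by rewrite pow2 -powR_mulrn ?invr_ge0// -powRrM mulrC.
  by rewrite natrX !exprMn -!exprM [(n * (2 * q))%N]mulnC [(n * q)%N]mulnC; ring.
have iQ : (\int[P]_w Q w < +oo)%E.
  rewrite /Q integral_nneseries//.
  apply: (@le_lt_trans _ _ (c / (1 - a))%:E); last exact: ltry.
  apply: nneseries_le_bound => [n|N]; first exact: integral_ge0.
  apply: (le_trans (lee_sum _ (fun k _ => ie k))); rewrite sumEFin lee_fin.
  by apply: geometric_sum_le => //; rewrite a0.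
(* [T^-lam] undoes the rescaling of [[0, T]] to [[0, 1]]. On the null set where [Q] is infinite,
   [fine] gives 0, so [K] is a real measurable function everywhere. *)
pose K w := chaining_const lam * (fine (Q w)) `^ ((2 * q)%:R^-1) * T `^ (- lam).
have cc0 := chaining_const_ge0 l0.
have q2 : (2 * q)%:R != 0 :> R by rewrite pnatr_eq0 -lt0n muln_gt0.
exists K; split.
- apply: measurable_funM => //; apply: measurable_funM => //.
  apply: (measurableT_comp (measurable_powR _)).
  exact: measurableT_comp mQ.
- by move=> w; rewrite mulr_ge0 ?powR_ge0// mulr_ge0 ?powR_ge0.
- pose cst := (chaining_const lam * T `^ (- lam)) ^+ (2 * q).
  have cst0 : 0 <= cst by rewrite exprn_ge0// mulr_ge0 ?powR_ge0.
  apply: (@le_lt_trans _ _ (\int[P]_w (cst%:E * Q w))%E).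
    apply: ge0_le_integral_nonmeas => w _.
      by rewrite lee_fin exprM exprn_ge0// sqr_ge0.
    have -> : K w ^+ (2 * q) = cst * fine (Q w).
      rewrite /K mulrAC exprMn; congr (_ * _).
      by rewrite pow2 mulVf// powRr1// fine_ge0.
    rewrite EFinM lee_wpmul2l ?lee_fin//.
    by have := Q0 w; case: (Q w) => [x| |] //= _; rewrite leey.
  rewrite ge0_integralZl//.
  have : (0 <= \int[P]_w Q w)%E by exact: integral_ge0.
  by move: iQ; case: (\int[P]_w Q w)%E => [x| |] // _ _; rewrite -EFinM ltry.
- have iQ' : P.-integrable setT Q.
    apply/integrableP; split => //.
    by under eq_integral do rewrite gee0_abs//.
  have Qfin := integrable_ae measurableT iQ'.
  apply: filterS2 Qfin contB => w /(_ I) Qw cw.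
  pose A := fine (Q w) `^ ((2 * q)%:R^-1).
  have A0 : 0 <= A by exact: powR_ge0.
  have inc n (k : nat) : (k < 2 ^ n)%N ->
      `|B (T * (k.+1%:R / 2 ^+ n)) w - B (T * (k%:R / 2 ^+ n)) w| <=
      A * (2 `^ (- lam)) ^+ n.
    move=> kn; apply: (@dyadic_energy_le T lam q B n w k q0 kn (fine (Q w))).
      exact: fine_ge0.
    rewrite -lee_fin fineK//; apply: le_trans (nneseries_lim_ge n.+1 _); last first.
      by move=> i _ _; exact: e0.
    by rewrite big_nat_recr//= leeDr// sume_ge0.
  have yH := dyadic_holder l0 A0 (dyadic_continuous (ltW T0) cw) inc.
  move=> s t s0 st tT; have := yH (s / T) (t / T).
  have Tn0 : T != 0 by rewrite gt_eqF.
  rewrite divr_ge0 ?(ltW T0)// ler_pM2r ?invr_gt0// ler_pdivrMr// mul1r.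
  move=> /(_ isT st tT).
  have -> : T * (t / T) = t by field.
  have -> : T * (s / T) = s by field.
  rewrite -mulrBl powRM ?subr_ge0 ?invr_ge0 ?(ltW T0)//.
  have -> : T^-1 `^ lam = T `^ (- lam) by rewrite -powR_inv1 ?(ltW T0)// -powRrM mulN1r.
  by rewrite /K -/A mulrCA mulrC [X in _ <= X -> _]mulrC => h; apply: (le_trans h);
    rewrite le_eqVlt; apply/orP; left; apply/eqP; ring.
Qed.

End kolmogorov.

(** * Measurability of Hoelder paths *)

Section path_measurability.
Context {R : realType} {d : nat} {dO : measure_display} {Omega : measurableType dO}.
Local Notation V := 'rV[R]_d.
Variables (a c th : R) (Y : Omega -> R -> V) (K : Omega -> R) (Cl : set (R -> V)).
Hypotheses (ac : a <= c) (th0 : 0 < th).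
Hypothesis mK : measurable_fun setT K.
Hypothesis YK : forall w, holder_on a c (K w) th (Y w).
Hypothesis YCl : forall w, Cl (Y w).
Hypothesis mY : forall t i, a <= t <= c -> measurable_fun setT (fun w => Y w t ord0 i).

Let grid (n k : nat) : R := a + (c - a) * (k%:R / n.+1%:R).

Let grid_itv n (k : nat) : (k <= n.+1)%N -> a <= grid n k <= c.
Proof.
move=> kn; have ca : 0 <= c - a by rewrite subr_ge0.
rewrite /grid lerDl mulr_ge0 ?divr_ge0//= -lerBrDl ler_piMr//.
by rewrite ler_pdivrMr ?ltr0n// mul1r ler_nat.
Qed.

Let grid_near n t : a <= t <= c -> exists k : 'I_n.+2,
  grid n k <= t /\ t - grid n k <= (c - a) / n.+1%:R.
Proof.
move=> /andP[at_ tc]; have ca : 0 <= c - a by rewrite subr_ge0.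
move: ca; rewrite le_eqVlt => /predU1P[ca|ca].
  exists ord0; rewrite /grid -ca !mul0r addr0; split=> //.
  by rewrite subr_le0 (le_trans tc)// -subr_le0 -ca.
pose u := (t - a) / (c - a) * n.+1%:R.
have u0 : 0 <= u by rewrite mulr_ge0// divr_ge0 ?subr_ge0// ltW.
have un : u <= n.+1%:R.
  by rewrite ler_piMl// ler_pdivrMr// mul1r lerD2r.
have /andP[h1 h2] := Num.Theory.truncn_itv u0.
have kn : (Num.trunc u < n.+2)%N by rewrite ltnS -(ler_nat R) (le_trans h1).
exists (Ordinal kn); rewrite /grid /=.
have tE : t = a + (c - a) * (u / n.+1%:R).
  by rewrite /u; field; rewrite !gt_eqF ?ltr0n.
have n0 : 0 < n.+1%:R :> R by rewrite ltr0n.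
split.
  rewrite [X in _ <= X]tE lerD2l ler_wpM2l ?(ltW ca)// ler_wpM2r ?invr_ge0//.
have -> : t - (a + (c - a) * ((Num.trunc u)%:R / n.+1%:R)) =
    (c - a) / n.+1%:R * (u - (Num.trunc u)%:R).
  by rewrite {1}tE; field; rewrite gt_eqF.
rewrite ler_piMr ?divr_ge0 ?(ltW ca)//.
by rewrite lerBlDr ltW// addrC natr1.
Qed.

Definition path_cell (n : nat) (v : 'M[rat]_(n.+2, d)) (f : R -> V) : Prop :=
  forall (k : 'I_n.+2) i, `|f (grid n k) ord0 i - ratr (v k i)| <= n.+1%:R^-1.

(** [U] is assumed relatively open for the uniform distance in each Hoelder ball only. There a path
    is known up to a small error from its values on a grid, so the preimage is a countable union of
    events on [K] and finitely many values. [Cl] restricts the admissible paths, for instance to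
    those vanishing at 0. *)
Lemma measurable_path_preimage (U : set (R -> V)) :
  (forall (C : R) f, 0 <= C -> Cl f -> holder_on a c C th f -> U f ->
     exists2 e : R, 0 < e & forall g, Cl g -> holder_on a c C th g ->
       (forall t, a <= t <= c -> `|g t - f t| <= e) -> U g) ->
  measurable (Y @^-1` U).
Proof.
move=> Uopen.
(* The rational cells all of whose paths in the Hoelder ball of radius [M] lie in [U]; countably
   many, and they cover. *)
pose good (M n : nat) (v : 'M[rat]_(n.+2, d)) := forall f, Cl f ->
  holder_on a c M%:R th f -> path_cell v f -> U f.
have -> : Y @^-1` U = \bigcup_M \bigcup_n \bigcup_(v in [set v | good M n v])
    ([set w | K w <= M%:R] `&` [set w | path_cell v (Y w)]).
  apply/seteqP; split => w /=; last first.
    move=> [M _ [n _ [v gv [KM cv]]]]; apply: gv => //.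
    exact: holder_on_le (YK w).
  move=> Uw; pose M := (Num.trunc (K w)).+1.
  have KM : K w <= M%:R by rewrite ltW// Num.Theory.truncnS_gt.
  have wM : holder_on a c M%:R th (Y w) by exact: holder_on_le (YK w).
  have [e e0 eU] := Uopen _ _ (ler0n _ M) (YCl w) wM Uw.
  (* Two paths in one cell differ by at most [2 / (n + 1)] at a grid point, and each moves by at
     most one Hoelder increment over a mesh. *)
  have [n ne] : exists n : nat,
      2 / n.+1%:R + 2 * (M%:R * ((c - a) / n.+1%:R) `^ th) <= e.
    pose e' := e / (4 * M.+1%:R); have M0 : 0 < M.+1%:R :> R by rewrite ltr0n.
    have e'0 : 0 < e' by rewrite divr_gt0// mulr_gt0.
    pose dl := e' `^ th^-1; have dl0 : 0 < dl by exact: powR_gt0.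
    have ca : 0 <= c - a by rewrite subr_ge0.
    exists (Num.trunc (4 / e + (c - a) / dl)); set n := Num.trunc _.
    have hn : 4 / e + (c - a) / dl < n.+1%:R by exact: Num.Theory.truncnS_gt.
    have n0 : 0 < n.+1%:R :> R by rewrite ltr0n.
    have h1 : 2 / n.+1%:R <= e / 2.
      rewrite ler_pdivrMr// mulrAC ler_pdivlMr// -ler_pdivrMl// mulrC.
      apply: le_trans (ltW hn); rewrite -natrM -[X in X <= _]addr0 lerD2l.
      by rewrite divr_ge0// ltW.
    have h2 : ((c - a) / n.+1%:R) `^ th <= e'.
      have -> : e' = dl `^ th by rewrite -powRrM mulVf ?gt_eqF// powRr1// ltW.
      apply: ge0_ler_powR; rewrite ?nnegrE ?(ltW th0) ?(ltW dl0) ?divr_ge0//.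
      rewrite ler_pdivrMr// mulrC -ler_pdivrMr// ltW// (le_lt_trans _ hn)//.
      by rewrite lerDr divr_ge0// ltW.
    have h3 : M%:R * ((c - a) / n.+1%:R) `^ th <= e / 4.
      apply: (@le_trans _ _ (M.+1%:R * e')).
        by apply: ler_pM => //; [exact: powR_ge0|rewrite ler_nat].
      by rewrite /e' le_eqVlt; apply/orP; left; apply/eqP; field; rewrite gt_eqF.
    have -> : e = e / 2 + 2 * (e / 4) by field.
    by apply: lerD => //; rewrite ler_wpM2l.
  have [v cv] : exists v : 'M[rat]_(n.+2, d), path_cell v (Y w).
    have n0 : 0 < n.+1%:R^-1 :> R by rewrite invr_gt0 ltr0n.
    have app (x : R) : exists q : rat, `|x - ratr q| <= n.+1%:R^-1.
      have /rat_in_itvoo[q] : x - n.+1%:R^-1 < x + n.+1%:R^-1.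
        by rewrite ltrD2l gt0_cp.
      rewrite in_itv/= => /andP[q1 q2]; exists q.
      by rewrite distrC ler_distl (ltW q1) ltW.
    have /choice[v vP] : forall k : 'I_n.+2 * 'I_d, exists q : rat,
        `|Y w (grid n k.1) ord0 k.2 - ratr q| <= n.+1%:R^-1 by move=> k; exact: app.
    exists (\matrix_(k, i) v (k, i)) => k i; rewrite mxE; exact: vP (k, i).
  exists M => //; exists n => //; exists v => // f Cf fM fv.
  apply: eU => // t tac; apply: le_trans ne.
  have [k [gk1 gk2]] := grid_near n tac.
  have gac : a <= grid n k <= c by apply: grid_itv; rewrite -ltnS.
  have mid : `|f (grid n k) - Y w (grid n k)| <= 2 / n.+1%:R.
    apply: rV_norm_le => [|i]; first by rewrite divr_ge0.
    have := fv k i; have := cv k i; rewrite !mxE.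
    set x := Y w _ _ _; set y := f _ _ _; set q := ratr _ => h1 h2.
    have -> : y - x = (y - q) - (x - q) by ring.
    by rewrite (le_trans (ler_normB _ _))// mulrDl mul1r lerD.
  have /andP[ga gc] := gac; have /andP[at_ tc] := tac.
  have hp : (t - grid n k) `^ th <= ((c - a) / n.+1%:R) `^ th.
    apply: ge0_ler_powR; rewrite ?nnegrE ?(ltW th0) ?subr_ge0//.
    by rewrite divr_ge0 ?subr_ge0.
  have h1 : `|f t - f (grid n k)| <= M%:R * ((c - a) / n.+1%:R) `^ th.
    by apply: (le_trans (fM _ _ ga gk1 tc)); rewrite ler_wpM2l.
  have h2 : `|Y w t - Y w (grid n k)| <= M%:R * ((c - a) / n.+1%:R) `^ th.
    by apply: (le_trans (wM _ _ ga gk1 tc)); rewrite ler_wpM2l.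
  have -> : f t - Y w t = (f t - f (grid n k)) + (f (grid n k) - Y w (grid n k)) -
      (Y w t - Y w (grid n k)).
    by apply/rowP => i; rewrite !mxE; ring.
  rewrite (le_trans (ler_normB _ _))// (le_trans (lerD (ler_normD _ _) (lexx _)))//.
  have -> : 2 / n.+1%:R + 2 * (M%:R * ((c - a) / n.+1%:R) `^ th) =
    M%:R * ((c - a) / n.+1%:R) `^ th + 2 / n.+1%:R + M%:R * ((c - a) / n.+1%:R) `^ th.
    by ring.
  by apply: lerD => //; exact: lerD.
apply: bigcupT_measurable => M; apply: bigcupT_measurable => n.
rewrite bigcup_mkcond; apply: countable_bigcupT_measurable; first exact: countableP.
move=> v; case: ifPn => // _; apply: measurableI.
  rewrite -[X in measurable X]setTI.
  exact: measurable_fun_le.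
have -> : [set w | path_cell v (Y w)] = \bigcap_(ki in [set: 'I_n.+2 * 'I_d])
    [set w | `|Y w (grid n ki.1) ord0 ki.2 - ratr (v ki.1 ki.2)| <= n.+1%:R^-1].
  by apply/seteqP; split => w /= h => [ki _|k i]; [exact: h|exact: (h (k, i))].
apply: fin_bigcap_measurable => // -[k i] _ /=; rewrite -[X in measurable X]setTI.
apply: measurable_fun_le => //; apply: measurableT_comp => //.
by apply: measurable_funB => //; apply: mY; apply: grid_itv; rewrite -ltnS.
Qed.

Lemma measurable_path_functional (Phi : (R -> V) -> R) :
  (forall (C e : R) f, 0 <= C -> 0 < e -> Cl f -> holder_on a c C th f ->
     exists2 e' : R, 0 < e' & forall g, Cl g -> holder_on a c C th g ->
       (forall t, a <= t <= c -> `|g t - f t| <= e') -> `|Phi g - Phi f| < e) ->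
  measurable_fun setT (fun w => Phi (Y w)).
Proof.
move=> Phic; apply: (measurability _ (RGenInftyO.measurableE R)).
move=> _ [_ [x ->] <-]; rewrite setTI.
apply: (@measurable_path_preimage [set f | Phi f < x]) => C f C0 Cf fC fx.
have e0 : 0 < x - Phi f by rewrite subr_gt0.
have [e' e'0 h] := Phic _ _ _ C0 e0 Cf fC; exists e' => // g Cg gC gf.
have := h g Cg gC gf; rewrite /= ltr_norml => /andP[_].
by rewrite ltrD2r.
Qed.

End path_measurability.

Section W0_measurability.
Context {R : realType} {d : nat} {dO : measure_display} {Omega : measurableType dO}.
Local Notation V := 'rV[R]_d.

(* On a Hoelder ball the W0-topology is coarser than the uniform one: by
   interpolation a uniformly small Hoelder function is small in a weaker
   Hoelder norm. *)
Lemma measurable_W0cont (al th a c : R) (Y : Omega -> R -> V) (K : Omega -> R) :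
  a <= c -> 0 < al -> al < th -> measurable_fun setT K ->
  (forall w, holder_on a c (K w) th (Y w)) ->
  (forall t i, a <= t <= c -> measurable_fun setT (fun w => Y w t ord0 i)) ->
  measurable_fun setT
    (Y : Omega -> borelType (@W0cont R d al a c) (W0norm al a c)).
Proof.
move=> ac al0 alth mK YK mY; have th0 := lt_trans al0 alth.
apply: (@measurability _ _ Omega (borelType (@W0cont R d al a c) (W0norm al a c))
  setT Y (norm_open (@W0cont R d al a c) (W0norm al a c)) erefl).
move=> _ [U [_ Uo] <-]; rewrite setTI.
apply: (measurable_path_preimage (Cl := setT) ac th0 mK YK) => // C f C0 _ fC Uf.
have [e e0 eU] := Uo f Uf.
(* This puts the interpolated order [th k] halfway between [al] and [th]. *)
pose k := (al / th + 1) / 2.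
have alth1 : 0 < al / th < 1 by rewrite divr_gt0// ltr_pdivrMr// mul1r.
have /andP[k0 k1] : 0 < k < 1.
  by move: alth1; rewrite /k => /andP[]; set x := al / th; move=> x0 x1; apply/andP; split; lra.
have thk : al < th * k.
  have -> : th * k = (al + th) / 2 by rewrite /k; field; rewrite gt_eqF.
  by lra.
pose Kc := (c - a) `^ (th * k - al) / (th * k - al).
have Kc0 : 0 <= Kc by rewrite divr_ge0 ?powR_ge0// subr_ge0 ltW.
pose B0 := d%:R * ((2 * C) `^ k * Kc).
have B00 : 0 <= B0 by rewrite mulr_ge0// mulr_ge0 ?powR_ge0.
pose x1 := e / (3 * d.+1%:R); pose x2 := (e / (3 * (B0 + 1))) `^ (1 - k)^-1.
have B1 : 0 < B0 + 1 by rewrite ltr_wpDl.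
have x10 : 0 < x1 by rewrite divr_gt0// mulr_gt0// ltr0n.
have q0 : 0 < e / (3 * (B0 + 1)) by rewrite divr_gt0// mulr_gt0.
have x20 : 0 < x2 by rewrite powR_gt0.
pose ep := Num.min x1 x2 / 2.
have ep0 : 0 < ep by rewrite divr_gt0// lt_min x10.
have e2 : 2 * ep = Num.min x1 x2 by rewrite /ep; field.
have ep1 : d%:R * ep <= e / 3.
  apply: (@le_trans _ _ (d.+1%:R * x1)).
    apply: ler_pM; rewrite ?(ltW ep0) ?ler_nat//.
    rewrite -[ep]mul1r; apply: (@le_trans _ _ (2 * ep)); first by rewrite ler_wpM2r ?(ltW ep0)// ler1n.
    by rewrite e2 ge_min lexx.
  have : d.+1%:R != 0 :> R by rewrite pnatr_eq0.
  rewrite /x1; set D := d.+1%:R => D0.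
  by rewrite le_eqVlt; apply/orP; left; apply/eqP; field.
have ep2 : (2 * ep) `^ (1 - k) * B0 <= e / 3.
  apply: (@le_trans _ _ (e / (3 * (B0 + 1)) * (B0 + 1))); last first.
    by rewrite le_eqVlt; apply/orP; left; apply/eqP; field; rewrite gt_eqF.
  apply: ler_pM; rewrite ?powR_ge0// ?lerDl//.
  have k1' : 0 < 1 - k by rewrite subr_gt0.
  have -> : e / (3 * (B0 + 1)) = x2 `^ (1 - k).
    by rewrite /x2 -powRrM mulVf ?gt_eqF// powRr1// ltW.
  apply: ge0_ler_powR; rewrite ?nnegrE ?(ltW k1') ?(ltW x20)//.
    by rewrite mulr_ge0// ltW.
  by rewrite e2 ge_min lexx orbT.
exists ep => // g _ gC gf; apply: eU; first exact: (holder_on_W0cont al0 alth ac C0 gC).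
have hC : holder_on a c (2 * C) th (g \- f)%R.
  move=> s t as_ st tc.
  have -> : (g \- f)%R t - (g \- f)%R s = (g t - g s) - (f t - f s).
    by apply/rowP => i; rewrite !mxE; ring.
  rewrite (le_trans (ler_normB _ _))//.
  rewrite (le_trans (lerD (gC _ _ as_ st tc) (fC _ _ as_ st tc)))//.
  by have -> : 2 * C * (t - s) `^ th = C * (t - s) `^ th + C * (t - s) `^ th by ring.
have C20 : 0 <= 2 * C by rewrite mulr_ge0.
have kk : 0 <= k <= 1 by rewrite !ltW.
have hI := holder_on_interpolate C20 kk (ltW ep0) hC gf.
have CI0 : 0 <= (2 * ep) `^ (1 - k) * (2 * C) `^ k by rewrite mulr_ge0 ?powR_ge0.
apply: (le_lt_trans (W0norm_holder al0 thk CI0 hI gf)); rewrite lte_fin -/Kc.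
have -> : d%:R * (ep + (2 * ep) `^ (1 - k) * (2 * C) `^ k * Kc) =
  d%:R * ep + (2 * ep) `^ (1 - k) * B0 by rewrite /B0; ring.
by rewrite (le_lt_trans (lerD ep1 ep2))//; lra.
Qed.

End W0_measurability.

Section iterates_measurability.
Context {R : realType} {d m : nat} {dO : measure_display} {Omega : measurableType dO}.
Local Notation V := 'rV[R]_d.
Variables (r T al mm be lam : R) (sigma : R -> V -> 'M[R]_(d, m)) (Ms S0 : R).
Variables (b : R -> (R -> V) -> V) (eta : R -> V).
Variables (L0 Kb : R) (beta0 L : R -> R) (Ce E : R).
Hypothesis D : delay_data r T (1 - al) b eta L0 Kb beta0 L Ce E.
Hypothesis DN : noise_data T al mm be lam sigma Ms S0.
Hypothesis r_gt0 : 0 < r.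
Variables (G : Omega -> 'I_m -> R -> R) (Kg : Omega -> R).
Hypothesis mKg : measurable_fun setT Kg.
Hypothesis Kg0 : forall w, 0 <= Kg w.
Hypothesis GK : forall w j, holder_on 0 T (Kg w) lam (G w j).
Hypothesis mG : forall t j, 0 <= t <= T -> measurable_fun setT (fun w => G w j t).

Let th := 1 - al.
Let th0 : 0 < th := dd_th0 D.
Let T0 : 0 <= T := dd_T0 D.
Let rT : - r <= T. Proof. by apply: le_trans T0; rewrite oppr_le0 ltW. Qed.

(** A common Hoelder constant and the value 0 at time 0 confine all the solutions to one ball, so a
    single weight serves in the stability estimate; its factor 2 and the weight explain
    [e / (4 ex)]. *)
Lemma ode_sol_continuous (C e t : R) (f : R -> V) i : 0 <= C -> 0 < e ->
  - r <= t <= T -> f 0 = 0 -> holder_on 0 T C th f ->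
  exists2 e' : R, 0 < e' & forall g : R -> V, g 0 = 0 -> holder_on 0 T C th g ->
    (forall s, 0 <= s <= T -> `|g s - f s| <= e') ->
    `|ode_sol b eta g t ord0 i - ode_sol b eta f t ord0 i| < e.
Proof.
move=> C0 e0 tT f0 fC.
have Z0 : 0 <= C * T `^ th by rewrite mulr_ge0 ?powR_ge0.
have zZ (z : R -> V) : z 0 = 0 -> holder_on 0 T C th z ->
    forall s, 0 <= s <= T -> `|z s| <= C * T `^ th.
  move=> z0 zC s sT; have := holder_on_bounded C0 (ltW th0) zC sT.
  by rewrite z0 normr0 add0r subr0.
pose N := ode_bound T th L0 Kb E (C * T `^ th).
have N0 : 0 <= N.
  rewrite /N /ode_bound mulr_ge0 ?expR_ge0// mulr_ge0// !addr_ge0 ?(dd_E0 D)//.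
  by rewrite mulr_ge0 ?powR_ge0// (dd_Kb0 D).
have k0 : 0 < 2 * L N + 1 by rewrite ltr_wpDl// mulr_ge0// (dd_L0 D).
have k1 : 2 * L N <= 2 * L N + 1 by rewrite lerDl.
pose ex := expR ((2 * L N + 1) * Num.max t 0).
have ex0 : 0 < ex by exact: expR_gt0.
exists (e / (4 * ex)); first by rewrite divr_gt0// mulr_gt0.
move=> g g0 gC gf.
have ep0 : 0 <= e / (4 * ex) by rewrite divr_ge0 ?mulr_ge0// ltW.
have Cf := ode_sol_Cspace D C0 Z0 f0 fC (zZ f f0 fC).
have Cg := ode_sol_Cspace D C0 Z0 g0 gC (zZ g g0 gC).
have Sf := ode_sol_solves D C0 Z0 f0 fC (zZ f f0 fC).
have Sg := ode_sol_solves D C0 Z0 g0 gC (zZ g g0 gC).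
have Bf := ode_sol_bounded D C0 Z0 f0 fC (zZ f f0 fC).
have Bg := ode_sol_bounded D C0 Z0 g0 gC (zZ g g0 gC).
have h := ode_stability D N0 k0 k1 ep0 (lexx T) g0 f0 Cg Cf Bg Bf gf Sg Sf tT.
have hi := rV_coord_le (ode_sol b eta g t - ode_sol b eta f t) i.
move: hi; rewrite [X in `|X| <= _]mxE [X in _ + X]mxE => hi.
apply: (le_lt_trans hi); apply: (le_lt_trans h).
have -> : 2 * (e / (4 * ex)) * ex = e / 2 by field; rewrite gt_eqF.
by lra.
Qed.

(** [sigma s] is Lipschitz, hence evaluation of the coefficient is a uniformly continuous functional
    of the path. *)
Lemma coef_measurable (X : Omega -> R -> V) (Kx : Omega -> R) s i j :
  measurable_fun setT Kx -> (forall w, holder_on (- r) T (Kx w) th (X w)) ->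
  (forall t i', - r <= t <= T -> measurable_fun setT (fun w => X w t ord0 i')) ->
  0 <= s <= T -> measurable_fun setT (fun w => coef r sigma (X w) i j s).
Proof.
move=> mKx XK mX /andP[s0 sT].
have sT' : 0 <= s <= T by rewrite s0.
apply: (measurable_path_functional (Cl := setT) rT th0 mKx XK (fun=> I) mX
  (Phi := fun x => coef r sigma x i j s)) => C e f C0 e0 _ fC.
have Ms0 := nd_Ms DN; have M1 : 0 < Ms + 1 by rewrite ltr_wpDl.
exists (e / (2 * (Ms + 1))); first by rewrite divr_gt0// mulr_gt0.
move=> g _ gC gf; rewrite /coef.
apply: (le_lt_trans (nd_lip DN _ _ _ _ sT')).
have h : `|g (s - r) - f (s - r)| <= e / (2 * (Ms + 1)).
  by apply: gf; rewrite lerBrDr addNr s0 lerBlDr (le_trans sT)// lerDl ltW.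
apply: (le_lt_trans (ler_wpM2l Ms0 h)).
apply: (@le_lt_trans _ _ ((Ms + 1) * (e / (2 * (Ms + 1))))).
  by rewrite ler_wpM2r ?lerDl// divr_ge0 ?mulr_ge0 ?(ltW e0)// ltW.
have -> : (Ms + 1) * (e / (2 * (Ms + 1))) = e / 2 by field; rewrite gt_eqF.
by lra.
Qed.

(** The Zaehle integral is the pointwise limit of its Riemann sums, which are finite combinations of
    measurable functions. *)
Lemma noise_measurable (X : Omega -> R -> V) (Kx : Omega -> R) t i :
  measurable_fun setT Kx -> (forall w, 0 <= Kx w) ->
  (forall w, holder_on (- r) T (Kx w) th (X w)) ->
  (forall t i', - r <= t <= T -> measurable_fun setT (fun w => X w t ord0 i')) ->
  0 <= t <= T -> measurable_fun setT (fun w => noise al r sigma (G w) (X w) t ord0 i).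
Proof.
move=> mKx Kx0 XK mX tT.
have H j : measurable_fun setT (fun w => zaehle_int al (coef r sigma (X w) i j) (G w j) t).
  have ml : 1 < mm + lam by have := nd_alm DN; have := nd_lam DN; lra.
  have cvg w := zaehle_riemann (nd_al DN) (nd_alm DN) (nd_lam DN) T0 ml
    (mulr_ge0 (coef_slope_ge0 DN) (addr_ge0 ler01 (Kx0 w))) (Kg0 w)
    (coef_holder (ltW r_gt0) DN i j (Kx0 w) (XK w)) (GK w j) tT.
  apply: (measurable_fun_cvg _ (fun w _ => cvg w)) => n.
  have pt (k : nat) : (k <= n.+1)%N -> 0 <= t * (k%:R / n.+1%:R) <= T.
    move=> kn; have /andP[t0 tT'] := tT.
    rewrite mulr_ge0 ?divr_ge0//= (le_trans _ tT')// ler_piMr//.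
    by rewrite ler_pdivrMr ?ltr0n// mul1r ler_nat.
  apply: measurable_funM => //; apply: measurable_sum => k.
  apply: measurable_funM.
    by apply: coef_measurable mKx XK mX _; apply: pt; exact: ltnW.
  by apply: measurable_funB; apply: mG; apply: pt => //; exact: ltnW.
have -> : (fun w => noise al r sigma (G w) (X w) t ord0 i) =
    (fun w => \sum_j zaehle_int al (coef r sigma (X w) i j) (G w j) t).
  by apply/funext => w; exact: noiseE.
by apply: measurable_sum.
Qed.

Lemma measurable_delay_const k :
  measurable_fun setT (fun w => delay_const (m := m) T al mm be lam Ms S0 L0 Kb Ce E (Kg w) k).
Proof.
rewrite /delay_const; apply: measurable_funB => //; apply: measurable_funM => //.
by apply: measurable_funX; apply: measurable_funD => //; exact: measurable_funM.
Qed.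

(** The noise of the previous iterate is a measurable Hoelder path vanishing at 0, and a coordinate
    of [ode_sol] is a continuous functional of such paths. *)
Lemma delay_iter_measurable k t i : - r <= t <= T ->
  measurable_fun setT (fun w => delay_iter r al sigma b eta (G w) k t ord0 i).
Proof.
elim: k t i => [|k IHk] t i tT; first exact: (@measurable_cst _ _ _ _ setT (ode_sol b eta (fun=> 0) t ord0 i)).
pose Kx w := delay_const (m := m) T al mm be lam Ms S0 L0 Kb Ce E (Kg w) k.
pose X w := delay_iter r al sigma b eta (G w) k.
have Kx0 w : 0 <= Kx w by exact: (delay_const_ge0 D DN (Kg0 w)).
have spec w := delay_iter_spec D DN r_gt0 (Kg0 w) (GK w) k.
have XK w : holder_on (- r) T (Kx w) th (X w) by have [] := spec w.
have mKx := measurable_delay_const k.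
have XE w : `|X w (- r)| <= E.
  have [_ [z [_ _ _ zS]]] := spec w.
  rewrite /X (solves_ode_neg T0 zS) ?lexx ?oppr_le0 ?(ltW r_gt0)//.
  by apply: (dd_etaE D); rewrite lexx oppr_le0 ltW.
pose Z w := noise al r sigma (G w) (X w).
have ZK w := noise_holder (ltW r_gt0) T0 DN (dd_E0 D) (Kg0 w) (Kx0 w) (XK w) (XE w) (GK w).
pose Kz w := noise_slope (m := m) T al mm be lam Ms S0 E * Kg w * (1 + Kx w).
have mKz : measurable_fun setT Kz.
  apply: measurable_funM; first exact: measurable_funM.
  exact: measurable_funD.
have mZ s i' : 0 <= s <= T -> measurable_fun setT (fun w => Z w s ord0 i').
  by move=> sT; exact: (noise_measurable i' mKx Kx0 XK IHk sT).
have Z0 w : [set z : R -> V | z 0 = 0] (Z w) by exact: noise0.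
apply: (measurable_path_functional T0 th0 mKz ZK Z0 mZ
  (Phi := fun z => ode_sol b eta z t ord0 i)) => C e f C0 e0 f0 fC.
have [e' e'0 h] := ode_sol_continuous i C0 e0 tT f0 fC.
by exists e'.
Qed.

End iterates_measurability.

(** * Existence, uniqueness and moments *)

Section almost_everywhere_bounds.
Context {R : realType} {dO : measure_display} {Omega : measurableType dO}.
Variable P : probability Omega R.

(** [f] will be a power of the [W0norm] of the solution, whose measurability is not established. The
    exceptional null set is thus moved to [g], by making it infinite there. *)
Lemma ge0_le_integral_ae (f g : Omega -> \bar R) : measurable_fun setT g ->
  (forall x, (0 <= f x)%E) -> (forall x, (0 <= g x)%E) ->
  {ae P, forall x, (f x <= g x)%E} ->
  (\int[P]_x f x <= \int[P]_x g x)%E.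
Proof.
move=> mg f0 g0 [N [mN PN fgN]].
pose h x := if x \in N then +oo%E else g x.
have mh : measurable_fun setT h.
  apply: measurable_fun_ifT => //; apply: (measurable_fun_bool true).
  rewrite setTI (_ : _ @^-1` _ = N)//.
  by apply/seteqP; split=> x /=; [move/set_mem|move/mem_set].
apply: (@le_trans _ _ (\int[P]_x h x)%E).
  apply: ge0_le_integral_nonmeas => x _ //; rewrite /h; case: ifPn => [_|xN]; first exact: leey.
  apply: contrapT => fg; move/negP: xN; apply; apply: mem_set; exact: fgN.
rewrite (@ge0_ae_eq_integral _ _ _ P setT h g)//.
- by move=> x _; rewrite /h; case: ifP.
- exists N; split=> // x /= /not_implyP [_ hg].
  by apply: contrapT => xN; apply: hg; rewrite /h memNset.
Qed.

(** Each term is at most the [n]-th root of the sum of the [n]-th powers. *)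
Lemma expr_sum_le (n m : nat) (x : 'I_m -> R) : (0 < n)%N -> (forall j, 0 <= x j) ->
  (\sum_j x j) ^+ n <= m%:R ^+ n * \sum_j x j ^+ n.
Proof.
move=> n0 x0; set S := \sum_j x j ^+ n.
have S0 : 0 <= S by apply: sumr_ge0 => j _; rewrite exprn_ge0.
have xS j : x j <= S `^ n%:R^-1.
  have nn : n%:R != 0 :> R by rewrite pnatr_eq0 -lt0n.
  have -> : x j = (x j ^+ n) `^ n%:R^-1.
    by rewrite -powR_mulrn// -powRrM divff// powRr1.
  apply: ge0_ler_powR; rewrite ?nnegrE ?exprn_ge0//.
  by rewrite /S (bigD1 j)//= lerDl sumr_ge0// => i _; rewrite exprn_ge0.
have -> : S = (S `^ n%:R^-1) ^+ n.
  by rewrite -powR_mulrn ?powR_ge0// -powRrM mulVf ?powRr1// pnatr_eq0 -lt0n.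
rewrite -exprMn; apply: lerXn2r; rewrite ?nnegrE ?mulr_ge0 ?powR_ge0//.
  exact: sumr_ge0.
apply: (le_trans (ler_sum _ (fun j _ => xS j))).
by rewrite sumr_const card_ord mulr_natl.
Qed.

Lemma fBm_family_holder (m : nat) (H T lam : R) (q : nat) (W : 'I_m -> R -> Omega -> R) :
  0 < T -> 0 < lam -> (forall j, is_fBm P H T (W j)) ->
  1 < 2 * q%:R * (H - lam) -> lam < H ->
  exists K : Omega -> R, [/\ measurable_fun setT K, forall w, 0 <= K w,
    (\int[P]_w (K w ^+ (2 * q))%:E < +oo)%E &
    {ae P, forall w j, holder_on 0 T (K w) lam (fun t => W j t w)}].
Proof.
move=> T0 l0 fW qH lH.
have /choice[K HK] := fun j => fBm_holder T0 l0 (fW j) qH lH.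
have mK j : measurable_fun setT (K j) by have [] := HK j.
have K0 j w : 0 <= K j w by have [_ h _ _] := HK j.
have q0 : (0 < 2 * q)%N.
  by case: q qH {HK} => // ; rewrite mulr0 mul0r ltNge ler01.
exists (fun w => \sum_j K j w); split.
- exact: measurable_sum.
- by move=> w; exact: sumr_ge0.
- apply: (@le_lt_trans _ _
    (\int[P]_w (\sum_(j < m) ((m%:R ^+ (2 * q))%:E * (K j w ^+ (2 * q))%:E)))%E).
    apply: ge0_le_integral_nonmeas => w _.
      by rewrite lee_fin exprn_ge0// sumr_ge0.
    apply: (@le_trans _ _ (m%:R ^+ (2 * q) * \sum_j K j w ^+ (2 * q))%:E).
      by rewrite lee_fin expr_sum_le.
    by rewrite mulr_sumr -sumEFin; apply: lee_sum => j _; rewrite EFinM.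
  have c0 : 0 <= m%:R ^+ (2 * q) :> R by rewrite exprn_ge0.
  have mKq j : measurable_fun setT (fun w => (K j w ^+ (2 * q))%:E).
    by apply/measurable_EFinP; exact: measurable_funX.
  have Kq0 j w : (0 <= (K j w ^+ (2 * q))%:E)%E by rewrite lee_fin exprn_ge0.
  rewrite ge0_integral_sum//; last 2 first.
  - by move=> j; apply: emeasurable_funM.
  - by move=> j w _; rewrite mule_ge0.
  apply: lte_sum_pinfty => j _; rewrite ge0_integralZl//.
  have [_ _ + _] := HK j; have : (0 <= \int[P]_w (K j w ^+ (2 * q))%:E)%E.
    exact: integral_ge0.
  by case: (\int[P]_w _)%E => [x| |] // _ _; rewrite -EFinM ltry.
(* The almost sure statements are indexed by natural numbers, vacuous from [m] on, to be combined by
   countable intersection. *)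
- have aeK n : {ae P, forall w (j : 'I_m), j = n :> nat ->
      holder_on 0 T (K j w) lam (fun t => W j t w)}.
    have [nm|nm] := ltnP n m; last first.
      by apply: aeW => w j jn; move: (ltn_ord j); rewrite jn ltnNge nm.
    have [_ _ _] := HK (Ordinal nm); apply: filterS => w h j jn.
    by have -> : j = Ordinal nm by exact: val_inj.
  have := ae_foralln aeK; apply: filterS => w h j.
  apply: holder_on_le (h j j erefl).
  by rewrite (bigD1 j)//= lerDl sumr_ge0.
Qed.

End almost_everywhere_bounds.

Section delay_moments.
Context {R : realType} {d m : nat}.
Local Notation V := 'rV[R]_d.
Variables (r T al mm be lam : R) (sigma : R -> V -> 'M[R]_(d, m)) (Ms S0 : R).
Variables (b : R -> (R -> V) -> V) (eta : R -> V).
Variables (L0 Kb : R) (beta0 L : R -> R) (Ce E : R).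
Hypothesis D : delay_data r T (1 - al) b eta L0 Kb beta0 L Ce E.
Hypothesis DN : noise_data T al mm be lam sigma Ms S0.
Hypothesis r_gt0 : 0 < r.
Hypothesis al2 : al < 2^-1.

Lemma delay_iter_W0norm (k : nat) : exists2 C : R, 0 <= C &
  forall (g : 'I_m -> R -> R) (Cg : R), 0 <= Cg ->
    (forall j, holder_on 0 T Cg lam (g j)) ->
    (W0norm al (- r) T (delay_iter r al sigma b eta g k) <= (C * (1 + Cg) ^+ k)%:E)%E.
Proof.
have T0 := dd_T0 D; have /andP[al0 al1] := nd_al DN; have E0 := dd_E0 D.
have th0 := dd_th0 D.
have rT : - r <= T by apply: le_trans T0; rewrite oppr_le0 ltW.
have alth : al < 1 - al.
  by rewrite ltrBrDr -mulr2n -mulr_natl -ltr_pdivlMl// mulr1.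
pose s := noise_slope (m := m) T al mm be lam Ms S0 E.
pose sl := delay_slope T al L0 Kb Ce E.
have s0 : 0 <= s by exact: (noise_slope_ge0 DN E0).
have sl1 : 1 <= sl by exact: (delay_slope_ge1 D).
pose Kc := (T - - r) `^ (1 - al) + (T - - r) `^ (1 - al - al) / (1 - al - al).
have Kc0 : 0 <= Kc by rewrite addr_ge0 ?powR_ge0// divr_ge0 ?powR_ge0// subr_ge0 ltW.
pose A := sl ^+ k.+1 * (1 + s) ^+ k.
have sl0 := le_trans ler01 sl1.
have A0 : 0 <= A.
  by apply: mulr_ge0; [exact: exprn_ge0|rewrite exprn_ge0// addr_ge0].
exists (d%:R * (E + A * Kc)).
  by rewrite mulr_ge0// addr_ge0// mulr_ge0.
move=> g Cg Cg0 gC.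
have [hX [z [_ _ _ zS]]] := delay_iter_spec D DN r_gt0 Cg0 gC k.
have C0 := delay_const_ge0 D DN Cg0 k.
have xE : `|delay_iter r al sigma b eta g k (- r)| <= E.
  rewrite (solves_ode_neg T0 zS) ?lexx ?oppr_le0 ?(ltW r_gt0)//.
  by apply: (dd_etaE D); rewrite lexx oppr_le0 ltW.
apply: (le_trans (W0norm_holder al0 alth C0 hX (holder_on_bounded C0 (ltW th0) hX))).
rewrite lee_fin -mulrA ler_wpM2l//.
set x0 := `|_| in xE *; set C := delay_const _ _ _ _ _ _ _ _ _ _ _ _ _ in C0 *.
(* [1 + s Cg <= (1 + s) (1 + Cg)] separates the data from the driving path. *)
have CA : C <= A * (1 + Cg) ^+ k.
  rewrite /C /delay_const lerBlDr -/s -/sl.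
  apply: (@le_trans _ _ (A * (1 + Cg) ^+ k)); last by rewrite lerDl.
  rewrite /A -mulrA ler_wpM2l ?exprn_ge0// -exprMn.
  have sC0 : 0 <= s * Cg by exact: mulr_ge0.
  have s1 : 0 <= 1 + s by exact: addr_ge0.
  have Cg1 : 0 <= 1 + Cg by exact: addr_ge0.
  apply: lerXn2r; rewrite ?nnegrE; [exact: addr_ge0|exact: mulr_ge0|].
  have -> : (1 + s) * (1 + Cg) = 1 + s * Cg + (s + Cg) by ring.
  by rewrite lerDl addr_ge0.
have p1 : 1 <= (1 + Cg) ^+ k by rewrite exprn_ege1// lerDl.
have -> : x0 + C * (T - - r) `^ (1 - al) + C * ((T - - r) `^ (1 - al - al) / (1 - al - al)) =
  x0 + C * Kc by rewrite /Kc; ring.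
rewrite [X in _ <= X]mulrDl; apply: lerD.
  by rewrite (le_trans xE)// ler_peMr.
by rewrite mulrAC ler_wpM2r.
Qed.

Lemma delay_iter_moment {dO : measure_display} {Omega : measurableType dO}
    (P : probability Omega R) (X : Omega -> R -> V) (W : 'I_m -> R -> Omega -> R)
    (K : Omega -> R) (k q : nat) (p : R) :
  1 <= p -> p * k%:R <= (2 * q)%:R -> measurable_fun setT K -> (forall w, 0 <= K w) ->
  (\int[P]_w (K w ^+ (2 * q))%:E < +oo)%E ->
  {ae P, forall w j, holder_on 0 T (K w) lam (fun t => W j t w)} ->
  {ae P, forall w, X w = delay_iter r al sigma b eta (fun j t => W j t w) k} ->
  (\int[P]_w (W0norm al (- r) T (X w) `^ p) < +oo)%E.
Proof.
move=> p1 pq mK K0 iK aeK aeX; have p0 : 0 <= p by exact: le_trans p1.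
have [C C0 HC] := delay_iter_W0norm k.
pose c := C `^ p * 2 ^+ (2 * q).
have c0 : 0 <= c by rewrite mulr_ge0 ?powR_ge0 ?exprn_ge0.
have mKq : measurable_fun setT (fun w => (1 + K w ^+ (2 * q))%:E).
  by apply/measurable_EFinP; apply: measurable_funD => //; exact: measurable_funX.
have Kq0 w : (0 <= (1 + K w ^+ (2 * q))%:E)%E by rewrite lee_fin addr_ge0// exprn_ge0.
apply: (@le_lt_trans _ _ (\int[P]_w (c%:E * (1 + K w ^+ (2 * q))%:E))%E).
  apply: ge0_le_integral_ae.
  - exact: emeasurable_funM.
  - by move=> w; exact: poweR_ge0.
  - by move=> w; rewrite mule_ge0// lee_fin.
  apply: filterS2 aeK aeX => w gK ->.
  have h := HC _ _ (K0 w) gK.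
  have W0 : (0 <= W0norm al (- r) T (delay_iter r al sigma b eta (fun j t => W j t w) k))%E.
    rewrite /W0norm; apply: (@le_trans _ _ ((enorm (delay_iter r al sigma b eta
        (fun j t => W j t w) k (- r)))%:E +
      \int[lebesgue_measure]_(s in `[(- r)%R, (- r)%R[) (enorm
       (delay_iter r al sigma b eta (fun j t => W j t w) k (- r) -
       delay_iter r al sigma b eta (fun j t => W j t w) k s) / (- r - s) `^ (al + 1))%:E)%E).
      apply: adde_ge0; first by rewrite lee_fin enorm_ge0.
      by apply: integral_ge0 => s _; rewrite lee_fin divr_ge0 ?enorm_ge0 ?powR_ge0.
    apply: ereal_sup_ubound; exists (- r) => //=; rewrite in_itv/= lexx/=.
    by apply: le_trans (dd_T0 D); rewrite oppr_le0 ltW.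
  have Cp0 : 0 <= C * (1 + K w) ^+ k by rewrite mulr_ge0 ?exprn_ge0 ?addr_ge0.
  apply: (le_trans (gt0_ler_poweR p0 _ _ h)).
  - by rewrite in_itv/= W0 leey.
  - by rewrite in_itv/= lee_fin Cp0 leey.
  rewrite poweR_EFin -EFinM lee_fin powRM// ?exprn_ge0 ?addr_ge0// /c -mulrA.
  rewrite ler_wpM2l ?powR_ge0//.
  have -> : ((1 + K w) ^+ k) `^ p = (1 + K w) `^ (p * k%:R).
    by rewrite -powR_mulrn ?addr_ge0// -powRrM mulrC.
  (* The base is at least 1 and [p k <= 2 q]; then [1 + K] is at most [2 K] or 2, whence the factor
     [2^(2 q)] in [c]. *)
  apply: (@le_trans _ _ ((1 + K w) `^ (2 * q)%:R)).
    by apply: ler_powR => //; rewrite lerDl.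
  rewrite powR_mulrn ?addr_ge0//.
  have [k1|k1] := leP 1 (K w).
    apply: (@le_trans _ _ ((2 * K w) ^+ (2 * q))).
      by apply: lerXn2r; rewrite ?nnegrE ?addr_ge0 ?mulr_ge0//; lra.
    by rewrite exprMn ler_wpM2l ?exprn_ge0// lerDr.
  apply: (@le_trans _ _ (2 ^+ (2 * q))).
    by apply: lerXn2r; rewrite ?nnegrE ?addr_ge0//; lra.
  by rewrite ler_peMr ?exprn_ge0// lerDl exprn_ge0.
rewrite ge0_integralZl//.
have mKq' : measurable_fun setT (fun w => (K w ^+ (2 * q))%:E).
  by apply/measurable_EFinP; exact: measurable_funX.
have K0' w : (0 <= (K w ^+ (2 * q))%:E)%E by rewrite lee_fin exprn_ge0.
have -> : (\int[P]_w (1 + K w ^+ (2 * q))%:E = 1 + \int[P]_w (K w ^+ (2 * q))%:E)%E.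
  under eq_integral do rewrite EFinD.
  have m1 : measurable_fun setT (fun _ : Omega => 1%E : \bar R) by exact: measurable_cst.
  rewrite (ge0_integralD P measurableT _ m1 _ mKq')//.
  by congr (_ + _)%E; rewrite integral_cst//= mul1e; exact: probability_setT.
move: iK; have : (0 <= \int[P]_w (K w ^+ (2 * q))%:E)%E by exact: integral_ge0.
by case: (\int[P]_w _)%E => [x| |] // _ _; rewrite -EFinD -EFinM ltry.
Qed.

End delay_moments.

Theorem theorem1p1 (R : realType) (T r : R) (d m : nat) (H : R)
  (dO : measure_display) (Omega : measurableType dO) (P : probability Omega R)
  (W : 'I_m -> R -> Omega -> R) (beta delta rho : R)
  (sigma : R -> 'rV[R]_d -> 'M[R]_(d, m))
  (b : R -> (R -> 'rV[R]_d) -> 'rV[R]_d)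
  (alpha : R) (eta : R -> 'rV[R]_d) :
  let alpha0 := Num.min (2^-1) (Num.min beta (delta / (1 + delta))) in
  0 < T -> 0 < r -> (1 <= d)%N -> (1 <= m)%N ->
  2^-1 < H -> H < 1 ->
  measure_is_complete P ->
  (forall j, is_fBm P H T (W j)) -> independent_processes P T W ->
  0 < beta <= 1 -> 0 < delta <= 1 ->
  1 - H < beta -> H^-1 - 1 < delta -> 2 <= rho ->
  sigma_assumption T beta delta sigma ->
  b_assumption r T rho b ->
  1 - H < alpha -> alpha < alpha0 -> alpha^-1 <= rho ->
  W0space alpha (- r) 0 eta -> Holder (1 - alpha) (- r) 0 eta ->
  exists X : Omega -> R -> 'rV[R]_d,
    [/\ is_solution P W alpha r T b sigma eta X,
        forall Y : Omega -> R -> 'rV[R]_d,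
          is_solution P W alpha r T b sigma eta Y ->
          {ae P, forall w, forall t, - r <= t <= T -> Y w t = X w t},
        {ae P, forall w, Holder (1 - alpha) (- r) T (X w)} &
        forall gamma K0 : R,
          0 <= gamma <= 1 -> 0 < K0 ->
          (forall t x, 0 <= t <= T ->
             enorm (sigma t x) <= K0 * (1 + enorm x `^ gamma)) ->
          alpha < Num.min alpha0 ((2 - gamma) / 4) ->
          forall p : R, 1 <= p ->
            (\int[P]_w (W0norm alpha (- r) T (X w) `^ p) < +oo)%E].
Proof.
move=> alpha0 T0 r0 _ _ H2 H1 _ fW _ /andP[be0 _] _ _ _ _ sA bA Hal alal0 alrho _ etaH.
have [al2 albe] : alpha < 2^-1 /\ alpha < beta.
  by move: alal0; rewrite /alpha0 !lt_min => /and3P[].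
have al0 : 0 < alpha by apply: lt_trans Hal; rewrite subr_gt0.
have al1 : alpha < 1 by apply: lt_trans al2 _; rewrite invf_lt1// ltr1n.
have al01 : 0 < alpha < 1 by rewrite al0.
have [L0 [Kb [beta0 [L [Ce [E D]]]]]] := delay_dataP T0 r0 al01 alrho bA etaH.
have al02 : 0 < alpha < 2^-1 by rewrite al0.
have [Ms [S0 DN]] := noise_dataP T0 al02 albe Hal sA.
set mm := Num.min _ _ in DN; set lam := (_ + H) / 2 in DN.
have lamH : lam < H by rewrite /lam; lra.
have lam0 : 0 < lam by rewrite /lam; lra.
have th0 := dd_th0 D; have T0' := ltW T0.
have rT : - r <= T by apply: le_trans T0'; rewrite oppr_le0 ltW.
have alth : alpha < 1 - alpha by rewrite ltrBrDr -mulr2n -mulr_natl -ltr_pdivlMl// mulr1.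
have Hlam : 0 < H - lam by rewrite subr_gt0.
(* Kolmogorov's criterion holds for every large [q], so the moment order may also be prescribed from
   below. *)
have large (x : R) : exists2 q : nat, 1 < 2 * q%:R * (H - lam) & x <= (2 * q)%:R.
  exists (Num.trunc (`|x| + (H - lam)^-1)).+1.
    have h : 1 < (Num.trunc (`|x| + (H - lam)^-1)).+1%:R * (H - lam).
      rewrite -ltr_pdivrMr// div1r; apply: le_lt_trans (Num.Theory.truncnS_gt _).
      by rewrite lerDr.
    by apply: (lt_trans h); rewrite -mulrA ltr_pMl ?ltr1n// (lt_trans ltr01 h).
  rewrite natrM (le_trans (ler_norm x))//.
  apply: (@le_trans _ _ (Num.trunc (`|x| + (H - lam)^-1)).+1%:R).
    apply: le_trans (ltW (Num.Theory.truncnS_gt _)).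
    by rewrite lerDl invr_ge0 ltW.
  by rewrite ler_peMl// ler1n.
have [q0 q0H _] := large 0.
have [K [mK K0 _ [N [mN PN goodN]]]] := fBm_family_holder T0 lam0 fW q0H lamH.
(* Trajectories are set to 0 on the null set [N], so that the Hoelder bound and all its consequences
   hold for every [w], as the space and measurability clauses of [is_solution] require. *)
pose G (w : Omega) (j : 'I_m) (t : R) : R := \1_(~` N) w * W j t w.
have GE w : ~ N w -> G w = fun j t => W j t w.
  move=> Nw; apply/funext => j; apply/funext => t.
  by rewrite /G indicE mem_set ?mul1r.
have GK w j : holder_on 0 T (K w) lam (G w j).
  have [Nw|Nw] := pselect (N w).
    move=> s t _ _ _; rewrite /G indicE memNset; last by move=> /(_ Nw).
    by rewrite !mul0r subrr normr0 mulr_ge0 ?powR_ge0.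
  rewrite GE//; apply: contrapT => bad; apply: Nw; apply: goodN => /= h.
  by apply: bad; exact: h.
have mW t j : 0 <= t <= T -> measurable_fun setT (W j t).
  move=> tT; have [gW _ _ _] := fW j.
  by have [] := gaussian_process_law gW tT.
have mG t j : 0 <= t <= T -> measurable_fun setT (fun w => G w j t).
  move=> tT; apply: measurable_funM; last exact: mW.
  by apply: measurable_indic; exact: measurableC.
have [k kT] : exists k : nat, T <= k%:R * r.
  exists (Num.trunc (T / r)).+1; rewrite -ler_pdivrMr//.
  by rewrite ltW// Num.Theory.truncnS_gt.
pose X w := delay_iter r alpha sigma b eta (G w) k.+1.
pose KX w := delay_const (m := m) T alpha mm beta lam Ms S0 L0 Kb Ce E (K w) k.+1.
have KX0 w : 0 <= KX w by exact: (delay_const_ge0 D DN (K0 w)).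
have XK w : holder_on (- r) T (KX w) (1 - alpha) (X w).
  by have [] := delay_iter_spec D DN r0 (K0 w) (GK w) k.+1.
have mX t i : - r <= t <= T -> measurable_fun setT (fun w => X w t ord0 i).
  by move=> tT; exact: (delay_iter_measurable D DN r0 mK K0 GK mG).
have aeN : {ae P, forall w, ~ N w}.
  by exists N; split=> // w /= /contrapT.
have XS w : ~ N w -> solves_path alpha r T b sigma eta (fun j t => W j t w) (X w).
  move=> Nw; rewrite -(GE w Nw).
  apply: (solves_ode_solves_path D DN (KX0 w) (K0 w) (XK w) (GK w)).
  exact: (delay_iter_solves D DN r0 (K0 w) (GK w) kT).
exists X; split.
- split.
  + by move=> w; exact: (holder_on_W0cont al0 alth rT (KX0 w) (XK w)).
  + apply: (measurable_W0cont rT al0 alth _ XK mX).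
    by apply: measurable_delay_const.
  + by apply: filterS aeN => w; exact: XS.
(* Uniqueness is pathwise off [N]: both trajectories are continuous and solve the same deterministic
   equation. *)
- move=> Y [YW _ Ysol]; apply: filterS2 aeN Ysol => w Nw YS t tT.
  have [_ CY] := YW w; have CX := holder_on_Cspace rT (KX0 w) th0 (XK w).
  exact: (delay_unique D r0 CY CX (solves_path_solves_ode YS)
    (solves_path_solves_ode (XS w Nw)) tT).
- apply: aeW => w; apply: holder_on_Holder (XK w) _.
  exact: (holder_on_bounded (KX0 w) (ltW th0) (XK w)).
- move=> gamma K1 _ _ _ _ p p1.
  (* The norm of the solution is a polynomial of degree [k + 1] in the Hoelder constant. The
     constant [K] was built for one fixed order, so another one with a moment of order at least
     [p (k + 1)] is taken for the same trajectories. *)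
  have [q qH qp] := large (p * k.+1%:R).
  have [Kq [mKq Kq0 iKq aeKq]] := fBm_family_holder T0 lam0 fW qH lamH.
  apply: (delay_iter_moment D DN r0 al2 p1 qp mKq Kq0 iKq aeKq).
  by apply: filterS aeN => w Nw; rewrite /X GE.
Qed.
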